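(* Let $X$ be a compact metrizable Hausdorff space. The Cuntz homology $WW(C(X),\mathbb C)$ of $X$ is order isomorphic to the partially ordered abelian monoid $\mathrm{Mf}(X)$ of multiplicity functions on $X$.
   Context: $K$ denotes the $C^*$-algebra of compact operators on a separable infinite-dimensional Hilbert space. A c.p.c. order zero map $\phi:A\to B$ between $C^*$-algebras is a completely positive contractive linear map with $\phi(a)\phi(b)=0$ whenever $a,b\in A$ are positive and $ab=0$. For such maps $\phi,\psi:A\to B$ write $\phi\precsim\psi$ if there is a sequence $(b_n)$ in $B$ with $\|b_n^*\psi(a)b_n-\phi(a)\|\to0$ for every $a\in A$, and $\phi\sim\psi$ if $\phi\precsim\psi\precsim\phi$. $WW(A,B)$ is the set of $\sim$-classes of c.p.c. order zero maps $A\otimes K\to B\otimes K$, with addition $[\phi]+[\psi]=[\phi\,\hat\oplus\,\psi]$, where $(\phi\,\hat\oplus\,\psi)(a)=\phi(a)\oplus\psi(a)\in M_2(B\otimes K)\cong B\otimes K$, and order $[\phi]\le[\psi]$ iff $\phi\precsim\psi$. It is identified with the ordered monoid of $\sim$-classes of c.p.c. order zero maps $A\to B\otimes K$ via $[\phi]\mapsto[\phi\otimes\mathrm{id}_K]$ and $K\otimes K\cong K$. Let $\tilde{\mathbb N}_0=\mathbb N_0\cup\{\infty\}$. A multiplicity function on $X$ is a function $\nu:X\to\tilde{\mathbb N}_0$ whose support $\{x:\nu(x)\neq0\}$ is closed and which takes the value $\infty$ at every accumulation point of its support. $\mathrm{Mf}(X)$ is the set of multiplicity functions on $X$ with pointwise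 addition and pointwise order. *)

(* Defs.v *)
(* The reals are an arbitrary [R : realType], the complex numbers are [R[i]]. *)
From HB Require Import structures.
From mathcomp Require Import all_boot all_order all_algebra.
From mathcomp Require Import boolp classical_sets functions cardinality.
From mathcomp Require Import reals topology normedtype.
From mathcomp Require Import complex.
From mathcomp Require Import ring lra.

Set Implicit Arguments.
Unset Strict Implicit.
Unset Printing Implicit Defensive.

Import Order.TTheory GRing.Theory Num.Theory.
Import numFieldNormedType.Exports.

Local Open Scope classical_set_scope.
Local Open Scope complex_scope.
Local Open Scope ring_scope.

(* C*-algebras, not necessarily unital: [cmul] and [star] are the product and
   the involution, the norm is that of the complete normed module and takes its
   values in the nonnegative reals of [R[i]]. *)
HB.mixin Record CompleteNormedModule_isCstar (R : realType) A
    & CompleteNormedModule R[i] A := {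
  cmul : A -> A -> A;
  star : A -> A;
  cmulA : associative cmul;
  cmulDl : left_distributive cmul +%R;
  cmulDr : right_distributive cmul +%R;
  cmulZl : forall (k : R[i]) a b, cmul (k *: a) b = k *: cmul a b;
  cmulZr : forall (k : R[i]) a b, cmul a (k *: b) = k *: cmul a b;
  starK : involutive star;
  starD : forall a b, star (a + b) = star a + star b;
  starZ : forall (k : R[i]) a, star (k *: a) = Num.conj k *: star a;
  starM : forall a b, star (cmul a b) = cmul (star b) (star a);
  cnormM : forall a b, `|cmul a b| <= `|a| * `|b|;
  cstar_identity : forall a, `|cmul (star a) a| = `|a| ^+ 2
}.

#[short(type="cstarType")]
HB.structure Definition Cstar (R : realType) :=
  {A of CompleteNormedModule R[i] A & CompleteNormedModule_isCstar R A}.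

(* [hdot] is linear in its first argument; the last field says that the given
   complete norm is the one of the inner product. *)
Structure hilbertType (R : realType) := HilbertType {
  hilbert_sort :> completeNormedModType R[i];
  hdot : {dot hilbert_sort for Num.conj};
  hdot_norm : forall x, hdot x x = `|x| ^+ 2
}.

Definition separable (T : topologicalType) :=
  exists2 D : set T, countable D & dense D.

Definition infinite_dimensional (R : realType) (H : hilbertType R) :=
  forall n (v : 'I_n -> H), exists x : H,
    forall c : 'I_n -> R[i], x <> \sum_i c i *: v i.

Definition metrizable (R : realType) (X : topologicalType) :=
  exists d : X -> X -> R,
    [/\ forall x y, d x y = 0 <-> x = y,
        forall x y, d x y = d y x,
        forall x y z, d x z <= d x y + d y z &
        forall x (W : set X), nbhs x W <->
          exists2 e : R, 0 < e & [set y | d x y < e] `<=` W].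

(* The norm of a normed [R[i]]-module, read in [R] instead of [R[i]]. *)
Section rnorm.
Variables (R : realType) (V : normedZmodType R[i]).
Implicit Types x y : V.

Definition rnorm x : R := complex.Re `|x|.

Lemma rnormE x : `|x| = (rnorm x)%:C.
Proof.
rewrite /rnorm; have := normr_ge0 x; case: `|x| => a b.
by rewrite lecE /= => /andP[/eqP -> _].
Qed.

Lemma rnorm_ge0 x : 0 <= rnorm x.
Proof. by rewrite -ler0c -rnormE. Qed.

Lemma rnormD x y : rnorm (x + y) <= rnorm x + rnorm y.
Proof. by rewrite -lecR rmorphD /= -!rnormE ler_normD. Qed.

Lemma rnormN x : rnorm (- x) = rnorm x.
Proof. by rewrite /rnorm normrN. Qed.

Lemma rnormBC x y : rnorm (x - y) = rnorm (y - x).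
Proof. by rewrite /rnorm distrC. Qed.

Lemma rnorm0 : rnorm 0 = 0.
Proof. by rewrite /rnorm normr0. Qed.

Lemma rnorm_eq0 x : rnorm x = 0 -> x = 0.
Proof. by move=> x0; apply/eqP; rewrite -normr_eq0 rnormE x0. Qed.

Lemma rnormB3 x y z : rnorm (x - z) <= rnorm (x - y) + rnorm (y - z).
Proof. by rewrite (le_trans _ (rnormD _ _))// addrA subrK. Qed.

End rnorm.

Lemma rnormZ (R : realType) (V : normedModType R[i]) (k : R[i]) (x : V) :
  rnorm (k *: x) = rnorm k * rnorm x.
Proof.
by apply: complexI; rewrite rmorphM /= -!rnormE normrZ.
Qed.

Section supnorm.
Variables (R : realType) (V : normedModType R[i]) (I : Type) (D : set I).
Implicit Types f g : I -> V.

Definition supnorm f : R := sup [set rnorm (f i) | i in D].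

Definition bounded_fam f := exists M : R, forall i, D i -> rnorm (f i) <= M.

Lemma supnorm_ub f i : bounded_fam f -> D i -> rnorm (f i) <= supnorm f.
Proof.
move=> [M fM] Di; apply: sup_upper_bound; last by exists i.
split; first by exists (rnorm (f i)), i.
by exists M => _ [j Dj <-]; exact: fM.
Qed.

Lemma supnorm_le f M : 0 <= M -> (forall i, D i -> rnorm (f i) <= M) ->
  supnorm f <= M.
Proof.
move=> M0 fM; have [[i Di]|D0] := pselect (D !=set0).
  by apply: ge_sup; [exists (rnorm (f i)), i|move=> _ [j Dj <-]; exact: fM].
rewrite /supnorm (_ : [set _ | _ in _] = set0) ?sup0//.
by apply/seteqP; split=> // y [i Di]; case: D0; exists i.
Qed.

Lemma supnorm_ge0 f : bounded_fam f -> 0 <= supnorm f.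
Proof.
move=> fb; have [[i Di]|D0] := pselect (D !=set0).
  exact: le_trans (rnorm_ge0 _) (supnorm_ub fb Di).
rewrite /supnorm (_ : [set _ | _ in _] = set0) ?sup0//.
by apply/seteqP; split=> // y [i Di]; case: D0; exists i.
Qed.

Lemma supnormD f g : bounded_fam f -> bounded_fam g ->
  supnorm (fun i => f i + g i) <= supnorm f + supnorm g.
Proof.
move=> fb gb; apply: supnorm_le; first by rewrite addr_ge0 ?supnorm_ge0.
by move=> i Di; rewrite (le_trans (rnormD _ _))// lerD ?supnorm_ub.
Qed.

Lemma bounded_famZ k f : bounded_fam f -> bounded_fam (fun i => k *: f i).
Proof.
move=> [M fM]; exists (rnorm k * M) => i Di.
by rewrite rnormZ ler_wpM2l ?rnorm_ge0 ?fM.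
Qed.

Lemma supnormZ k f : bounded_fam f ->
  supnorm (fun i => k *: f i) = rnorm k * supnorm f.
Proof.
move=> fb.
have le_supZ l g : bounded_fam g ->
    supnorm (fun i => l *: g i) <= rnorm l * supnorm g.
  move=> gb; apply: supnorm_le.
    by rewrite mulr_ge0 ?rnorm_ge0 ?supnorm_ge0.
  by move=> i Di; rewrite rnormZ ler_wpM2l ?rnorm_ge0 ?supnorm_ub.
apply/eqP; rewrite eq_le le_supZ//=.
have [->|k0] := eqVneq k 0.
  by rewrite rnorm0 mul0r supnorm_ge0//; exact: bounded_famZ.
have := le_supZ k^-1 _ (bounded_famZ k fb).
rewrite (_ : (fun i => _) = f); last first.
  by apply/funext => i; rewrite scalerA mulVf// scale1r.
have rk0 : 0 < rnorm k.
  by rewrite lt_neqAle rnorm_ge0 andbT; apply: contra_neq k0 => /esym /rnorm_eq0.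
have -> : rnorm k^-1 = (rnorm k)^-1.
  by apply: complexI; rewrite fmorphV /= -!rnormE normfV.
by rewrite ler_pdivlMl.
Qed.

End supnorm.

Lemma gt0_complexE (R : realType) (e : R[i]) : 0 < e ->
  e = (complex.Re e)%:C /\ 0 < complex.Re e.
Proof.
by case: e => a b; rewrite ltcE /= => /andP[/eqP -> a0].
Qed.

Lemma ball_rnorm (R : realType) (V : normedModType R[i]) (x y : V) (e : R) :
  ball x e%:C y <-> rnorm (x - y) < e.
Proof. by rewrite -ball_normE /ball_ /= rnormE ltcR. Qed.

Lemma unif_limit (R : realType) (V : completeNormedModType R[i]) (I E : Type)
    (ev : E -> I -> V) (w : I -> R) (F : set_system E) :
  ProperFilter F -> (forall i, 0 <= w i) ->
  (forall e : R, 0 < e ->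
     exists u0, F [set u | forall i, rnorm (ev u0 i - ev u i) <= e * w i]) ->
  exists g : I -> V, forall e : R, 0 < e ->
    F [set u | forall i, rnorm (g i - ev u i) <= e * w i].
Proof.
move=> PF w0 cF.
have cvgF i : cvg ((ev^~ i) @ F).
  apply: cauchy_cvg; apply/cauchy_exP => ee /gt0_complexE[-> e0].
  set e := complex.Re ee in e0 *.
  have w1 : 0 < w i + 1 by rewrite ltr_wpDl.
  have [u0 Fu0] := cF (e / (w i + 1)) (divr_gt0 e0 w1).
  exists (ev u0 i).
  suff : F [set u | ball (ev u0 i) e%:C (ev u i)] by [].
  apply: filterS Fu0 => u /(_ i) uu0.
  apply/ball_rnorm; apply: le_lt_trans uu0 _.
  by rewrite mulrAC ltr_pdivrMr// ltr_pM2l// ltrDl.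
exists (fun i => lim ((ev^~ i) @ F)) => e e0.
have e20 : 0 < e / 2 by rewrite divr_gt0.
have [u0 Fu0] := cF (e / 2) e20.
apply: filterS (Fu0) => u uu0 i.
rewrite (le_trans (rnormB3 _ (ev u0 i) _))//.
rewrite [e](splitr e) mulrDl lerD//.
apply/ler_addgt0Pl => d d0.
have dC : 0 < d%:C by rewrite ltcR.
have Fd : F [set u | rnorm (lim ((ev^~ i) @ F) - ev u i) < d].
  have /cvg_ballP/(_ _ dC) := cvgF i.
  by apply: filterS => v /ball_rnorm.
have [v [/= vd vu0]] := filter_ex (filterI Fd Fu0).
rewrite (le_trans (rnormB3 _ (ev v i) _))// lerD//; first exact: ltW.
by rewrite rnormBC vu0.
Qed.

Lemma unif_complete (R : realType) (V : completeNormedModType R[i]) (I : Type)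
    (E : normedModType R[i]) (ev : E -> I -> V) (w : I -> R) :
  (forall i, 0 <= w i) ->
  (forall u v i, rnorm (ev u i - ev v i) <= rnorm (u - v) * w i) ->
  (forall (u v : E) M, 0 <= M ->
     (forall i, rnorm (ev u i - ev v i) <= M * w i) -> rnorm (u - v) <= M) ->
  (forall g : I -> V, (forall e : R, 0 < e ->
     exists u, forall i, rnorm (g i - ev u i) <= e * w i) ->
     exists u, ev u = g) ->
  forall F : set_system E, ProperFilter F -> cauchy F -> cvg F.
Proof.
move=> w0 evB evn evc F PF /cauchyP cF.
have [|g Fg] := @unif_limit R V I E ev w F PF w0.
  move=> e e0; have eC : 0 < e%:C :> R[i] by rewrite ltcR.
  have [u0 Fu0] := cF _ eC; exists u0; apply: filterS Fu0 => u /ball_rnorm uu0 i.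
  by rewrite (le_trans (evB _ _ _))// ler_wpM2r// ltW.
have [|u ug] := evc g; first by move=> e e0; exact: filter_ex (Fg e e0).
apply/cvg_ex; exists u; apply/cvg_ballP => ee /gt0_complexE[-> e0].
set e := complex.Re ee in e0 *.
have e20 : 0 < e / 2 by rewrite divr_gt0.
apply: filterS (Fg _ e20) => v gv; apply/ball_rnorm.
rewrite (@le_lt_trans _ _ (e / 2))//; last by rewrite ltr_pdivrMr// ltr_pMr// ltr1n.
by apply: evn (ltW e20) _ => i; rewrite ug.
Qed.

Section Hilbert.
Variables (R : realType) (H : hilbertType R).
Implicit Types (x y z v : H) (t : R).
Local Notation "''[' x , y ]" := (hdot H x y) : ring_scope.

Definition hre x y : R := complex.Re '[x, y].

Lemma hdotC x y : '[x, y] = Num.conj '[y, x].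
Proof. by rewrite (hermC (hdot H)) expr0 mul1r. Qed.

Lemma hreC x y : hre x y = hre y x.
Proof. by rewrite /hre hdotC; case: '[y, x]. Qed.

Lemma hreDl x y z : hre (x + y) z = hre x z + hre y z.
Proof. by rewrite /hre linearDl /=; case: '[x, z]; case: '[y, z]. Qed.

Lemma hreDr x y z : hre z (x + y) = hre z x + hre z y.
Proof. by rewrite hreC hreDl !(hreC _ z). Qed.

Lemma hreZl t x y : hre (t%:C *: x) y = t * hre x y.
Proof.
rewrite /hre linearZl_LR /=; case: '[x, y] => a b.
by rewrite /GRing.mul /= mul0r subr0.
Qed.

Lemma hreZr t x y : hre y (t%:C *: x) = t * hre y x.
Proof. by rewrite hreC hreZl hreC. Qed.

Lemma hreNl x y : hre (- x) y = - hre x y.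
Proof. by have := hreZl (-1) x y; rewrite rmorphN /= scaleN1r mulN1r. Qed.

Lemma hreNr x y : hre y (- x) = - hre y x.
Proof. by rewrite hreC hreNl hreC. Qed.

Lemma hreZi x y : hre ('i *: x) y = - complex.Im '[x, y].
Proof.
rewrite /hre linearZl_LR /=; case: '[x, y] => a b.
by rewrite /GRing.mul /= mul0r mul1r sub0r.
Qed.

Lemma hre_norm x : hre x x = rnorm x ^+ 2.
Proof. by apply: complexI; rewrite /hre hdot_norm rnormE -rmorphXn. Qed.

Lemma hdot_eq x y : (forall v, hre v x = hre v y) -> forall v, '[v, x] = '[v, y].
Proof.
move=> xy v; have := xy ('i *: v); have := xy v; rewrite !hreZi /hre.
by case: '[v, x] => a b; case: '[v, y] => c d /= -> /oppr_inj ->.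
Qed.

Lemma hdotI x y : (forall v, hre v x = hre v y) -> x = y.
Proof.
move=> xy; apply/eqP; rewrite -subr_eq0; apply/eqP/rnorm_eq0/eqP.
by rewrite -sqrf_eq0 -hre_norm hreDr hreNr xy subrr.
Qed.

Lemma rnormD2 x y : rnorm (x + y) ^+ 2 = rnorm x ^+ 2 + 2 * hre x y + rnorm y ^+ 2.
Proof. by rewrite -!hre_norm hreDl !hreDr (hreC y x); ring. Qed.

Lemma quad_ge0 (a b : R) : 0 <= b ->
  (forall t, 0 <= 2 * t * a + t ^+ 2 * b) -> a = 0.
Proof.
move=> b0 ab; apply/eqP; rewrite -sqrf_eq0 eq_le sqr_ge0 andbT.
have b1 : 0 < b + 1 by rewrite ltr_wpDl.
have := ab (- a / (b + 1)).
have -> : 2 * (- a / (b + 1)) * a + (- a / (b + 1)) ^+ 2 * b =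
  - (a ^+ 2 * (b + 2)) / (b + 1) ^+ 2 by field; rewrite gt_eqF.
rewrite ler_pdivlMr ?exprn_gt0// mul0r oppr_ge0.
by rewrite pmulr_lle0//; lra.
Qed.

Lemma hre_le x y : `|hre x y| <= rnorm x * rnorm y.
Proof.
rewrite -ler_sqr ?nnegrE ?mulr_ge0 ?rnorm_ge0// exprMn real_normK ?num_real//.
have [y0|y0] := eqVneq (rnorm y) 0.
  have h0 : hre x 0 = 0 by have := hreDr 0 0 x; rewrite addr0; lra.
  by rewrite (rnorm_eq0 y0) h0 rnorm0 expr0n mulr0.
have yp : 0 < rnorm y ^+ 2 by rewrite exprn_gt0// lt_neqAle eq_sym y0 rnorm_ge0.
have := hre_norm (x + (- hre x y / rnorm y ^+ 2)%:C *: y).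
rewrite hreDl !hreDr !hreZl !hreZr !hre_norm (hreC y x) => e.
have : 0 <= rnorm x ^+ 2 - hre x y ^+ 2 / rnorm y ^+ 2.
  have := sqr_ge0 (rnorm (x + (- hre x y / rnorm y ^+ 2)%:C *: y)).
  rewrite -e; congr (_ <= _); field.
  exact: y0.
by rewrite subr_ge0 ler_pdivrMr.
Qed.

Lemma riesz (f : H -> R[i]) (M : R) :
  (forall k x y, f (k *: x + y) = k * f x + f y) ->
  (forall x, `|complex.Re (f x)| <= M * rnorm x) ->
  exists z, forall x, f x = '[x, z].
Proof.
move=> flin fM.
pose g x := complex.Re (f x).
have f0 : f 0 = 0.
  by have := flin 1 0 0; rewrite scale1r add0r mul1r => /eqP; rewrite -subr_eq subrr eq_sym => /eqP.
have gD x y : g (x + y) = g x + g y.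
  by rewrite /g -[x in LHS]scale1r flin mul1r; case: (f x); case: (f y).
have gZ t x : g (t%:C *: x) = t * g x.
  rewrite /g -[X in f X]addr0 flin f0 addr0; case: (f x) => a b.
  by rewrite /GRing.mul /= mul0r subr0.
have gi x : g ('i *: x) = - complex.Im (f x).
  rewrite /g -[X in f X]addr0 flin f0 addr0; case: (f x) => a b.
  by rewrite /GRing.mul /= mul0r mul1r sub0r.
pose J x := rnorm x ^+ 2 - 2 * g x.
have Jlb x : - M ^+ 2 <= J x.
  have := fM x; rewrite ler_norml => /andP[_ gM].
  have := sqr_ge0 (rnorm x - M); rewrite /J /g; lra.
pose S := range J; pose m := inf S.
have Sinf : has_inf S.
  by split; [exists (J 0), 0|exists (- M ^+ 2) => _ [x _ <-]].
have mJ x : m <= J x by apply: ge_inf; [case: Sinf|exists x].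
pose A (e : R) := [set x | J x < m + e].
pose F := filter_from [set e : R | 0 < e] A.
have FF : ProperFilter F.
  apply: filter_from_proper.
    apply: filter_from_filter; first by exists 1; exact: ltr01.
    move=> e1 e2 /= e10 e20; exists (Order.min e1 e2); first by rewrite /= lt_min e10.
    by move=> x; rewrite /A /=; rewrite -!ltrBlDl lt_min => /andP[].
  move=> e /= e0; have [_ [x _ <-] xm] := inf_adherent e0 Sinf.
  by exists x.
have AB e x y : A e x -> A e y -> rnorm (x - y) ^+ 2 <= 4 * e.
  rewrite /A /= => Jx Jy.
  have := mJ ((1 / 2)%:C *: (x + y)).
  rewrite /J -hre_norm hreZl hreZr hre_norm gZ gD rnormD2.
  rewrite rnormD2 rnormN hreNr; move: Jx Jy; rewrite /J; lra.
have cF : cvg F.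
  apply: cauchy_cvg; apply/cauchy_exP => ee /gt0_complexE[-> e0].
  set e := complex.Re ee in e0 *.
  have d0 : 0 < e ^+ 2 / 8 by rewrite divr_gt0// exprn_gt0.
  have Fd : F (A (e ^+ 2 / 8)) by exists (e ^+ 2 / 8).
  have [x Ax] := filter_ex Fd.
  exists x; apply: filterS Fd => y Ay; apply/ball_rnorm.
  rewrite -ltr_sqr ?nnegrE ?rnorm_ge0 ?ltW//.
  by have := AB _ _ _ Ax Ay; have := exprn_gt0 2 e0; lra.
pose z := lim F; exists z; move=> x.
suff gz v : g v = hre v z.
  have := gz x; have := gz ('i *: x); rewrite gi hreZi => /oppr_inj.
  by rewrite /g /hre; case: (f x) => a b; case: '[x, z] => c d /= -> ->.
suff : hre v z - g v = 0 by move/eqP; rewrite subr_eq0 => /eqP.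
apply: (@quad_ge0 _ (rnorm v ^+ 2)); first exact: sqr_ge0.
move=> t; apply/ler_addgt0Pl => e e0.
pose d := e / 2 / (2 * `|t| * rnorm v + 1).
have D0 : 0 < 2 * `|t| * rnorm v + 1 by rewrite ltr_wpDl// !mulr_ge0 ?rnorm_ge0.
have d0 : 0 < d by rewrite !divr_gt0.
have dC : 0 < d%:C :> R[i] by rewrite ltcR.
have F1 : F [set y | ball z d%:C y] by apply: cF; exact: nbhsx_ballx.
have F2 : F (A (e / 2)) by exists (e / 2) => //=; rewrite divr_gt0.
have [y [/= /ball_rnorm zy Jy]] := filter_ex (filterI F1 F2).
have := mJ (y + t%:C *: v).
rewrite /J rnormD2 hreZr -(hre_norm (_ *: _)) hreZl hreZr hre_norm gD gZ.
move: Jy; rewrite /A /J /= => Jy mJy.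
have h1 : `|hre v (y - z)| <= rnorm v * d.
  rewrite (le_trans (hre_le _ _))// ler_wpM2l ?rnorm_ge0//.
  by rewrite rnormBC ltW.
have h2 : t * hre v (y - z) <= `|t| * (rnorm v * d).
  by rewrite (le_trans (ler_norm _))// normrM ler_wpM2l.
have h3 : 2 * `|t| * rnorm v * d <= e / 2.
  rewrite /d mulrCA ger_pMr ?divr_gt0// ler_pdivrMr// mul1r; lra.
have h4 : hre v (y - z) = hre y v - hre v z by rewrite hreDr hreNr (hreC y).
move: h2 h3; rewrite h4; move: Jy mJy.
set a := hre y v; set b := hre v z; set n := rnorm v.
lra.
Qed.

End Hilbert.

Section TotallyBounded.
Variables (R : realType) (V : completeNormedModType R[i]).
Implicit Types (A : set V).

Definition tbdd A := forall e : R, 0 < e ->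
  exists s : seq V, forall x, A x -> exists2 y, y \in s & rnorm (x - y) <= e.

Lemma ultra_bigcup (F : set_system V) (s : seq V) (B : V -> set V) :
  UltraFilter F -> F [set x | exists2 y, y \in s & B y x] ->
  exists y, F (B y).
Proof.
move=> UF; elim: s => [|y s IHs].
  by move=> F0; have [x [//]] := filter_ex F0.
move=> Fs; have [FB|FB] := in_ultra_setVsetC (B y) UF; first by exists y.
apply: IHs; apply: filterS (filterI Fs FB) => x [/= [z]].
by rewrite inE => /predU1P[->|zs] Bz nB //; exists z.
Qed.

Lemma precompact_tbdd A : precompact A <-> tbdd A.
Proof.
rewrite precompactE; split.
  rewrite compact_cover => cA e e0.
  have eC : 0 < e%:C :> R[i] by rewrite ltcR.
  have [|x Ax|D _ AD] := cA V setT (fun x => ball x e%:C).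
  - by move=> x _; exact: ball_open.
  - by exists x => //; exact: ballxx.
  exists (finmap.enum_fset D) => x Ax.
  have [y yD /ball_rnorm yx] := AD _ (subset_closure Ax).
  by exists y => //; rewrite rnormBC ltW.
move=> tA; rewrite compact_ultra => F UF FA.
suff cF : cvg F.
  exists (lim F); split=> //.
  apply: (@closed_cvg _ _ F _ id) => //; first exact: closed_closure.
apply: cauchy_cvg; apply/cauchy_exP => ee /gt0_complexE[-> e0].
set e := complex.Re ee in e0 *.
have e30 : 0 < e / 3 by rewrite divr_gt0.
have [s As] := tA _ e30.
have [|y Fy] := @ultra_bigcup F s (fun y => ball y e%:C) UF; last by exists y.
apply: filterS FA => x cAx.
have eC : 0 < (e / 3)%:C :> R[i] by rewrite ltcR.
have [a [Aa /ball_rnorm xa]] := cAx _ (nbhsx_ballx x _ eC).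
have [y ys ay] := As _ Aa.
exists y => //; apply/ball_rnorm; rewrite rnormBC.
by rewrite (le_lt_trans (rnormB3 _ a _))//; lra.
Qed.

End TotallyBounded.

Section CompactMaps.
Variables (R : realType) (H : hilbertType R).
Implicit Types (f g : H -> H) (x y : H).

Definition compact_map f := precompact (f @` [set x | `|x| <= 1]).

Lemma unit_ballE x : (`|x| <= 1 :> R[i]) = (rnorm x <= 1).
Proof. by rewrite rnormE -lecR. Qed.

Lemma compact_mapP f : compact_map f <-> forall e : R, 0 < e ->
  exists s : seq H, forall x, rnorm x <= 1 ->
    exists2 y, y \in s & rnorm (f x - y) <= e.
Proof.
rewrite /compact_map precompact_tbdd; split=> ft e e0; have [s fs] := ft e e0; exists s.
  by move=> x x1; apply: fs; exists x => //=; rewrite unit_ballE.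
by move=> _ [x /= x1 <-]; apply: fs; rewrite -unit_ballE.
Qed.

Lemma linear_mapD f : linear f -> forall x y, f (x + y) = f x + f y.
Proof. by move=> fl x y; have := fl 1 x y; rewrite !scale1r. Qed.

Lemma linear_map0 f : linear f -> f 0 = 0.
Proof.
by move=> fl; have /eqP := linear_mapD fl 0 0; rewrite addr0 eq_sym -subr_eq0 addrK => /eqP.
Qed.

Lemma linear_mapZ f : linear f -> forall k x, f (k *: x) = k *: f x.
Proof. by move=> fl k x; have := fl k x 0; rewrite /= (linear_map0 fl) !addr0. Qed.

Lemma linear_mapB f : linear f -> forall x y, f (x - y) = f x - f y.
Proof.
by move=> fl x y; rewrite (linear_mapD fl) -scaleN1r (linear_mapZ fl) scaleN1r.
Qed.

Lemma compact_map_bounded f : linear f -> compact_map f ->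
  exists2 M : R, 0 <= M & forall x, rnorm (f x) <= M * rnorm x.
Proof.
move=> fl /compact_mapP/(_ 1 ltr01)[s fs].
pose M : R := 1 + \sum_(y <- s) rnorm y.
have M0 : 0 <= M by rewrite addr_ge0// sumr_ge0// => i _; exact: rnorm_ge0.
have le_s y : y \in s -> rnorm y <= \sum_(y <- s) rnorm y.
  elim: s {fs M M0} => // a s IHs; rewrite inE big_cons => /predU1P[->|/IHs ys].
    by rewrite lerDl sumr_ge0// => i _; exact: rnorm_ge0.
  by rewrite (le_trans ys)// lerDr rnorm_ge0.
exists M => // x; have [x0|x0] := eqVneq x 0.
  by rewrite x0 (linear_map0 fl) rnorm0 mulr0.
have rx : 0 < rnorm x.
  by rewrite lt_neqAle rnorm_ge0 andbT eq_sym; apply: contra_neq x0; exact: rnorm_eq0.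
pose u := ((rnorm x)^-1)%:C *: x.
have rk (t : R) : 0 <= t -> rnorm (t%:C : R[i]) = t.
  by move=> t0; apply: complexI; rewrite -rnormE ger0_norm// ler0c.
have ri : 0 <= (rnorm x)^-1 by rewrite invr_ge0 ltW.
have u1 : rnorm u <= 1 by rewrite rnormZ (rk _ ri) mulVf// gt_eqF.
have [y ys fuy] := fs _ u1.
have fu : rnorm (f u) <= M.
  by rewrite -(subrK y (f u)) (le_trans (rnormD _ _))// lerD// le_s.
move: fu; rewrite (linear_mapZ fl) rnormZ (rk _ ri).
by rewrite mulrC ler_pdivrMr.
Qed.

Lemma compact_map0 : compact_map (fun=> 0).
Proof.
by apply/compact_mapP => e e0; exists [:: 0] => x _; exists 0; rewrite ?inE// subrr rnorm0 ltW.
Qed.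

Lemma compact_mapD f g : compact_map f -> compact_map g ->
  compact_map (fun x => f x + g x).
Proof.
move=> /compact_mapP fc /compact_mapP gc; apply/compact_mapP => e e0.
have e20 : 0 < e / 2 by rewrite divr_gt0.
have [s fs] := fc _ e20; have [t gt] := gc _ e20.
exists [seq y + z | y <- s, z <- t] => x x1.
have [y ys xy] := fs _ x1; have [z zt xz] := gt _ x1.
exists (y + z); first by apply/allpairsP; exists (y, z).
by rewrite opprD addrACA (le_trans (rnormD _ _))//; lra.
Qed.

Lemma compact_mapZ k f : compact_map f -> compact_map (fun x => k *: f x).
Proof.
move=> /compact_mapP fc; apply/compact_mapP => e e0.
have k1 : 0 < rnorm k + 1 by rewrite ltr_wpDl ?rnorm_ge0.
have [s fs] := fc _ (divr_gt0 e0 k1).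
exists (map (GRing.scale k) s) => x x1; have [y ys xy] := fs _ x1.
exists (k *: y); first exact: map_f.
rewrite -scalerBr rnormZ (le_trans (ler_wpM2l (rnorm_ge0 k) xy))//.
by rewrite mulrA ler_pdivrMr// mulrC ler_wpM2l ?ltW// ltrDl.
Qed.

Lemma compact_map_comp f g (M : R) : linear f -> 0 <= M ->
  (forall x, rnorm (f x) <= M * rnorm x) -> compact_map g ->
  compact_map (f \o g).
Proof.
move=> fl M0 fM /compact_mapP gc; apply/compact_mapP => e e0.
have M1 : 0 < M + 1 by rewrite ltr_wpDl.
have [s gs] := gc _ (divr_gt0 e0 M1).
exists (map f s) => x x1; have [y ys xy] := gs _ x1.
exists (f y); first exact: map_f.
rewrite /= -(linear_mapB fl) (le_trans (fM _))// (le_trans (ler_wpM2l M0 xy))//.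
by rewrite mulrA ler_pdivrMr// mulrC ler_wpM2l ?ltW// ltrDl.
Qed.

Lemma compact_map_lim f : (forall e : R, 0 < e -> exists g,
    [/\ linear g, compact_map g & forall x, rnorm (f x - g x) <= e * rnorm x]) ->
  linear f /\ compact_map f.
Proof.
move=> flim; split.
  move=> k x y; apply/eqP; rewrite -subr_eq0; apply/eqP/rnorm_eq0/eqP.
  rewrite eq_le rnorm_ge0 andbT; apply/ler_addgt0Pl => e e0; rewrite addr0.
  pose N := rnorm (k *: x + y) + rnorm k * rnorm x + rnorm y + 1.
  have N0 : 0 < N by rewrite ltr_wpDl// !addr_ge0 ?mulr_ge0 ?rnorm_ge0.
  have [g [gl _ fg]] := flim _ (divr_gt0 e0 N0).
  have -> : f (k *: x + y) - (k *: f x + f y) =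
    (f (k *: x + y) - g (k *: x + y)) + (k *: (g x - f x) + (g y - f y)).
    rewrite (linear_mapD gl) (linear_mapZ gl) scalerBr.
    by rewrite [_ - _ + (_ - _)]addrACA -opprD addrA subrK.
  have h1 := fg (k *: x + y); have h2 := fg x; have h3 := fg y.
  rewrite (le_trans (rnormD _ _))// (le_trans (lerD h1 (rnormD _ _)))//.
  rewrite rnormZ !(rnormBC (g _)).
  have h4 := ler_wpM2l (rnorm_ge0 k) h2.
  have h5 : e / N * N = e by rewrite divfK ?gt_eqF.
  have h6 : 0 <= e / N by rewrite divr_ge0 ?ltW.
  rewrite -[leRHS]h5 /N; move: h3 h4 h6.
  by set d := e / _; lra.
apply/compact_mapP => e e0; have e20 : 0 < e / 2 by rewrite divr_gt0.
have [g [_ /compact_mapP gc fg]] := flim _ e20.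
have [s gs] := gc _ e20; exists s => x x1; have [y ys gy] := gs _ x1; exists y => //.
rewrite (le_trans (rnormB3 _ (g x) _))// (le_trans (lerD (fg x) gy))//.
have := ler_wpM2l (ltW e20) x1; lra.
Qed.

Definition adjoint_of f g := forall x y, hdot H (f x) y = hdot H x (g y).

Lemma adjoint_exists f (M : R) : linear f -> 0 <= M ->
  (forall x, rnorm (f x) <= M * rnorm x) -> exists g, adjoint_of f g.
Proof.
move=> fl M0 fM.
have ex y : {z | forall x, hdot H (f x) y = hdot H x z}.
  apply: cid; apply: (@riesz _ _ (fun x => hdot H (f x) y) (M * rnorm y)).
    by move=> k u v; rewrite fl linearDl /= linearZl_LR.
  move=> x; rewrite (le_trans (hre_le _ _))// mulrAC.
  by rewrite ler_wpM2r ?rnorm_ge0.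
by exists (fun y => sval (ex y)) => x y; case: (ex y).
Qed.

Lemma adjoint_hre f g : adjoint_of f g -> forall x y, hre (f x) y = hre x (g y).
Proof. by move=> fg x y; rewrite /hre fg. Qed.

Lemma adjoint_sym f g : adjoint_of f g -> adjoint_of g f.
Proof. by move=> fg x y; rewrite hdotC -fg -hdotC. Qed.

Lemma adjoint_uniq f g h : adjoint_of f g -> adjoint_of f h -> g = h.
Proof.
move=> fg fh; apply/funext => y; apply: hdotI => v.
by rewrite -(adjoint_hre fg) -(adjoint_hre fh).
Qed.

Lemma adjoint_linear f g : adjoint_of f g -> linear g.
Proof.
move=> fg k x y; apply: hdotI => v; rewrite /hre.
by rewrite -fg !linearDr /= !linearZr_LR /= -!fg.
Qed.

Lemma adjoint_le f g (M : R) : 0 <= M -> adjoint_of f g ->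
  (forall x, rnorm (f x) <= M * rnorm x) ->
  forall y, rnorm (g y) <= M * rnorm y.
Proof.
move=> M0 fg fM y; have [g0|g0] := eqVneq (rnorm (g y)) 0.
  by rewrite g0 mulr_ge0 ?rnorm_ge0.
have gp : 0 < rnorm (g y) by rewrite lt_neqAle eq_sym g0 rnorm_ge0.
rewrite -(ler_pM2l gp) -expr2 -hre_norm -(adjoint_hre fg).
rewrite (le_trans (ler_norm _))// (le_trans (hre_le _ _))//.
by rewrite mulrA (mulrC _ M) ler_wpM2r ?rnorm_ge0.
Qed.

Lemma adjoint_compact f g : linear f -> compact_map f -> adjoint_of f g ->
  compact_map g.
Proof.
move=> fl fc fg; have [M M0 fM] := compact_map_bounded fl fc.
have gl := adjoint_linear fg; have gM := adjoint_le M0 fg fM.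
move/compact_mapP : fc => fc; apply/compact_mapP => e e0.
have M1 : 0 < M + 1 by rewrite ltr_wpDl.
pose d := e ^+ 2 / 4; have d0 : 0 < d by rewrite divr_gt0// exprn_gt0.
have [s fs] := fc _ (divr_gt0 d0 M1).
have rk (t : R) : 0 <= t -> rnorm (t%:C : R[i]) = t.
  by move=> t0; apply: complexI; rewrite -rnormE ger0_norm// ler0c.
pose near_pt (w : H) := [set x | rnorm x <= 1 /\
   rnorm (f (g x) - (M + 1)%:C *: w) <= d].
exists [seq g (xget 0 (near_pt w)) | w <- s] => x x1.
have gx1 : rnorm (((M + 1)^-1)%:C *: g x) <= 1.
  rewrite rnormZ rk; last by rewrite invr_ge0 ltW.
  rewrite ler_pdivrMl// mulr1.
  rewrite (le_trans (gM x))// (le_trans (ler_wpM2l M0 x1))//; lra.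
have [w ws xw] := fs _ gx1.
have xN : near_pt w x.
  split=> //.
  have -> : f (g x) - (M + 1)%:C *: w =
      (M + 1)%:C *: (f (((M + 1)^-1)%:C *: g x) - w).
    rewrite (linear_mapZ fl) scalerBr scalerA -rmorphM /= mulfV ?gt_eqF//.
    by rewrite scale1r.
  by rewrite rnormZ (rk _ (ltW M1)) mulrC -ler_pdivlMr.
exists (g (xget 0 (near_pt w))); first by apply/mapP; exists w.
have [] := xgetPex 0 (ex_intro _ x xN); set u := xget _ _ => u1 uN.
rewrite -(linear_mapB gl) -ler_sqr ?nnegrE ?rnorm_ge0 ?(ltW e0)// -hre_norm.
rewrite -(adjoint_hre fg).
rewrite (le_trans (ler_norm _))// (le_trans (hre_le _ _))//.
have [_ xN2] := xN.
have h1 : rnorm (f (g (x - u))) <= 2 * d.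
  rewrite (linear_mapB gl) (linear_mapB fl) (le_trans (rnormB3 _ ((M + 1)%:C *: w) _))//.
  by rewrite (rnormBC (_ *: _)); lra.
have h2 : rnorm (x - u) <= 2.
  by rewrite (le_trans (rnormD _ _))// rnormN; lra.
rewrite (le_trans (ler_pM _ _ h1 h2)) ?rnorm_ge0//; rewrite /d; lra.
Qed.

End CompactMaps.

(* K(H), with the operator norm and, as involution, the Hilbert space adjoint
   (see [op_starP]). *)
Record compactOp (R : realType) (H : hilbertType R) := CompactOp {
  op_fun :> H -> H;
  op_linear : linear op_fun;
  op_compact : compact_map op_fun
}.

Section CompactOp.
Variables (R : realType) (H : hilbertType R).
Local Notation K := (compactOp H).
Implicit Types (S T : K) (x y : H).

Lemma opP S T : (forall x, S x = T x) -> S = T.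
Proof.
case: S T => [f fl fc] [g gl gc] /= /funext fg; rewrite fg in fl fc *.
by congr CompactOp; exact: Prop_irrelevance.
Qed.

HB.instance Definition _ := gen_eqMixin K.
HB.instance Definition _ := gen_choiceMixin K.

Lemma op_zero_linear : linear ((fun=> 0) : H -> H).
Proof. by move=> k x y; rewrite scaler0 addr0. Qed.

Definition op_zero : K := CompactOp op_zero_linear (@compact_map0 R H).

Lemma op_add_linear S T : linear ((fun x => S x + T x) : H -> H).
Proof. by move=> k x y; rewrite !op_linear scalerDr addrACA. Qed.

Definition op_add S T : K :=
  CompactOp (@op_add_linear S T) (compact_mapD (op_compact S) (op_compact T)).

Lemma op_scale_linear k S : linear ((fun x => k *: S x) : H -> H).
Proof. by move=> l x y; rewrite op_linear scalerDr !scalerA mulrC. Qed.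

Definition op_scale k S : K :=
  CompactOp (@op_scale_linear k S) (compact_mapZ k (op_compact S)).

Lemma op_addA : associative op_add.
Proof. by move=> S T U; apply: opP => x /=; rewrite addrA. Qed.

Lemma op_addC : commutative op_add.
Proof. by move=> S T; apply: opP => x /=; rewrite addrC. Qed.

Lemma op_add0 : left_id op_zero op_add.
Proof. by move=> S; apply: opP => x /=; rewrite add0r. Qed.

Lemma op_addN : left_inverse op_zero (op_scale (-1)) op_add.
Proof. by move=> S; apply: opP => x /=; rewrite scaleN1r addNr. Qed.

HB.instance Definition _ := GRing.isZmodule.Build K op_addA op_addC op_add0 op_addN.

Lemma op_scaleA k l S : op_scale k (op_scale l S) = op_scale (k * l) S.
Proof. by apply: opP => x /=; rewrite scalerA. Qed.

Lemma op_scale1 : left_id 1 op_scale.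
Proof. by move=> S; apply: opP => x /=; rewrite scale1r. Qed.

Lemma op_scaleDr : right_distributive op_scale +%R.
Proof. by move=> k S T; apply: opP => x /=; rewrite scalerDr. Qed.

Lemma op_scaleDl S : {morph op_scale^~ S : k l / k + l}.
Proof. by move=> k l; apply: opP => x /=; rewrite scalerDl. Qed.

HB.instance Definition _ :=
  GRing.Zmodule_isLmodule.Build R[i] K op_scaleA op_scale1 op_scaleDr op_scaleDl.

Lemma op_fun0 x : (0 : K) x = 0. Proof. by []. Qed.
Lemma op_funD S T x : (S + T) x = S x + T x. Proof. by []. Qed.
Lemma op_funZ k S x : (k *: S) x = k *: S x. Proof. by []. Qed.
Lemma op_funN S x : (- S) x = - S x.
Proof. by rewrite -scaleN1r -[RHS]scaleN1r. Qed.

Definition opnorm S : R := supnorm [set x : H | `|x| <= 1] S.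

Lemma rnorm_realC (V : normedModType R[i]) (t : R) (x : V) : 0 <= t ->
  rnorm (t%:C *: x) = t * rnorm x.
Proof.
by move=> t0; rewrite rnormZ; congr (_ * _); apply: complexI; rewrite -rnormE ger0_norm// ler0c.
Qed.

Lemma op_bounded S : bounded_fam [set x : H | `|x| <= 1] S.
Proof.
have [M M0 SM] := compact_map_bounded (op_linear S) (op_compact S).
exists M => x /=; rewrite unit_ballE => x1.
by rewrite (le_trans (SM x))// ler_piMr.
Qed.

Lemma opnorm_ge0 S : 0 <= opnorm S.
Proof. exact/supnorm_ge0/op_bounded. Qed.

Lemma opnorm_le S x : rnorm (S x) <= opnorm S * rnorm x.
Proof.
have [->|x0] := eqVneq x 0.
  by rewrite (linear_map0 (op_linear S)) rnorm0 mulr0.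
have rx : 0 < rnorm x.
  by rewrite lt_neqAle rnorm_ge0 andbT eq_sym; apply: contra_neq x0; exact: rnorm_eq0.
have ri : 0 <= (rnorm x)^-1 by rewrite invr_ge0 ltW.
have := @supnorm_ub _ _ _ _ S (((rnorm x)^-1)%:C *: x) (op_bounded S).
rewrite /= unit_ballE rnorm_realC// mulVf ?gt_eqF// => /(_ (lexx 1)).
by rewrite (linear_mapZ (op_linear S)) rnorm_realC// mulrC ler_pdivrMr.
Qed.

Lemma opnorm_leP S (M : R) : 0 <= M ->
  (forall x, rnorm (S x) <= M * rnorm x) -> opnorm S <= M.
Proof.
move=> M0 SM; apply: supnorm_le => // x /=; rewrite unit_ballE => x1.
by rewrite (le_trans (SM x))// ler_piMr.
Qed.

Definition op_normC S : R[i] := (opnorm S)%:C.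

Lemma op_normD S T : op_normC (S + T) <= op_normC S + op_normC T.
Proof. by rewrite /op_normC -rmorphD lecR; exact: supnormD (op_bounded S) (op_bounded T). Qed.

Lemma op_normZ k S : op_normC (k *: S) = `|k| * op_normC S.
Proof.
by rewrite /op_normC rnormE -rmorphM; congr _%:C; exact: supnormZ (op_bounded S).
Qed.

Lemma op_norm_eq0 S : op_normC S = 0 -> S = 0.
Proof.
move=> /complexI S0; apply: opP => x; apply: rnorm_eq0; apply/eqP.
by rewrite eq_le rnorm_ge0 andbT (le_trans (opnorm_le _ _))// S0 mul0r.
Qed.

HB.instance Definition _ :=
  Lmodule_isNormed.Build R[i] K op_normD op_normZ op_norm_eq0.

Lemma op_rnormE S : rnorm S = opnorm S. Proof. by []. Qed.

Lemma op_complete (F : set_system K) : ProperFilter F -> cauchy F -> cvg F.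
Proof.
apply: (@unif_complete R H H K (@op_fun R H) (@rnorm R H)).
- exact: rnorm_ge0.
- by move=> S T x; rewrite -op_funN -op_funD; exact: opnorm_le.
- by move=> S T M M0 ST; apply: opnorm_leP => // x; rewrite op_funD op_funN.
move=> g glim; have [|gl gc] := @compact_map_lim R H g.
  move=> e e0; have [S gS] := glim _ e0.
  by exists S; split=> //; [exact: op_linear|exact: op_compact].
by exists (CompactOp gl gc).
Qed.

HB.instance Definition _ := Uniform_isComplete.Build K op_complete.

Lemma op_mul_linear S T : linear (S \o T : H -> H).
Proof. by move=> k x y /=; rewrite !op_linear. Qed.

Lemma op_mul_compact S T : compact_map (S \o T).
Proof.
exact: compact_map_comp (op_linear S) (opnorm_ge0 S) (opnorm_le S) (op_compact T).
Qed.

Definition op_mul S T : K := CompactOp (@op_mul_linear S T) (op_mul_compact S T).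

Lemma op_star_exists S :
  exists T : K, forall x y, hdot H (S x) y = hdot H x (T y).
Proof.
have [g Sg] := adjoint_exists (op_linear S) (opnorm_ge0 S) (opnorm_le S).
have gc := adjoint_compact (op_linear S) (op_compact S) Sg.
by exists (CompactOp (adjoint_linear Sg) gc).
Qed.

Definition op_star S : K := sval (cid (op_star_exists S)).

Lemma op_starP S x y : hdot H (S x) y = hdot H x (op_star S y).
Proof. by rewrite /op_star; case: cid. Qed.

Lemma op_star_uniq S T : (forall x y, hdot H (S x) y = hdot H x (T y)) ->
  op_star S = T.
Proof.
move=> ST; apply: opP => x.
by rewrite (adjoint_uniq (op_starP S) ST).
Qed.

Lemma op_mulA : associative op_mul.
Proof. by move=> S T U; apply: opP. Qed.

Lemma op_mulDl : left_distributive op_mul +%R.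
Proof. by move=> S T U; apply: opP. Qed.

Lemma op_mulDr : right_distributive op_mul +%R.
Proof. by move=> S T U; apply: opP => x; rewrite /= (linear_mapD (op_linear S)). Qed.

Lemma op_mulZl k S T : op_mul (k *: S) T = k *: op_mul S T.
Proof. by apply: opP. Qed.

Lemma op_mulZr k S T : op_mul S (k *: T) = k *: op_mul S T.
Proof. by apply: opP => x; rewrite /= (linear_mapZ (op_linear S)). Qed.

Lemma op_starK : involutive op_star.
Proof. by move=> S; apply: op_star_uniq; apply: adjoint_sym; exact: op_starP. Qed.

Lemma op_starD S T : op_star (S + T) = op_star S + op_star T.
Proof.
apply: op_star_uniq => x y.
by rewrite !op_funD linearDl linearDr /= !op_starP.
Qed.

Lemma op_starZ k S : op_star (k *: S) = Num.conj k *: op_star S.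
Proof.
apply: op_star_uniq => x y.
by rewrite !op_funZ linearZl_LR linearZr_LR /= conjCK op_starP.
Qed.

Lemma op_starM S T : op_star (op_mul S T) = op_mul (op_star T) (op_star S).
Proof. by apply: op_star_uniq => x y /=; rewrite !op_starP. Qed.

Lemma opnormM S T : opnorm (op_mul S T) <= opnorm S * opnorm T.
Proof.
apply: opnorm_leP => [|x]; first by rewrite mulr_ge0 ?opnorm_ge0.
rewrite (le_trans (opnorm_le S (T x)))// -mulrA ler_wpM2l ?opnorm_ge0//.
exact: opnorm_le.
Qed.

Lemma op_normM S T : `|op_mul S T| <= `|S| * `|T|.
Proof. by rewrite !rnormE -rmorphM lecR; exact: opnormM. Qed.

Lemma opnorm_star_le S : opnorm (op_star S) <= opnorm S.
Proof.
apply: opnorm_leP (opnorm_ge0 S) _.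
exact: adjoint_le (opnorm_ge0 S) (op_starP S) (opnorm_le S).
Qed.

Lemma op_cstar S : `|op_mul (op_star S) S| = `|S| ^+ 2.
Proof.
rewrite !rnormE -rmorphXn; congr _%:C; rewrite !op_rnormE.
apply/eqP; rewrite eq_le; apply/andP; split.
  by rewrite (le_trans (opnormM _ _))// expr2 ler_wpM2r ?opnorm_ge0// opnorm_star_le.
set c := opnorm (op_mul _ _).
have c0 : 0 <= c by exact: opnorm_ge0.
rewrite -[leRHS]sqr_sqrtr// ler_sqr ?nnegrE ?opnorm_ge0 ?sqrtr_ge0//.
apply: opnorm_leP => [|x]; first exact: sqrtr_ge0.
rewrite -ler_sqr ?nnegrE ?mulr_ge0 ?rnorm_ge0 ?sqrtr_ge0//.
rewrite exprMn sqr_sqrtr// -hre_norm (adjoint_hre (op_starP S)).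
rewrite (le_trans (ler_norm _))// (le_trans (hre_le _ _))//.
rewrite expr2 mulrCA ler_wpM2l ?rnorm_ge0//.
exact: (opnorm_le (op_mul (op_star S) S)).
Qed.

HB.instance Definition _ := CompleteNormedModule_isCstar.Build R K
  op_mulA op_mulDl op_mulDr op_mulZl op_mulZr op_starK op_starD op_starZ
  op_starM op_normM op_cstar.

End CompactOp.

Section CstarTheory.
Variables (R : realType) (A : cstarType R).
Implicit Types a b : A.

Lemma cnorm_rM a b : rnorm (cmul a b) <= rnorm a * rnorm b.
Proof. by rewrite -lecR rmorphM /= -!rnormE cnormM. Qed.

Lemma cstar_rnorm a : rnorm (cmul (star a) a) = rnorm a ^+ 2.
Proof. by apply: complexI; rewrite rmorphXn /= -!rnormE cstar_identity. Qed.

Lemma star_rnorm a : rnorm (star a) = rnorm a.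
Proof.
have le_star b : rnorm b <= rnorm (star b).
  have [b0|b0] := eqVneq (rnorm b) 0; first by rewrite b0 rnorm_ge0.
  have bp : 0 < rnorm b by rewrite lt_neqAle eq_sym b0 rnorm_ge0.
  by rewrite -(ler_pM2r bp) -expr2 -cstar_rnorm cnorm_rM.
by apply/eqP; rewrite eq_le le_star -{2}(starK a) le_star.
Qed.

Lemma star0 : star (0 : A) = 0.
Proof. by rewrite -[X in star X](scale0r (0 : A)) starZ conjC0 scale0r. Qed.

Lemma starN a : star (- a) = - star a.
Proof. by apply/eqP; rewrite -addr_eq0 -starD addNr star0. Qed.

Lemma starB a b : star (a - b) = star a - star b.
Proof. by rewrite starD starN. Qed.

Lemma cmul0l a : cmul 0 a = 0.
Proof. by rewrite -[X in cmul X _](scale0r (0 : A)) cmulZl scale0r. Qed.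

Lemma cmul0r a : cmul a 0 = 0.
Proof. by rewrite -[X in cmul _ X](scale0r (0 : A)) cmulZr scale0r. Qed.

Lemma cmulNl a b : cmul (- a) b = - cmul a b.
Proof. by rewrite -scaleN1r cmulZl scaleN1r. Qed.

Lemma cmulNr a b : cmul a (- b) = - cmul a b.
Proof. by rewrite -scaleN1r cmulZr scaleN1r. Qed.

Lemma cmulBl a b c : cmul (a - b) c = cmul a c - cmul b c.
Proof. by rewrite cmulDl cmulNl. Qed.

Lemma cmulBr a b c : cmul c (a - b) = cmul c a - cmul c b.
Proof. by rewrite cmulDr cmulNr. Qed.

End CstarTheory.

Section ContinuousMaps.
Variables (R : realType) (X : topologicalType).

Lemma continuous_rnormP (V : normedModType R[i]) (f : X -> V) :
  continuous f <-> forall (x : X) (e : R), 0 < e ->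
    \forall y \near x, rnorm (f x - f y) < e.
Proof.
split=> [cf x e e0|cf x].
  have eC : 0 < e%:C :> R[i] by rewrite ltcR.
  have /cvg_ballP/(_ _ eC) := cf x.
  by apply: filterS => y /ball_rnorm.
apply/cvg_ballP => ee /gt0_complexE[-> e0].
by apply: filterS (cf x _ e0) => y xy; apply/ball_rnorm.
Qed.

Lemma continuous_bounded_fam (V : completeNormedModType R[i]) (f : X -> V) :
  compact [set: X] -> continuous f -> bounded_fam [set: X] f.
Proof.
move=> cX cf.
have fcpt : compact (f @` [set: X]).
  by apply: continuous_compact => //; exact: continuous_subspaceT.
have /precompact_tbdd/(_ 1 ltr01)[s fs] : precompact (f @` [set: X]).
  by rewrite precompact_closed//; exact: compact_closed (@norm_hausdorff _ _) fcpt.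
exists (1 + \sum_(y <- s) rnorm y) => x _.
have [y ys xy] := fs _ (ex_intro2 _ _ x I erefl).
have le_s : rnorm y <= \sum_(y <- s) rnorm y.
  elim: s {fs} ys => // a s IHs; rewrite inE big_cons => /predU1P[->|/IHs ys].
    by rewrite lerDl sumr_ge0// => i _; exact: rnorm_ge0.
  by rewrite (le_trans ys)// lerDr rnorm_ge0.
by rewrite -(subrK y (f x)) (le_trans (rnormD _ _))// lerD.
Qed.

Variable A : cstarType R.
Implicit Types f g : X -> A.

Lemma continuous_cmul f g : continuous f -> continuous g ->
  continuous (fun x => cmul (f x) (g x)).
Proof.
move=> /continuous_rnormP cf /continuous_rnormP cg.
apply/continuous_rnormP => x e e0.
pose N := rnorm (f x) + rnorm (g x) + 1.
have N0 : 0 < N by rewrite ltr_wpDl// addr_ge0 ?rnorm_ge0.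
have d0 : 0 < e / N by rewrite divr_gt0.
apply: filterS3 (cf x _ d0) (cg x _ d0) (cg x 1 ltr01) => y fy gy gy1.
have -> : cmul (f x) (g x) - cmul (f y) (g y) =
    cmul (f x) (g x - g y) + cmul (f x - f y) (g y).
  by rewrite cmulBr cmulBl addrA subrK.
rewrite (le_lt_trans (rnormD _ _))//.
rewrite (le_lt_trans (lerD (cnorm_rM _ _) (cnorm_rM _ _)))//.
have gyx : rnorm (g y) < rnorm (g x) + 1.
  by rewrite -(subrK (g x) (g y)) (le_lt_trans (rnormD _ _))// addrC ltrD2l rnormBC.
have eN : e = rnorm (f x) * (e / N) + (e / N) * (rnorm (g x) + 1).
  by rewrite mulrC -mulrDr addrA divfK// gt_eqF.
rewrite [ltRHS]eN ler_ltD//; first by rewrite ler_wpM2l ?rnorm_ge0// ltW.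
by rewrite (@le_lt_trans _ _ ((e / N) * rnorm (g y)))//;
  [rewrite ler_wpM2r ?rnorm_ge0// ltW|rewrite ltr_pM2l].
Qed.

Lemma continuous_star f : continuous f -> continuous (fun x => star (f x)).
Proof.
move=> /continuous_rnormP cf; apply/continuous_rnormP => x e e0.
by apply: filterS (cf x e e0) => y; rewrite -starB star_rnorm.
Qed.

Lemma continuous_unif_lim (V : normedModType R[i]) (f : X -> V) :
  (forall e : R, 0 < e -> exists2 g : X -> V, continuous g &
     forall x, rnorm (f x - g x) <= e) -> continuous f.
Proof.
move=> flim; apply/continuous_rnormP => x e e0.
have e30 : 0 < e / 3 by rewrite divr_gt0.
have [g /continuous_rnormP cg fg] := flim _ e30.
apply: filterS (cg x _ e30) => y gxy.
rewrite (le_lt_trans (rnormB3 _ (g x) _))//.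
rewrite (le_lt_trans (lerD (fg x) (rnormB3 _ (g y) _)))//.
by have := fg y; rewrite (rnormBC (f y)); lra.
Qed.

End ContinuousMaps.

(* C(X, A) for X compact, with the pointwise operations and the sup norm.  It is
   the model used here for the tensor product of C(X) and A: the elementary
   tensor f (x) a is x |-> f x *: a, see [cfun_tensor] and [cfun_tensor_dense]. *)
Record cfun (R : realType) (X : topologicalType) (cX : compact [set: X])
    (A : cstarType R) := CFun {
  cfun_fun :> X -> A;
  cfun_continuous : continuous cfun_fun
}.

Section CFun.
Variables (R : realType) (X : topologicalType) (cX : compact [set: X]).
Variable (A : cstarType R).
Local Notation C := (cfun cX A).
Implicit Types (f g : C) (x : X).

Lemma cfunP f g : (forall x, f x = g x) -> f = g.
Proof.
case: f g => [f fc] [g gc] /= /funext fg; rewrite fg in fc *.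
by congr CFun; exact: Prop_irrelevance.
Qed.

HB.instance Definition _ := gen_eqMixin C.
HB.instance Definition _ := gen_choiceMixin C.

Lemma cfun_zero_continuous : continuous ((fun=> 0) : X -> A).
Proof. by move=> x; exact: cvg_cst. Qed.

Definition cfun_zero : C := CFun cX cfun_zero_continuous.

Lemma cfun_add_continuous f g : continuous (fun x => f x + g x).
Proof. by move=> x; apply: cvgD; exact: cfun_continuous. Qed.

Definition cfun_add f g : C := CFun cX (@cfun_add_continuous f g).

Lemma cfun_scale_continuous k f : continuous (fun x => k *: f x).
Proof. by move=> x; apply: cvgZr; exact: cfun_continuous. Qed.

Definition cfun_scale k f : C := CFun cX (@cfun_scale_continuous k f).

Lemma cfun_addA : associative cfun_add.
Proof. by move=> f g h; apply: cfunP => x /=; rewrite addrA. Qed.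

Lemma cfun_addC : commutative cfun_add.
Proof. by move=> f g; apply: cfunP => x /=; rewrite addrC. Qed.

Lemma cfun_add0 : left_id cfun_zero cfun_add.
Proof. by move=> f; apply: cfunP => x /=; rewrite add0r. Qed.

Lemma cfun_addN : left_inverse cfun_zero (cfun_scale (-1)) cfun_add.
Proof. by move=> f; apply: cfunP => x /=; rewrite scaleN1r addNr. Qed.

HB.instance Definition _ :=
  GRing.isZmodule.Build C cfun_addA cfun_addC cfun_add0 cfun_addN.

Lemma cfun_scaleA k l f : cfun_scale k (cfun_scale l f) = cfun_scale (k * l) f.
Proof. by apply: cfunP => x /=; rewrite scalerA. Qed.

Lemma cfun_scale1 : left_id 1 cfun_scale.
Proof. by move=> f; apply: cfunP => x /=; rewrite scale1r. Qed.

Lemma cfun_scaleDr : right_distributive cfun_scale +%R.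
Proof. by move=> k f g; apply: cfunP => x /=; rewrite scalerDr. Qed.

Lemma cfun_scaleDl f : {morph cfun_scale^~ f : k l / k + l}.
Proof. by move=> k l; apply: cfunP => x /=; rewrite scalerDl. Qed.

HB.instance Definition _ := GRing.Zmodule_isLmodule.Build R[i] C
  cfun_scaleA cfun_scale1 cfun_scaleDr cfun_scaleDl.

Lemma cfun_fun0 x : (0 : C) x = 0. Proof. by []. Qed.
Lemma cfun_funD f g x : (f + g) x = f x + g x. Proof. by []. Qed.
Lemma cfun_funZ k f x : (k *: f) x = k *: f x. Proof. by []. Qed.
Lemma cfun_funN f x : (- f) x = - f x.
Proof. by rewrite -scaleN1r -[RHS]scaleN1r. Qed.

Definition cfun_norm f : R := supnorm [set: X] f.

Lemma cfun_bounded f : bounded_fam [set: X] f.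
Proof. exact: continuous_bounded_fam cX (@cfun_continuous _ _ _ _ f). Qed.

Lemma cfun_norm_ge0 f : 0 <= cfun_norm f.
Proof. exact/supnorm_ge0/cfun_bounded. Qed.

Lemma cfun_norm_ub f x : rnorm (f x) <= cfun_norm f.
Proof. exact: supnorm_ub (cfun_bounded f) _. Qed.

Lemma cfun_norm_leP f (M : R) : 0 <= M -> (forall x, rnorm (f x) <= M) ->
  cfun_norm f <= M.
Proof. by move=> M0 fM; exact: supnorm_le. Qed.

Definition cfun_normC f : R[i] := (cfun_norm f)%:C.

Lemma cfun_normD f g : cfun_normC (f + g) <= cfun_normC f + cfun_normC g.
Proof.
by rewrite /cfun_normC -rmorphD lecR; exact: supnormD (cfun_bounded f) (cfun_bounded g).
Qed.

Lemma cfun_normZ k f : cfun_normC (k *: f) = `|k| * cfun_normC f.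
Proof.
by rewrite /cfun_normC rnormE -rmorphM; congr _%:C; exact: supnormZ (cfun_bounded f).
Qed.

Lemma cfun_norm_eq0 f : cfun_normC f = 0 -> f = 0.
Proof.
move=> /complexI f0; apply: cfunP => x; apply: rnorm_eq0; apply/eqP.
by rewrite eq_le rnorm_ge0 andbT (le_trans (cfun_norm_ub _ _))// f0.
Qed.

HB.instance Definition _ :=
  Lmodule_isNormed.Build R[i] C cfun_normD cfun_normZ cfun_norm_eq0.

Lemma cfun_rnormE f : rnorm f = cfun_norm f. Proof. by []. Qed.

Lemma cfun_complete (F : set_system C) : ProperFilter F -> cauchy F -> cvg F.
Proof.
apply: (@unif_complete R A X C (@cfun_fun R X cX A) (fun=> 1)) => //.
- by move=> f g x; rewrite mulr1 -cfun_funN -cfun_funD; exact: cfun_norm_ub.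
- move=> f g M M0 fg; apply: cfun_norm_leP => // x.
  by rewrite cfun_funD cfun_funN; have := fg x; rewrite mulr1.
move=> g glim; have cg : continuous g.
  apply: continuous_unif_lim => e e0; have [f gf] := glim _ e0.
  exists f; first exact: cfun_continuous.
  by move=> x; have := gf x; rewrite mulr1.
by exists (CFun cX cg).
Qed.

HB.instance Definition _ := Uniform_isComplete.Build C cfun_complete.

Definition cfun_mul f g : C := CFun cX
  (continuous_cmul (@cfun_continuous _ _ _ _ f) (@cfun_continuous _ _ _ _ g)).

Definition cfun_star f : C := CFun cX (continuous_star (@cfun_continuous _ _ _ _ f)).

Lemma cfun_mulA : associative cfun_mul.
Proof. by move=> f g h; apply: cfunP => x /=; exact: cmulA. Qed.

Lemma cfun_mulDl : left_distributive cfun_mul +%R.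
Proof. by move=> f g h; apply: cfunP => x /=; exact: cmulDl. Qed.

Lemma cfun_mulDr : right_distributive cfun_mul +%R.
Proof. by move=> f g h; apply: cfunP => x /=; exact: cmulDr. Qed.

Lemma cfun_mulZl k f g : cfun_mul (k *: f) g = k *: cfun_mul f g.
Proof. by apply: cfunP => x /=; exact: cmulZl. Qed.

Lemma cfun_mulZr k f g : cfun_mul f (k *: g) = k *: cfun_mul f g.
Proof. by apply: cfunP => x /=; exact: cmulZr. Qed.

Lemma cfun_starK : involutive cfun_star.
Proof. by move=> f; apply: cfunP => x /=; exact: starK. Qed.

Lemma cfun_starD f g : cfun_star (f + g) = cfun_star f + cfun_star g.
Proof. by apply: cfunP => x /=; exact: starD. Qed.

Lemma cfun_starZ k f : cfun_star (k *: f) = Num.conj k *: cfun_star f.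
Proof. by apply: cfunP => x /=; exact: starZ. Qed.

Lemma cfun_starM f g : cfun_star (cfun_mul f g) = cfun_mul (cfun_star g) (cfun_star f).
Proof. by apply: cfunP => x /=; exact: starM. Qed.

Lemma cfun_normM f g : `|cfun_mul f g| <= `|f| * `|g|.
Proof.
rewrite !rnormE -rmorphM lecR; apply: cfun_norm_leP => [|x].
  by rewrite mulr_ge0 ?cfun_norm_ge0.
by rewrite (le_trans (cnorm_rM _ _))// ler_pM ?rnorm_ge0 ?cfun_norm_ub.
Qed.

Lemma cfun_cstar f : `|cfun_mul (cfun_star f) f| = `|f| ^+ 2.
Proof.
rewrite !rnormE -rmorphXn; congr _%:C; rewrite !cfun_rnormE.
apply/eqP; rewrite eq_le; apply/andP; split.
  apply: cfun_norm_leP => [|x]; first by rewrite exprn_ge0 ?cfun_norm_ge0.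
  by rewrite /= cstar_rnorm ler_sqr ?nnegrE ?rnorm_ge0 ?cfun_norm_ge0 ?cfun_norm_ub.
set c := cfun_norm (cfun_mul _ _).
have c0 : 0 <= c by exact: cfun_norm_ge0.
rewrite -[leRHS]sqr_sqrtr// ler_sqr ?nnegrE ?cfun_norm_ge0 ?sqrtr_ge0//.
apply: cfun_norm_leP => [|x]; first exact: sqrtr_ge0.
rewrite -ler_sqr ?nnegrE ?rnorm_ge0 ?sqrtr_ge0// sqr_sqrtr// -cstar_rnorm.
exact: (cfun_norm_ub (cfun_mul (cfun_star f) f)).
Qed.

HB.instance Definition _ := CompleteNormedModule_isCstar.Build R C
  cfun_mulA cfun_mulDl cfun_mulDr cfun_mulZl cfun_mulZr cfun_starK cfun_starD
  cfun_starZ cfun_starM cfun_normM cfun_cstar.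

End CFun.

Section ElementaryTensors.
Variables (R : realType) (X : topologicalType) (cX : compact [set: X]).
Variable A : cstarType R.

Lemma cfun_tensor_continuous (f : X -> R[i]^o) (a : A) :
  continuous f -> continuous (fun x => f x *: a).
Proof. by move=> cf x; apply: cvgZl; exact: cf. Qed.

Definition cfun_tensor (f : X -> R[i]^o) (cf : continuous f) (a : A) : cfun cX A :=
  CFun cX (@cfun_tensor_continuous f a cf).

Lemma rnorm_real (t : R) : rnorm (t%:C : R[i]^o) = `|t|.
Proof. by apply: complexI; rewrite -rnormE normc_def /= expr0n addr0 sqrtr_sqr. Qed.

Lemma cfun_tensor_dense (F : cfun cX A) (e : R) : 0 < e ->
  exists2 s : seq (cfun cX A),
    (forall g, g \in s -> exists f (cf : continuous f) a, g = @cfun_tensor f cf a) &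
    `|F - \sum_(g <- s) g| <= e%:C.
Proof.
move=> e0; have e20 : 0 < e / 2 by rewrite divr_gt0.
have Fcpt : compact (F @` [set: X]).
  by apply: continuous_compact => //; exact/continuous_subspaceT/cfun_continuous.
have /precompact_tbdd/(_ _ e20)[s Fs] : precompact (F @` [set: X]).
  by rewrite precompact_closed//; exact: compact_closed (@norm_hausdorff _ _) Fcpt.
pose p y x : R := Order.max 0 (e - rnorm (F x - y)).
pose P x : R := \sum_(y <- s) p y x.
have p0 y x : 0 <= p y x by rewrite le_max lexx.
have P0 x : 0 < P x.
  have [y ys xy] := Fs _ (ex_intro2 _ _ x I erefl).
  rewrite /P (big_rem y)//= ltr_pwDl ?sumr_ge0//.
  by rewrite lt_max; apply/orP; right; lra.
have cp y : continuous (p y).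
  move=> x; apply: (@continuous_max _ _ (fun=> 0) (fun x => e - rnorm (F x - y))).
    exact: cvg_cst.
  apply: cvgB; first exact: cvg_cst.
  apply/cvgrPdist_lt => d d0.
  apply: filterS ((continuous_rnormP F).1 (@cfun_continuous _ _ _ _ F) x d d0) => z.
  apply: le_lt_trans.
  have h1 := rnormB3 (F x) (F z) y; have h2 := rnormB3 (F z) (F x) y.
  rewrite ler_norml; move: h1 h2; rewrite (rnormBC (F z) (F x)); lra.
have cP : continuous P.
  rewrite /P; elim: (s) => [|y t IHt].
    have -> : (fun x => \sum_(y <- [::]) p y x) = cst 0.
      by apply/funext => z; rewrite big_nil.
    by move=> x; exact: cvg_cst.
  have -> : (fun x => \sum_(y <- y :: t) p y x) =
      (fun x => p y x + \sum_(y <- t) p y x).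
    by apply/funext => z; rewrite big_cons.
  by move=> x; apply: cvgD; [exact: cp|exact: IHt].
pose f y x : R[i]^o := (p y x / P x)%:C.
have cf y : continuous (f y).
  apply/continuous_rnormP => x d d0.
  have cq : continuous (fun x => p y x / P x).
    by move=> z; apply: cvgM; [exact: cp|apply: cvgV; [rewrite gt_eqF|exact: cP]].
  have /cvgrPdist_lt/(_ _ d0) := cq x.
  by apply: filterS => z; rewrite -rmorphB rnorm_real.
exists [seq cfun_tensor (cf y) y | y <- s].
  by move=> g /mapP[y _ ->]; exists (f y), (cf y), y.
have sumE (t : seq A) x : (\sum_(g <- [seq cfun_tensor (cf y) y | y <- t]) g) x =
    \sum_(y <- t) f y x *: y.
  elim: t => [|y t IHt] /=; first by rewrite !big_nil.
  by rewrite !big_cons cfun_funD IHt.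
rewrite rnormE lecR; apply: cfun_norm_leP => [|x]; first exact: ltW.
rewrite cfun_funD cfun_funN sumE.
have q1 : \sum_(y <- s) p y x / P x = 1.
  by rewrite -mulr_suml -/(P x) divff ?gt_eqF.
have f1 : \sum_(y <- s) f y x = 1 by rewrite -[RHS](rmorph1 (real_complex R)) -q1 rmorph_sum.
have -> : F x - \sum_(y <- s) f y x *: y = \sum_(y <- s) f y x *: (F x - y).
  rewrite -{1}[F x]scale1r -f1 scaler_suml -sumrB.
  by apply: eq_bigr => y _; rewrite scalerBr.
have rsum (t : seq A) (h : A -> A) : rnorm (\sum_(y <- t) h y) <= \sum_(y <- t) rnorm (h y).
  elim: t => [|y t IHt]; first by rewrite !big_nil rnorm0.
  by rewrite !big_cons (le_trans (rnormD _ _))// lerD.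
rewrite (le_trans (rsum _ _))//.
have -> : e = \sum_(y <- s) (p y x / P x) * e.
  by rewrite -mulr_suml q1 mul1r.
apply: ler_sum => y _; rewrite rnormZ.
have q0 : 0 <= p y x / P x by rewrite divr_ge0// ltW.
have -> : rnorm (f y x) = p y x / P x by rewrite rnorm_real ger0_norm.
have [pe|pe] := leP (e - rnorm (F x - y)) 0.
  have -> : p y x = 0 by rewrite /p; apply/max_idPl.
  by rewrite !mul0r.
by rewrite ler_wpM2l//; lra.
Qed.

End ElementaryTensors.

Section OrderZero.
Variable R : realType.
Implicit Types A B : cstarType R.

(* Positive elements of A and, below, of the matrix algebra M_n(A), as those of
   the form b^* b. *)
Definition cpos A (a : A) := exists b : A, a = cmul (star b) b.

Definition mxpos A n (a : 'M[A]_n) := exists b : 'M[A]_n,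
  forall i j, a i j = \sum_(k < n) cmul (star (b k i)) (b k j).

(* Completely positive contractive order zero maps. *)
Record cpcoz A B := CPCOZ {
  oz_fun :> A -> B;
  oz_linear : linear oz_fun;
  oz_cp : forall n (a : 'M[A]_n), mxpos a -> mxpos (map_mx oz_fun a);
  oz_contractive : forall a, `|oz_fun a| <= `|a|;
  oz_order_zero : forall a b : A, cpos a -> cpos b -> cmul a b = 0 ->
    cmul (oz_fun a) (oz_fun b) = 0
}.

Variables A B : cstarType R.
Implicit Types phi psi : cpcoz A B.

Definition cuntz_le phi psi := exists b : nat -> B, forall a : A,
  cmul (cmul (star (b n)) (psi a)) (b n) @[n --> \oo] --> phi a.

Definition cuntz_eq phi psi := cuntz_le phi psi /\ cuntz_le psi phi.

(* Equivalence classes are represented as sets of maps. *)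
Definition cuntz_classes :=
  {c : set (cpcoz A B) | exists phi, c = [set psi | cuntz_eq phi psi]}.

Definition cuntz_class phi : cuntz_classes :=
  exist _ [set psi | cuntz_eq phi psi] (ex_intro _ phi erefl).

Lemma oz_zero_linear : linear ((fun=> 0) : A -> B).
Proof. by move=> k x y; rewrite scaler0 addr0. Qed.

Lemma oz_zero_cp n (a : 'M[A]_n) : mxpos a -> mxpos (map_mx (fun=> 0 : B) a).
Proof.
move=> _; exists (const_mx 0) => i j; rewrite mxE big1// => k _.
by rewrite !mxE cmul0r.
Qed.

Lemma oz_zero_contractive (a : A) : `|0 : B| <= `|a|.
Proof. by rewrite normr0. Qed.

Lemma oz_zero_order_zero (a b : A) : cpos a -> cpos b -> cmul a b = 0 ->
  cmul (0 : B) 0 = 0.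
Proof. by rewrite cmul0r. Qed.

Definition oz_zero : cpcoz A B :=
  CPCOZ oz_zero_linear oz_zero_cp oz_zero_contractive oz_zero_order_zero.

End OrderZero.

(* A unitary of H + H onto H.  Conjugation by it is an isomorphism of
   M_2(K(H)) = K(H + H) onto K(H), and all of them are of this form.  Such a
   unitary exists when H is infinite-dimensional. *)
Structure doubling (R : realType) (H : hilbertType R) := Doubling {
  dbl_fun :> H * H -> H;
  dbl_inv : H -> H * H;
  dbl_linear : linear dbl_fun;
  dbl_funK : cancel dbl_fun dbl_inv;
  dbl_invK : cancel dbl_inv dbl_fun;
  dbl_dot : forall p q : H * H, hdot H (dbl_fun p) (dbl_fun q) =
    hdot H p.1 q.1 + hdot H p.2 q.2
}.

Section DirectSum.
Variables (R : realType) (H : hilbertType R) (U : doubling H).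
Local Notation K := (compactOp H).
Local Notation V := (dbl_inv U).
Implicit Types (S T : K) (x y : H).

Lemma dbl_inv_linear k x y : V (k *: x + y) = k *: V x + V y.
Proof.
by apply: (can_inj (dbl_funK U)); rewrite dbl_linear !dbl_invK.
Qed.

Lemma dbl_inv_dot x y : hdot H x y = hdot H (V x).1 (V y).1 + hdot H (V x).2 (V y).2.
Proof. by rewrite -(dbl_dot U) !dbl_invK. Qed.

Lemma dbl_rnorm (p : H * H) : rnorm (U p) ^+ 2 = rnorm p.1 ^+ 2 + rnorm p.2 ^+ 2.
Proof. by rewrite -!hre_norm /hre dbl_dot raddfD. Qed.

Lemma dbl_inv_rnorm x : rnorm (V x).1 ^+ 2 + rnorm (V x).2 ^+ 2 = rnorm x ^+ 2.
Proof. by rewrite -dbl_rnorm dbl_invK. Qed.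

Definition dsum_fun S T x : H := U (S (V x).1, T (V x).2).

Lemma dsum_linear S T : linear (dsum_fun S T).
Proof.
move=> k x y; rewrite /dsum_fun dbl_inv_linear /= !op_linear.
by rewrite -dbl_linear.
Qed.

Lemma dbl_inv_le1 x : rnorm x <= 1 -> rnorm (V x).1 <= 1 /\ rnorm (V x).2 <= 1.
Proof.
move=> x1; have := dbl_inv_rnorm x.
have := rnorm_ge0 (V x).1; have := rnorm_ge0 (V x).2; have := rnorm_ge0 x.
move: x1; set a := rnorm x; set b := rnorm _; set c := rnorm _ => a1 a0 b0 c0 abc.
have a2 : a ^+ 2 <= 1 by rewrite expr_le1.
have := sqr_ge0 b; have := sqr_ge0 c => c2 b2.
by split; rewrite -(@expr_le1 _ 2)//; lra.
Qed.

Lemma dsum_compact S T : compact_map (dsum_fun S T).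
Proof.
apply/compact_mapP => e e0; have e20 : 0 < e / 2 by rewrite divr_gt0.
have /compact_mapP/(_ _ e20)[s Ss] := op_compact S.
have /compact_mapP/(_ _ e20)[t Tt] := op_compact T.
exists [seq U (y, z) | y <- s, z <- t] => x /dbl_inv_le1[x1 x2].
have [y ys xy] := Ss _ x1; have [z zt xz] := Tt _ x2.
exists (U (y, z)); first by apply/allpairsP; exists (y, z).
have -> : dsum_fun S T x - U (y, z) = U (S (V x).1 - y, T (V x).2 - z).
  rewrite /dsum_fun -scaleN1r addrC -dbl_linear; congr (U _).
  by rewrite -[_ *: _ + _]/(_, _) /= !scaleN1r !(addrC (- _)).
rewrite -ler_sqr ?nnegrE ?rnorm_ge0 ?(ltW e0)// dbl_rnorm /=.
have h1 : rnorm (S (V x).1 - y) ^+ 2 <= (e / 2) ^+ 2.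
  by rewrite ler_sqr ?nnegrE ?rnorm_ge0// ltW.
have h2 : rnorm (T (V x).2 - z) ^+ 2 <= (e / 2) ^+ 2.
  by rewrite ler_sqr ?nnegrE ?rnorm_ge0// ltW.
rewrite (le_trans (lerD h1 h2))//; have := sqr_ge0 e; lra.
Qed.

Definition dsum S T : K := CompactOp (@dsum_linear S T) (@dsum_compact S T).

Lemma dsum_is_linear k S S' T T' :
  dsum (k *: S + S') (k *: T + T') = k *: dsum S T + dsum S' T'.
Proof.
by apply: opP => x; rewrite op_funD op_funZ /= /dsum_fun -dbl_linear.
Qed.

Lemma dsum0 : dsum 0 0 = 0.
Proof.
apply: opP => x; rewrite /= /dsum_fun !op_fun0.
have := dbl_linear U 1 0 0; rewrite !scale1r addr0 => /eqP.
by rewrite eq_sym -subr_eq0 addrK => /eqP.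
Qed.

Lemma dsumD S S' T T' : dsum (S + S') (T + T') = dsum S T + dsum S' T'.
Proof. by have := dsum_is_linear 1 S S' T T'; rewrite !scale1r. Qed.

Lemma dsum_sum n (S T : 'I_n -> K) :
  dsum (\sum_i S i) (\sum_i T i) = \sum_i dsum (S i) (T i).
Proof.
move: S T; elim: n => [|n IHn] S T; first by rewrite !big_ord0 dsum0.
by rewrite !big_ord_recl dsumD IHn.
Qed.

Lemma dsumM S S' T T' : dsum (cmul S S') (cmul T T') = cmul (dsum S T) (dsum S' T').
Proof. by apply: opP => x; rewrite /= /dsum_fun dbl_funK. Qed.

Lemma dsum_star S T : dsum (star S) (star T) = star (dsum S T).
Proof.
apply/esym; apply: op_star_uniq => x y; rewrite /= /dsum_fun.
rewrite -[X in hdot H _ X = _](dbl_invK U y) -[X in _ = hdot H X _](dbl_invK U x).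
rewrite !dbl_dot /=.
by rewrite !op_starP.
Qed.

Lemma dsum_norm_le S T (M : R[i]) : `|S| <= M -> `|T| <= M -> `|dsum S T| <= M.
Proof.
move=> SM TM; have M0 : 0 <= M by exact: le_trans (normr_ge0 S) SM.
have ME : M = (complex.Re M)%:C.
  by move: M0; case: (M) => a b; rewrite lecE /= => /andP[/eqP-> _].
have m0 : 0 <= complex.Re M by rewrite -ler0c -ME.
move: SM TM; rewrite ME !rnormE !lecR !op_rnormE.
move: (complex.Re M) m0 => m m0 Sm Tm.
apply: opnorm_leP => // x.
rewrite -ler_sqr ?nnegrE ?mulr_ge0 ?rnorm_ge0// exprMn -(dbl_inv_rnorm x) mulrDr.
rewrite /= /dsum_fun dbl_rnorm /= lerD//.
  rewrite -exprMn ler_sqr ?nnegrE ?mulr_ge0 ?rnorm_ge0//.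
  by rewrite (le_trans (opnorm_le _ _))// ler_wpM2r ?rnorm_ge0.
rewrite -exprMn ler_sqr ?nnegrE ?mulr_ge0 ?rnorm_ge0//.
by rewrite (le_trans (opnorm_le _ _))// ler_wpM2r ?rnorm_ge0.
Qed.

Variable A : cstarType R.
Implicit Types phi psi : cpcoz A K.

Lemma oz_dsum_linear phi psi : linear ((fun a => dsum (phi a) (psi a)) : A -> K).
Proof. by move=> k a b; rewrite !oz_linear dsum_is_linear. Qed.

Lemma oz_dsum_cp phi psi n (a : 'M[A]_n) : mxpos a ->
  mxpos (map_mx (fun a => dsum (phi a) (psi a)) a).
Proof.
move=> apos; have [b phib] := oz_cp phi apos; have [c psic] := oz_cp psi apos.
exists (\matrix_(i, j) dsum (b i j) (c i j)) => i j.
have := phib i j; have := psic i j; rewrite !mxE => -> ->.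
rewrite dsum_sum; apply: eq_bigr => k _.
by rewrite !mxE -dsum_star dsumM.
Qed.

Lemma oz_dsum_contractive phi psi a : `|dsum (phi a) (psi a)| <= `|a|.
Proof. by apply: dsum_norm_le; exact: oz_contractive. Qed.

Lemma oz_dsum_order_zero phi psi (a b : A) : cpos a -> cpos b -> cmul a b = 0 ->
  cmul (dsum (phi a) (psi a)) (dsum (phi b) (psi b)) = 0.
Proof.
by move=> a0 b0 ab; rewrite -dsumM !(oz_order_zero _ a0 b0 ab) dsum0.
Qed.

(* The orthogonal sum of phi and psi, brought back from M_2(K(H)) to K(H). *)
Definition oz_dsum phi psi : cpcoz A K :=
  CPCOZ (@oz_dsum_linear phi psi) (@oz_dsum_cp phi psi)
    (@oz_dsum_contractive phi psi) (@oz_dsum_order_zero phi psi).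

End DirectSum.

(* WW(C(X), C): here C(X) (x) K is C(X, K) and C (x) K is K. *)
Definition cuntz_homology (R : realType) (X : topologicalType)
    (cX : compact [set: X]) (H : hilbertType R) :=
  cuntz_classes (cfun cX (compactOp H)) (compactOp H).

(* Natural numbers with infinity, which is [None]. *)
Definition enat := option nat.

Definition eadd (m n : enat) : enat :=
  if m is Some a then if n is Some b then Some (a + b)%N else None else None.

Definition ele (m n : enat) : bool :=
  if n is Some b then if m is Some a then (a <= b)%N else false else true.

Definition mf_support X (nu : X -> enat) := [set x | nu x <> Some 0%N].

Record multfun (X : topologicalType) := MultFun {
  mf_fun :> X -> enat;
  mf_closed : closed (mf_support mf_fun);
  mf_limit : forall x, limit_point (mf_support mf_fun) x -> mf_fun x = None
}.

Section MultFun.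
Variable X : topologicalType.
Implicit Types (nu mu rho : multfun X) (x : X).

Lemma multfunP nu mu : (forall x, nu x = mu x) -> nu = mu.
Proof.
case: nu mu => [f fc fl] [g gc gl] /= /funext fg; rewrite fg in fc fl *.
by congr MultFun; exact: Prop_irrelevance.
Qed.

HB.instance Definition _ := gen_eqMixin (multfun X).
HB.instance Definition _ := gen_choiceMixin (multfun X).

Lemma mf_support0 : mf_support (fun=> Some 0%N : enat) = set0 :> set X.
Proof. by apply/seteqP; split=> // x []. Qed.

Lemma mf_zero_closed : closed (mf_support (fun _ : X => Some 0%N : enat)).
Proof. by rewrite mf_support0; exact: closed0. Qed.

Lemma mf_zero_limit x : limit_point (mf_support (fun _ : X => Some 0%N : enat)) x ->
  Some 0%N = None :> enat.
Proof. by rewrite mf_support0 => /(_ setT filterT)[y [_ []]]. Qed.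

Definition mf_zero : multfun X := MultFun mf_zero_closed mf_zero_limit.

Lemma mf_supportD nu mu : mf_support (fun x => eadd (nu x) (mu x)) =
  mf_support nu `|` mf_support mu.
Proof.
apply/seteqP; split=> x; rewrite /mf_support /=; case: (nu x) (mu x) => [a|] [b|]//=.
- case: a => [|a] ab; last by left.
  by case: b ab => [|b] ab; [case: ab|right].
- by move=> _; right.
- by move=> _; left.
- by move=> _; left.
- by case: a b => [|a] [|b] []// ab; rewrite ?addn0 ?addnS.
Qed.

Lemma mf_add_closed nu mu : closed (mf_support (fun x => eadd (nu x) (mu x))).
Proof. by rewrite mf_supportD; apply: closedU; exact: mf_closed. Qed.

Lemma mf_add_limit nu mu x :
  limit_point (mf_support (fun x => eadd (nu x) (mu x))) x ->
  eadd (nu x) (mu x) = None.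
Proof.
rewrite mf_supportD => lx.
have [l|nl] := pselect (limit_point (mf_support nu) x); first by rewrite (mf_limit l).
have -> : mu x = None; last by case: (nu x).
apply: mf_limit => W xW; apply: contrapT => nW; apply: nl => W' xW'.
have [y [yx [ny|my] [Wy W'y]]] := lx _ (filterI xW xW'); first by exists y.
by case: nW; exists y.
Qed.

Definition mf_add nu mu : multfun X :=
  MultFun (@mf_add_closed nu mu) (@mf_add_limit nu mu).

Lemma mf_addA : associative mf_add.
Proof.
move=> nu mu rho; apply: multfunP => x /=.
by case: (nu x) (mu x) (rho x) => [a|] [b|] [c|]//=; rewrite addnA.
Qed.

Lemma mf_addC : commutative mf_add.
Proof.
move=> nu mu; apply: multfunP => x /=.
by case: (nu x) (mu x) => [a|] [b|]//=; rewrite addnC.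
Qed.

Lemma mf_add0 : left_id mf_zero mf_add.
Proof. by move=> nu; apply: multfunP => x /=; case: (nu x). Qed.

HB.instance Definition _ := GRing.isNmodule.Build (multfun X) mf_addA mf_addC mf_add0.

Definition mf_le nu mu : bool := `[< forall x, ele (nu x) (mu x) >].

Lemma mf_le_refl : reflexive mf_le.
Proof. by move=> nu; apply/asboolP => x; case: (nu x) => //= a; exact: leqnn. Qed.

Lemma mf_le_anti : antisymmetric mf_le.
Proof.
move=> nu mu /andP[/asboolP nm /asboolP mn]; apply: multfunP => x.
move: (nm x) (mn x); case: (nu x) (mu x) => [a|] [b|]//= ab ba.
by congr Some; apply/eqP; rewrite eqn_leq ab.
Qed.

Lemma mf_le_trans : transitive mf_le.
Proof.
move=> mu nu rho /asboolP nm /asboolP mr; apply/asboolP => x.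
move: (nm x) (mr x); case: (nu x) (mu x) (rho x) => [a|] [b|] [c|]//=.
exact: leq_trans.
Qed.

HB.instance Definition _ := Order.Le_isPOrder.Build (Order.Disp tt tt) (multfun X)
  mf_le_refl mf_le_anti mf_le_trans.

Lemma multfun_addE nu mu x : (nu + mu) x = eadd (nu x) (mu x).
Proof. by []. Qed.

Lemma multfun_leP nu mu : reflect (forall x, ele (nu x) (mu x)) (nu <= mu)%O.
Proof. exact: asboolP. Qed.

End MultFun.

(* Main.v *)
(* An order zero map phi on C(X, K) sends elements with product zero to elements
   with product zero, and this alone makes it a module map up to a positive
   factor: phi(a T) phi(b) = phi(a) phi(T b) for T compact, and the compact
   operators phi(f (x) p), for p a rank one projection and f in C(X), commute.
   They are therefore diagonal in an orthonormal system (xi_i), which gives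
   phi(F) = sum_i lam_i V_i F(x_i) V_i^* for isometries V_i with orthogonal
   ranges, points x_i and weights lam_i > 0 tending to 0.  The multiplicity of
   phi at x is the largest n such that every neighbourhood of x contains x_i for
   n distinct indices i.

   If phi <~ psi then phi(f (x) p), for f supported near x, has rank at most that
   of psi(f (x) p), so the multiplicities compare.  Conversely, if they compare,
   finitely many x_i can be matched injectively with nearby points y_s(i) of psi,
   and b = sum_i (lam_i / mu_s(i))^(1/2) W_s(i) P V_i^*, with P a large finite rank
   projection, makes b^* psi(F) b close to phi(F).  Every multiplicity function
   arises, from a dense sequence in its support repeated with multiplicity. *)

Require Import Defs.
From mathcomp Require Import all_boot all_order all_algebra.
From mathcomp Require Import boolp classical_sets functions cardinality.
From mathcomp Require Import reals topology normedtype.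
From mathcomp Require Import complex ring lra.

Set Implicit Arguments.
Unset Strict Implicit.
Unset Printing Implicit Defensive.

Import Order.TTheory GRing.Theory Num.Theory.
Import numFieldNormedType.Exports.

Local Open Scope classical_set_scope.
Local Open Scope complex_scope.
Local Open Scope ring_scope.

(** * Hilbert space preliminaries *)

(** The general structure theorem would write an order zero map as a homomorphism times a commuting
    positive factor. Matrix units replace it here: given a vector orthogonal to the range of p, the
    product phi(g (x) p) phi(f (x) p) depends on g f alone, so one can compute as if the theorem
    were available, without bidual or functional calculus. The point x_i of an eigenvector is found
    by compactness of X, and the eigenvector itself by compactness of h = phi(1 (x) p). The lam_i
    are eigenvalues of h, which is why they tend to 0. Cuntz comparison sees neither the size of the
    weights, as b may rescale, nor the exact position of the points, as F is uniformly continuous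
    and finitely many terms give phi up to any error. Hence the multiplicity counts indices near x
    rather than at x, and is infinite at accumulation points of its support. The V_i are not compact
    and C(X, K) has no unit: the finite rank projections of an orthonormal basis serve both to bring
    b into K and as an approximate unit. *)

Section Dot.
Variables (R : realType) (H : hilbertType R).
Implicit Types (x y z u v : H) (k : R[i]).
Local Notation "''[' x , y ]" := (hdot H x y) : ring_scope.

Lemma dotDl x y z : '[x + y, z] = '[x, z] + '[y, z].
Proof. by rewrite linearDl. Qed.

Lemma dotDr x y z : '[z, x + y] = '[z, x] + '[z, y].
Proof. by rewrite linearDr. Qed.

Lemma dotZl k x y : '[k *: x, y] = k * '[x, y].
Proof. by rewrite linearZl_LR. Qed.

Lemma dotZr k x y : '[x, k *: y] = Num.conj k * '[x, y].
Proof. by rewrite linearZr_LR. Qed.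

Lemma dot0l x : '[0, x] = 0.
Proof. by rewrite -(scale0r x) dotZl mul0r. Qed.

Lemma dot0r x : '[x, 0] = 0.
Proof. by rewrite hdotC dot0l conjC0. Qed.

Lemma dotBl x y z : '[x - y, z] = '[x, z] - '[y, z].
Proof. by rewrite -scaleN1r dotDl dotZl mulN1r. Qed.

Lemma dot_suml (I : Type) (s : seq I) (P : pred I) (F : I -> H) y :
  '[\sum_(i <- s | P i) F i, y] = \sum_(i <- s | P i) '[F i, y].
Proof.
elim/big_rec2: _ => [|i a b _ <-]; first by rewrite dot0l.
by rewrite dotDl.
Qed.

Lemma dot_sumr (I : Type) (s : seq I) (P : pred I) (F : I -> H) y :
  '[y, \sum_(i <- s | P i) F i] = \sum_(i <- s | P i) '[y, F i].
Proof.
elim/big_rec2: _ => [|i a b _ <-]; first by rewrite dot0r.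
by rewrite dotDr.
Qed.

Lemma dotxx x : '[x, x] = (rnorm x ^+ 2)%:C.
Proof. by rewrite hdot_norm rnormE -rmorphXn. Qed.

Lemma dotI x y : (forall v, '[v, x] = '[v, y]) -> x = y.
Proof. by move=> xy; apply: hdotI => v; rewrite /hre xy. Qed.

(** [hre_le] controls real parts only; scaling [x] by the conjugate of the inner product [c] makes
    the product real, equal to |c|^2. *)
Lemma dot_rnorm x y : rnorm '[x, y] <= rnorm x * rnorm y.
Proof.
set c := '[x, y].
have [c0|c0] := eqVneq (rnorm c) 0; first by rewrite c0 mulr_ge0 ?rnorm_ge0.
have cp : 0 < rnorm c by rewrite lt_neqAle eq_sym c0 rnorm_ge0.
rewrite -(ler_pM2l cp).
have -> : rnorm c * rnorm c = hre (Num.conj c *: x) y.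
  rewrite /hre dotZl -/c -expr2 (_ : _ * c = (rnorm c ^+ 2)%:C)//.
  by rewrite mulrC -normCK rnormE -rmorphXn.
rewrite (le_trans (ler_norm _))// (le_trans (hre_le _ _))// rnormZ mulrA.
by rewrite (_ : rnorm (Num.conj c) = rnorm c)// /rnorm norm_conjC.
Qed.

Lemma rnormC (t : R) : rnorm (t%:C : R[i]) = `|t|.
Proof. exact: rnorm_real. Qed.

Lemma rnorm_gt0 (V : normedModType R[i]) (w : V) : w != 0 -> 0 < rnorm w.
Proof.
by move=> w0; rewrite lt_neqAle rnorm_ge0 andbT eq_sym; apply: contra_neq w0; exact: rnorm_eq0.
Qed.

Lemma rnorm_normalize x : x != 0 -> rnorm ((rnorm x)^-1%:C *: x) = 1.
Proof.
by move=> /rnorm_gt0 x0; rewrite rnorm_realC ?invr_ge0 ?rnorm_ge0// mulVf// gt_eqF.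
Qed.

Lemma rnorm_small (V : normedModType R[i]) (w : V) :
  (forall e : R, 0 < e -> rnorm w <= e) -> w = 0.
Proof.
move=> we; apply: rnorm_eq0; apply/eqP; rewrite eq_le rnorm_ge0 andbT.
by apply/ler_addgt0Pr => e e0; rewrite add0r we.
Qed.

Lemma pythagoras x y : '[x, y] = 0 -> rnorm (x + y) ^+ 2 = rnorm x ^+ 2 + rnorm y ^+ 2.
Proof. by move=> xy; rewrite rnormD2 /hre xy /= mulr0 addr0. Qed.

Lemma pythagoras_sum (I : eqType) (s : seq I) (F : I -> H) : uniq s ->
  (forall i j, i \in s -> j \in s -> i != j -> '[F i, F j] = 0) ->
  rnorm (\sum_(i <- s) F i) ^+ 2 = \sum_(i <- s) rnorm (F i) ^+ 2.
Proof.
elim: s => [|a s IHs] /=; first by rewrite !big_nil rnorm0 expr0n.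
move=> /andP[nas us] oF; rewrite !big_cons pythagoras.
  by rewrite IHs// => i j si sj; apply: oF; rewrite inE ?si ?sj orbT.
rewrite dot_sumr big_seq big1// => j js; apply: oF; rewrite ?inE ?eqxx ?js ?orbT//.
by apply: contraNneq nas => ->.
Qed.

End Dot.

(** * Rank one operators *)

Section RankOne.
Variables (R : realType) (H : hilbertType R).
Implicit Types (x y z u v : H) (T : compactOp H).
Local Notation "''[' x , y ]" := (hdot H x y) : ring_scope.

(** The interval [-M, M] has the grid of points k d - M as a finite net. [theta_compact] uses this
    for the real and the imaginary part of a functional. *)
Lemma compact_map_line (g : H -> R) u (M : R) :
  (forall x, rnorm x <= 1 -> `|g x| <= M) -> compact_map (fun x => (g x)%:C *: u).
Proof.
move=> gM; apply/compact_mapP => e e0.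
have u1 : 0 < rnorm u + 1 by rewrite ltr_wpDl ?rnorm_ge0.
pose d := e / (rnorm u + 1); have d0 : 0 < d by rewrite divr_gt0.
exists [seq (k%:R * d - M)%:C *: u | k <- iota 0 (Num.truncn (2 * M / d)).+1] => x x1.
have := gM x x1; rewrite ler_norml => /andP[g1 g2].
pose k := Num.truncn ((g x + M) / d).
have gM0 : 0 <= (g x + M) / d   by apply: divr_ge0; [lra|exact: ltW].
have /andP[k1 k2] := truncn_itv gM0.
exists ((k%:R * d - M)%:C *: u).
  apply/mapP; exists k => //; rewrite mem_iota add0n /= ltnS /k; apply: le_truncn.
  by rewrite ler_pM2r ?invr_gt0//; lra.
rewrite -scalerBl -rmorphB rnormZ rnormC.
rewrite (@le_trans _ _ (d * rnorm u))//; last first.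
  by rewrite /d mulrAC ler_pdivrMr// ler_pM2l// lerDl.
rewrite ler_wpM2r ?rnorm_ge0//.
move: k1 k2; rewrite -/k ler_pdivlMr// ltr_pdivrMr// -natr1 mulrDl mul1r ler_norml => ? ?.
by apply/andP; split; lra.
Qed.

Definition theta_fun u v x : H := '[x, v] *: u.

Lemma theta_linear u v : linear (theta_fun u v).
Proof.
by move=> k x y; rewrite /theta_fun dotDl dotZl scalerDl scalerA.
Qed.

Lemma theta_compact u v : compact_map (theta_fun u v).
Proof.
have -> : theta_fun u v = fun x => (complex.Re '[x, v])%:C *: u +
    (complex.Im '[x, v])%:C *: ('i *: u).
  apply/funext => x; rewrite /theta_fun scalerA -scalerDl mulrC.
  by congr (_ *: _); case: '[x, v] => a b; rewrite -complexE.
have dM x : rnorm x <= 1 -> rnorm '[x, v] <= rnorm v.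
  move=> x1; rewrite (le_trans (dot_rnorm _ _))// ler_piMl ?rnorm_ge0//.
apply: compact_mapD.
  apply: (@compact_map_line _ _ (rnorm v)) => x /dM; apply: le_trans.
  by rewrite -lecR -rnormE normc_ge_Re.
apply: (@compact_map_line _ _ (rnorm v)) => x /dM; apply: le_trans.
have i1 : `|'i%C : R[i]| = 1 by rewrite normc_def /= expr0n expr1n add0r sqrtr1.
have := normc_ge_Re ('i * '[x, v]); rewrite normrM i1 mul1r rnormE lecR.
by case: '[x, v] => a b; rewrite /= mul0r sub0r mul1r normrN.
Qed.

(** The operator |u><v|. For [u] and [v] in an orthonormal basis these are the matrix units of K. *)
Definition theta u v : compactOp H := CompactOp (theta_linear u v) (theta_compact u v).

Lemma thetaE u v x : theta u v x = '[x, v] *: u. Proof. by []. Qed.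

Lemma theta_star u v : star (theta u v) = theta v u.
Proof.
apply: op_star_uniq => x y; rewrite !thetaE dotZl dotZr.
by rewrite -hdotC mulrC.
Qed.

Lemma starP T x y : '[T x, y] = '[x, star T y].
Proof. exact: op_starP. Qed.

Lemma starPr T x y : '[x, T y] = '[star T x, y].
Proof. by rewrite hdotC starP -hdotC. Qed.

Lemma cmulE (S T : compactOp H) x : cmul S T x = S (T x). Proof. by []. Qed.

Lemma op_funB (S T : compactOp H) x : (S - T) x = S x - T x.
Proof. by rewrite op_funD op_funN. Qed.

Lemma opD T x y : T (x + y) = T x + T y.
Proof. exact: linear_mapD (op_linear T) x y. Qed.

Lemma opZ T k x : T (k *: x) = k *: T x.
Proof. exact: linear_mapZ (op_linear T) k x. Qed.

Lemma opB T x y : T (x - y) = T x - T y.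
Proof. exact: linear_mapB (op_linear T) x y. Qed.

Lemma op0 T : T 0 = 0.
Proof. exact: linear_map0 (op_linear T). Qed.

Lemma op_sum T (I : Type) (s : seq I) (P : pred I) (F : I -> H) :
  T (\sum_(i <- s | P i) F i) = \sum_(i <- s | P i) T (F i).
Proof.
elim/big_rec2: _ => [|i a b _ <-]; first by rewrite op0.
by rewrite opD.
Qed.

Lemma sum_op (I : Type) (s : seq I) (P : pred I) (F : I -> compactOp H) x :
  (\sum_(i <- s | P i) F i) x = \sum_(i <- s | P i) F i x.
Proof. by elim/big_rec2: _ => [|i a b _ <-]. Qed.

Lemma cmul_theta T u v : cmul T (theta u v) = theta (T u) v.
Proof. by apply: opP => x; rewrite cmulE !thetaE opZ. Qed.

Lemma thetaM u v u' v' : cmul (theta u v) (theta u' v') = '[u', v] *: theta u v'.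
Proof. by apply: opP => x; rewrite cmulE op_funZ !thetaE dotZl !scalerA mulrC. Qed.

Lemma thetaDl u u' v : theta (u + u') v = theta u v + theta u' v.
Proof. by apply: opP => x; rewrite op_funD !thetaE scalerDr. Qed.

Lemma thetaZl k u v : theta (k *: u) v = k *: theta u v.
Proof. by apply: opP => x; rewrite op_funZ !thetaE !scalerA mulrC. Qed.

Lemma thetaDr u v v' : theta u (v + v') = theta u v + theta u v'.
Proof. by apply: opP => x; rewrite op_funD !thetaE dotDr scalerDl. Qed.

Lemma thetaZr k u v : theta u (k *: v) = Num.conj k *: theta u v.
Proof. by apply: opP => x; rewrite op_funZ !thetaE dotZr scalerA. Qed.

Lemma rnorm_op_le T x : rnorm (T x) <= rnorm T * rnorm x.
Proof. exact: opnorm_le. Qed.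

Lemma rnorm_op_leP T (M : R) : 0 <= M ->
  (forall x, rnorm (T x) <= M * rnorm x) -> rnorm T <= M.
Proof. exact: opnorm_leP. Qed.

Lemma rnorm_op_unit T (M : R) : 0 <= M ->
  (forall x, rnorm x <= 1 -> rnorm (T x) <= M) -> rnorm T <= M.
Proof.
move=> M0 TM; apply: (@supnorm_le _ _ _ [set x : H | `|x| <= 1] T) => // x.
by rewrite /= unit_ballE; exact: TM.
Qed.

Lemma theta_rnorm u v : rnorm (theta u v) <= rnorm u * rnorm v.
Proof.
apply: rnorm_op_leP => [|x]; first by rewrite mulr_ge0 ?rnorm_ge0.
rewrite thetaE rnormZ mulrC -mulrA ler_wpM2l ?rnorm_ge0// mulrC.
exact: dot_rnorm.
Qed.

End RankOne.

(** * Orthonormal bases by the Gram-Schmidt process *)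

Section Basis.
Variables (R : realType) (H : hilbertType R).
Implicit Types (x y z u v : H).
Local Notation "''[' x , y ]" := (hdot H x y) : ring_scope.

(** Restricted to the first [n] vectors, so that it can be the induction hypothesis while the
    process is running. *)
Definition orthonormal_upto (e : nat -> H) n := forall i j, (i < n)%N -> (j < n)%N ->
  '[e i, e j] = (i == j)%:R.

Definition fourier (e : nat -> H) n x : H := \sum_(k < n) '[x, e k] *: e k.

Lemma fourierD e n x y : fourier e n (x + y) = fourier e n x + fourier e n y.
Proof.
by rewrite /fourier -big_split; apply: eq_bigr => k _; rewrite dotDl scalerDl.
Qed.

Lemma fourierZ e n k x : fourier e n (k *: x) = k *: fourier e n x.
Proof.
by rewrite /fourier scaler_sumr; apply: eq_bigr => i _; rewrite dotZl scalerA.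
Qed.

Lemma fourierB e n x y : fourier e n (x - y) = fourier e n x - fourier e n y.
Proof. by rewrite -scaleN1r fourierD fourierZ scaleN1r. Qed.

Lemma fourier_dot e n x k : orthonormal_upto e n -> (k < n)%N ->
  '[fourier e n x, e k] = '[x, e k].
Proof.
move=> oe kn; rewrite dot_suml (bigD1 (Ordinal kn))//= dotZl oe// eqxx mulr1.
rewrite big1 ?addr0// => i ik; rewrite dotZl oe// -[k]/(val (Ordinal kn)) val_eqE (negPf ik).
by rewrite mulr0.
Qed.

Lemma fourier_orth e n x : orthonormal_upto e n ->
  '[x - fourier e n x, fourier e n x] = 0.
Proof.
move=> oe; rewrite {2}/fourier dot_sumr big1// => k _.
by rewrite dotZr dotBl fourier_dot// subrr mulr0.
Qed.

Lemma fourier_pyth e n x : orthonormal_upto e n ->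
  rnorm x ^+ 2 = rnorm (x - fourier e n x) ^+ 2 + rnorm (fourier e n x) ^+ 2.
Proof. by move=> oe; rewrite -pythagoras ?subrK ?fourier_orth. Qed.

Lemma fourier_le e n x : orthonormal_upto e n -> rnorm (fourier e n x) <= rnorm x.
Proof.
move=> oe; rewrite -ler_sqr ?nnegrE ?rnorm_ge0//.
by rewrite (fourier_pyth x oe) lerDr sqr_ge0.
Qed.

Lemma fourier_resid_le e n x : orthonormal_upto e n ->
  rnorm (x - fourier e n x) <= rnorm x.
Proof.
move=> oe; rewrite -ler_sqr ?nnegrE ?rnorm_ge0//.
by rewrite (fourier_pyth x oe) lerDl sqr_ge0.
Qed.

Definition orthonormal_basis (e : nat -> H) :=
  (forall i j, '[e i, e j] = (i == j)%:R) /\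
  forall x (d : R), 0 < d -> exists N, forall n, (N <= n)%N ->
    rnorm (x - fourier e n x) <= d.

Section GramSchmidt.
Variable d : nat -> H.
Hypothesis dense_d : forall x (r : R), 0 < r -> exists m, rnorm (x - d m) < r.
Hypothesis iH : infinite_dimensional H.

Definition resid (s : seq H) x : H := x - \sum_(u <- s) '[x, u] *: u.

(** The first vector of the dense sequence outside the current span is made orthogonal to it and
    normalized; dependent vectors are skipped. The default 0 is never reached, by [gs_exists]. *)
Definition gs_next (s : seq H) : H :=
  if pselect (exists m, resid s (d m) != 0) is left P
  then let r := resid s (d (ex_minn P)) in (rnorm r)^-1%:C *: r else 0.

Fixpoint gs_seq n : seq H := if n is m.+1 then gs_next (gs_seq m) :: gs_seq m else [::].

Definition gs n : H := gs_next (gs_seq n).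

Lemma resid_gs n x : resid (gs_seq n) x = x - fourier gs n x.
Proof.
rewrite /resid /fourier; congr (_ - _); elim: n => [|n IHn] /=.
  by rewrite big_nil big_ord0.
by rewrite big_cons big_ord_recr /= addrC IHn.
Qed.

(** Taking residues is contractive. If it killed every [d m], then a vector [x] outside the span
    would have distance at least the norm of its residue from all of them, against density. *)
Lemma gs_exists n : orthonormal_upto gs n -> exists m, resid (gs_seq n) (d m) != 0.
Proof.
move=> oe; apply: contrapT => nex.
have d0 m : resid (gs_seq n) (d m) = 0.
  by apply: contrapT => /eqP dm; apply: nex; exists m.
have [x xs] := iH (fun k : 'I_n => gs k).
have r0 : resid (gs_seq n) x != 0.
  by apply/eqP; rewrite resid_gs => /eqP; rewrite subr_eq0 => /eqP; exact: xs.
have [m] := dense_d x (rnorm_gt0 r0).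
rewrite ltNge => /negP; apply.
have <- : (x - d m) - fourier gs n (x - d m) = resid (gs_seq n) x.
  by rewrite -[RHS]subr0 -(d0 m) !resid_gs fourierB !opprD addrACA.
exact: fourier_resid_le.
Qed.

Lemma gs_spec n : orthonormal_upto gs n ->
  rnorm (gs n) = 1 /\ (forall k, (k < n)%N -> '[gs n, gs k] = 0) /\
  exists m, [/\ resid (gs_seq n) (d m) != 0,
    forall m', resid (gs_seq n) (d m') != 0 -> (m <= m')%N &
    gs n = (rnorm (resid (gs_seq n) (d m)))^-1%:C *: resid (gs_seq n) (d m)].
Proof.
move=> oe; rewrite {1 2 4}/gs /gs_next; case: pselect => [P|/(_ (gs_exists oe))//].
case: ex_minnP => m m0 mmin /=; split; first exact: rnorm_normalize.
split=> [k kn|]; last by exists m.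
by rewrite dotZl resid_gs dotBl fourier_dot// subrr mulr0.
Qed.

Lemma gs_orthonormal n : orthonormal_upto gs n.
Proof.
elim: n => [|n IHn] i j; first by [].
have [gs1 [gs0 _]] := gs_spec IHn.
rewrite !ltnS leq_eqVlt => /predU1P[->|il]; rewrite leq_eqVlt => /predU1P[->|jl].
- by rewrite eqxx dotxx gs1 expr1n.
- by rewrite gs0// gtn_eqF.
- by rewrite hdotC gs0// conjC0 ltn_eqF.
- exact: IHn.
Qed.

(** In the inductive step, the least index with nonzero residue is at least [n], since the earlier
    vectors are already in the span. So if [d m] with [m <= n] still has a residue, it is the very
    vector being processed. *)
Lemma gs_resid0 n m : (m < n)%N -> d m - fourier gs n (d m) = 0.
Proof.
elim: n m => // n IHn m; rewrite ltnS => mn.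
have oe := @gs_orthonormal n.
have rE x : x - fourier gs n.+1 x = (x - fourier gs n x) - '[x, gs n] *: gs n.
  by rewrite /fourier big_ord_recr /= opprD addrA.
rewrite rE.
have [r0|r0] := eqVneq (d m - fourier gs n (d m)) 0.
  have -> : '[d m, gs n] = 0; last by rewrite scale0r subr0.
  move/eqP : r0; rewrite subr_eq0 => /eqP ->.
  rewrite dot_suml big1// => k _; rewrite dotZl (@gs_orthonormal n.+1).
  - by rewrite ltn_eqF// mulr0.
  - by rewrite ltnS ltnW.
  - exact: ltnSn.
have [gs1 [gs0 [m' [rm' mmin gsE]]]] := gs_spec oe.
have m'm : (m' <= m)%N by apply: mmin; rewrite resid_gs.
have nm' : (n <= m')%N.
  by rewrite leqNgt; apply: contra rm' => m'n; rewrite resid_gs IHn.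
have {m'm nm' mmin} mE : m = m' by apply/eqP; rewrite eqn_leq m'm (leq_trans mn nm').
rewrite -mE resid_gs in gsE rm'.
set r := d m - _ in r0 rm' gsE *.
have rp : 0 < rnorm r by exact: rnorm_gt0.
have dE : d m = r + fourier gs n (d m) by rewrite subrK.
have fgs : '[fourier gs n (d m), gs n] = 0.
  rewrite dot_suml big1// => k _; rewrite dotZl (@gs_orthonormal n.+1).
  - by rewrite ltn_eqF// mulr0.
  - by rewrite ltnS ltnW.
  - exact: ltnSn.
rewrite [in '[_, _]]dE dotDl fgs addr0.
have rgs : r = (rnorm r)%:C *: gs n.
  by rewrite gsE scalerA -rmorphM /= mulfV ?gt_eqF// scale1r.
by rewrite {2}rgs dotZl dotxx gs1 expr1n mulr1 -rgs subrr.
Qed.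

Lemma gs_basis : orthonormal_basis gs.
Proof.
split=> [i j|x r r0].
  by apply: (@gs_orthonormal (maxn i j).+1); rewrite ltnS ?leq_maxl ?leq_maxr.
have [m xm] := dense_d x r0.
exists m.+1 => n mn.
have -> : x - fourier gs n x = (x - d m) - fourier gs n (x - d m).
  have /eqP := gs_resid0 mn; rewrite subr_eq0 => /eqP dE.
  by rewrite fourierB -dE opprB addrA subrK.
exact: le_trans (fourier_resid_le _ (@gs_orthonormal n)) (ltW xm).
Qed.

End GramSchmidt.

Lemma orthonormal_basis_exists : separable H -> infinite_dimensional H ->
  exists e, orthonormal_basis e.
Proof.
move=> [D cD dD] iH.
have D0 : D !=set0.
  have := dD setT; rewrite setTI; apply; [by exists 0|exact: openT].
have [z Dz] := D0.
have [d dE] : exists d : nat -> H, forall x, D x -> exists m, d m = x.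
  move/countable_injP : cD => [f finj].
  exists (fun m => xget z (D `&` [set x | f x = m])) => x Dx; exists (f x).
  have [Dy fy] := xgetPex z (ex_intro (D `&` [set y | f y = f x]) x (conj Dx erefl)).
  by apply: finj; rewrite ?inE.
exists (gs d); apply: gs_basis => // x r r0.
have rC : 0 < r%:C :> R[i] by rewrite ltcR.
have [||y [/ball_rnorm xy Dy]] := dD (ball x r%:C).
- by exists x; exact: ballxx.
- exact: ball_open.
by have [m dm] := dE _ Dy; exists m; rewrite dm.
Qed.

End Basis.

(** * Closed subspaces and eigenvectors of compact operators *)

Section ClosedSubspace.
Variables (R : realType) (H : hilbertType R).
Implicit Types (x y z u v : H) (T : compactOp H).

Record closed_subspace (Z : set H) : Prop := ClosedSubspace {
  csub0 : Z 0;
  csubP : forall k x y, Z x -> Z y -> Z (k *: x + y);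
  csub_closed : forall x, (forall d : R, 0 < d -> exists2 y, Z y & rnorm (x - y) < d) -> Z x
}.

Lemma csubZ (Z : set H) k x : closed_subspace Z -> Z x -> Z (k *: x).
Proof. by move=> cZ Zx; rewrite -(addr0 (_ *: _)); apply: (csubP cZ) => //; exact: csub0. Qed.

Lemma csub_orth (D : set H) : closed_subspace [set z | forall u, D u -> hdot H z u = 0].
Proof.
split=> [u _|k x y xD yD u Du|x xD u Du]; first by rewrite dot0l.
  by rewrite dotDl dotZl xD// yD// mulr0 addr0.
apply: (@rnorm_small _ (R[i]^o)) => e e0.
have u1 : 0 < rnorm u + 1 by rewrite ltr_wpDl ?rnorm_ge0.
have [y yD xy] := xD _ (divr_gt0 e0 u1).
rewrite -[hdot H x u]subr0 -(yD _ Du) -dotBl (le_trans (dot_rnorm _ _))//.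
rewrite (le_trans (ler_wpM2r (rnorm_ge0 u) (ltW xy)))//.
by rewrite mulrAC ler_pdivrMr// ler_pM2l// lerDl.
Qed.

Lemma csub_inter (Y Z : set H) : closed_subspace Y -> closed_subspace Z ->
  closed_subspace (Y `&` Z).
Proof.
move=> cY cZ; split; first by split; exact: csub0.
  by move=> k x y [Yx Zx] [Yy Zy]; split; apply: csubP.
move=> x xYZ; split; [apply: (csub_closed cY)|apply: (csub_closed cZ)] => d d0;
  by have [y [Yy Zy] xy] := xYZ _ d0; exists y.
Qed.

Lemma csub_eigen T (c : R[i]) : closed_subspace [set z | T z = c *: z].
Proof.
split=> [|k x y /= Tx Ty|x xT] /=; first by rewrite op0 scaler0.
  by rewrite opD opZ Tx Ty scalerDr !scalerA mulrC.
apply/eqP; rewrite -subr_eq0; apply/eqP; apply: rnorm_small => e e0.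
have N0 : 0 < rnorm T + rnorm c + 1 by rewrite ltr_wpDl// addr_ge0 ?rnorm_ge0.
have [y /= Ty xy] := xT _ (divr_gt0 e0 N0).
have -> : T x - c *: x = T (x - y) - c *: (x - y).
  by rewrite opB scalerBr Ty opprB addrA subrK.
rewrite (le_trans (rnormD _ _))// rnormN rnormZ.
have h1 := rnorm_op_le T (x - y).
have h2 := ler_wpM2l (addr_ge0 (rnorm_ge0 T) (rnorm_ge0 c)) (ltW xy).
have h3 : e / (rnorm T + rnorm c + 1) * (rnorm T + rnorm c + 1) = e by rewrite divfK ?gt_eqF.
have h4 : 0 < e / (rnorm T + rnorm c + 1) by rewrite divr_gt0.
move: h2 h3 h4; set q := e / _; nra.
Qed.

(** Along [F] the vectors T z cluster at some y, by compactness of [T], and kap z is asymptotic to T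
    z. As kap > 0, z clusters at y / kap. *)
Lemma compact_cluster T (kap : R) (F : set_system H) : ProperFilter F -> 0 < kap ->
  F [set z | rnorm z <= 1] ->
  (forall d : R, 0 < d -> F [set z | rnorm (T z - kap%:C *: z) <= d]) ->
  exists zeta, forall (d : R) (A : set H), 0 < d -> F A ->
    exists2 z, A z & rnorm (z - zeta) < d.
Proof.
move=> PF k0 F1 Fd.
have := op_compact T; rewrite /compact_map precompactE => /(_ (T @ F) _).
case.
  rewrite /nbhs /=; apply: filterS F1 => z z1.
  by apply: subset_closure; exists z => //=; rewrite unit_ballE.
move=> y [_ clF]; exists (kap^-1%:C *: y) => d A d0 FA.
have e0 : 0 < kap * d / 3 by rewrite divr_gt0// mulr_gt0.
have eC : 0 < (kap * d / 3)%:C :> R[i] by rewrite ltcR.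
pose B := A `&` [set z | rnorm (T z - kap%:C *: z) <= kap * d / 3].
have FTB : (T @ F) (T @` B).
  have FB : F B by apply: filterI => //; exact: Fd.
  suff : F (T @^-1` (T @` B)) by [].
  by apply: filterS FB => z zB; exists z.
have [w [[z [Az /= zT] <-] /ball_rnorm yT]] := clF _ _ FTB (nbhsx_ballx y _ eC).
exists z => //.
have -> : z - kap^-1%:C *: y = kap^-1%:C *: ((kap%:C *: z - T z) + (T z - y)).
  by rewrite addrA subrK scalerBr scalerA -rmorphM /= mulVf ?gt_eqF// scale1r.
rewrite rnorm_realC ?invr_ge0 ?ltW// mulrC ltr_pdivrMr//.
rewrite (le_lt_trans (rnormD _ _))// (rnormBC (_ *: _)) (rnormBC (T z) y).
rewrite (le_lt_trans (lerD zT (ltW yT)))//.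
have : 0 < kap * d by rewrite mulr_gt0.
by rewrite (mulrC d); lra.
Qed.

(** Variational: [kap] is the supremum of the quadratic form on the unit ball of [Z]. Near
    maximizers are near eigenvectors, and these cluster by [compact_cluster]. *)
Lemma top_eigenvector T (Z : set H) : star T = T -> (forall z, 0 <= hre (T z) z) ->
  closed_subspace Z -> (forall z, Z z -> Z (T z)) ->
  exists2 kap : R, 0 <= kap & (forall z, Z z -> hre (T z) z <= kap * rnorm z ^+ 2) /\
    (0 < kap -> exists zeta, [/\ Z zeta, rnorm zeta = 1 & T zeta = kap%:C *: zeta]).
Proof.
move=> sT T0 cZ TZ.
pose S := [set hre (T z) z | z in Z `&` [set z | rnorm z <= 1]].
have S0 : S 0 by exists 0; [split; [exact: csub0|rewrite /= rnorm0 ler01]|rewrite /hre dot0r].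
have Sub : has_ubound S.
  exists (rnorm T) => _ [z [Zz /= z1] <-].
  rewrite (le_trans (ler_norm _))// (le_trans (hre_le _ _))//.
  rewrite (le_trans (ler_wpM2r (rnorm_ge0 _) (rnorm_op_le T z)))//.
  by rewrite -mulrA ler_piMr ?rnorm_ge0// mulr_ile1 ?rnorm_ge0.
have Ssup : has_sup S by split=> //; exists 0.
pose kap := sup S.
have k0 : 0 <= kap by apply: ub_le_sup.
have kM z : Z z -> hre (T z) z <= kap * rnorm z ^+ 2.
  move=> Zz; have [->|z0] := eqVneq z 0.
    by rewrite /hre dot0r rnorm0 expr0n mulr0.
  have zp := rnorm_gt0 z0.
  have zE : z = (rnorm z)%:C *: ((rnorm z)^-1%:C *: z).
    by rewrite scalerA -rmorphM /= mulfV ?gt_eqF// scale1r.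
  rewrite {1 2}zE opZ hreZl hreZr mulrA -expr2 mulrC ler_pM2r ?exprn_gt0//.
  apply: ub_le_sup => //; exists ((rnorm z)^-1%:C *: z) => //.
  by split; [exact: csubZ|rewrite /= rnorm_normalize].
exists kap => //; split=> // kp.
have Tsym x y : hre (T x) y = hre x (T y) by rewrite /hre starP sT.
(* Positivity of the form at z - T z / kap, combined with the bound [kM] at T z. *)
have Tsq z : Z z -> rnorm (T z) ^+ 2 <= kap * hre (T z) z.
  move=> Zz; have := T0 (z + (- kap^-1)%:C *: T z).
  rewrite opD opZ hreDl !hreDr !hreZl !hreZr (Tsym (T z) z) !hre_norm.
  have := kM _ (TZ _ Zz).
  set a := hre (T z) z; set b := rnorm _ ^+ 2; set c := hre (T _) _ => cb h.
  have kV : 0 < kap^-1 by rewrite invr_gt0.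
  have h1 : kap^-1 * (kap^-1 * c) <= kap^-1 * b.
    by rewrite ler_pM2l// mulrC ler_pdivrMr// mulrC.
  have h2 : kap^-1 * b <= a by move: h h1; rewrite !mulNr !mulrN opprK; lra.
  by rewrite -ler_pdivrMl.
pose A d := [set z | [/\ Z z, rnorm z <= 1 & kap - d < hre (T z) z]].
pose F := filter_from [set d : R | 0 < d] A.
have FF : ProperFilter F.
  apply: filter_from_proper.
    apply: filter_from_filter; first by exists 1; exact: ltr01.
    move=> e1 e2 /= e10 e20; exists (Order.min e1 e2); first by rewrite /= lt_min e10.
    move=> z [Zz z1]; rewrite ltrBlDr -ltrBlDl lt_min => /andP[h1 h2].
    by split; split=> //; rewrite ltrBlDr -ltrBlDl.
  move=> d /= d0; have [_ [z [Zz z1] <-] zd] := sup_adherent d0 Ssup.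
  by exists z.
have FA d : 0 < d -> F (A d) by move=> d0; exists d.
(* Expanding the square and using [Tsq] leaves at most kap (kap - <T z, z>). *)
have AT d z : A d z -> rnorm (T z - kap%:C *: z) ^+ 2 <= kap * d.
  move=> [Zz z1 zd].
  rewrite rnormD2 rnormN hreNr hreZr (rnorm_realC _ (ltW kp)) exprMn.
  have h1 := Tsq _ Zz.
  have h2 : kap ^+ 2 * rnorm z ^+ 2 <= kap ^+ 2.
    by rewrite ler_piMr ?sqr_ge0// expr_le1// rnorm_ge0.
  have h3 : kap * (kap - hre (T z) z) <= kap * d by rewrite ler_pM2l//; lra.
  move: h1 h2 h3; rewrite (mulrBr kap) -expr2; lra.
have FT d : 0 < d -> F [set z | rnorm (T z - kap%:C *: z) <= d].
  move=> d0; have q0 : 0 < d ^+ 2 / kap by rewrite divr_gt0// exprn_gt0.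
  apply: filterS (FA _ q0) => z /AT /= h.
  by rewrite -ler_sqr ?nnegrE ?rnorm_ge0 ?(ltW d0)// (le_trans h)// mulrC divfK ?gt_eqF.
have F1 : F [set z | rnorm z <= 1] by apply: filterS (FA _ ltr01) => z [].
have [zeta zetaF] := compact_cluster FF kp F1 FT.
have Zzeta : Z zeta.
  apply: (csub_closed cZ) => d d0; have [z [Zz _ _] zz] := zetaF _ _ d0 (FA _ ltr01).
  by exists z => //; rewrite rnormBC.
have zeta0 : zeta != 0.
  apply/eqP => z0.
  have hk : 0 < kap / 2 by rewrite divr_gt0.
  have h12 : 0 < (1 / 2 : R) by rewrite divr_gt0.
  have [z [Zz _ zk]] := zetaF _ _ h12 (FA _ hk).
  rewrite z0 subr0 => zh; have := kM _ Zz; apply/negP; rewrite -ltNge.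
  apply: le_lt_trans zk.
  have -> : kap - kap / 2 = kap * (1 / 2) by lra.
  rewrite ler_pM2l// (le_trans _ (ltW zh))// expr2 ler_piMr ?rnorm_ge0//.
  by rewrite (le_trans (ltW zh))//; lra.
have Tz : T zeta = kap%:C *: zeta.
  apply/eqP; rewrite -subr_eq0; apply/eqP; apply: rnorm_small => d d0.
  have N0 : 0 < rnorm T + kap + 1 by rewrite ltr_wpDl// addr_ge0 ?rnorm_ge0.
  have q0 := divr_gt0 d0 N0.
  have [z zT zz] := zetaF _ _ q0 (FT _ q0).
  have -> : T zeta - kap%:C *: zeta =
      (T zeta - T z) + (T z - kap%:C *: z) + (kap%:C *: z - kap%:C *: zeta).
    by rewrite !addrA !subrK.
  rewrite (le_trans (rnormD _ _))// -scalerBr (rnorm_realC _ (ltW kp)) -opB.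
  have h1 := rnormD (T (zeta - z)) (T z - kap%:C *: z).
  have h2 := rnorm_op_le T (zeta - z); rewrite (rnormBC zeta) in h2.
  have h3 : d / (rnorm T + kap + 1) * (rnorm T + kap + 1) = d by rewrite divfK ?gt_eqF.
  have h4 : rnorm T * rnorm (z - zeta) <= rnorm T * (d / (rnorm T + kap + 1)).
    by rewrite ler_wpM2l ?rnorm_ge0// ltW.
  have h5 : kap * rnorm (z - zeta) <= kap * (d / (rnorm T + kap + 1)).
    by rewrite ler_wpM2l ?rnorm_ge0// ltW.
  rewrite (le_trans (lerD h1 (lexx _)))// (le_trans (lerD (lerD h2 zT) (lexx _)))//.
  rewrite (le_trans (lerD (lerD h4 (lexx _)) h5))// -[leRHS]h3.
  by set q := d / _; lra.
exists ((rnorm zeta)^-1%:C *: zeta); split; first exact: csubZ.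
  exact: rnorm_normalize.
by rewrite opZ Tz !scalerA mulrC.
Qed.

End ClosedSubspace.

(** * Order zero maps on C(X, K) *)

Section Approximation.
Variables (R : realType) (H : hilbertType R) (e : nat -> H).
Hypothesis eB : orthonormal_basis e.
Implicit Types (x y z u v : H) (T : compactOp H).

Definition projop n : compactOp H := \sum_(k < n) theta (e k) (e k).

Lemma projopE n x : projop n x = fourier e n x.
Proof. by rewrite /projop sum_op. Qed.

Lemma basis_upto n : orthonormal_upto e n.
Proof. by move=> i j _ _; exact: eB.1. Qed.

Lemma star_sum (A : cstarType R) (I : Type) (s : seq I) (P : pred I) (F : I -> A) :
  star (\sum_(i <- s | P i) F i) = \sum_(i <- s | P i) star (F i).
Proof.
elim/big_rec2: _ => [|i a b _ <-]; first by rewrite star0.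
by rewrite starD.
Qed.

Lemma star_projop n : star (projop n) = projop n.
Proof. by rewrite star_sum; apply: eq_bigr => k _; rewrite theta_star. Qed.

Lemma rnorm_projop n : rnorm (projop n) <= 1.
Proof.
apply: rnorm_op_leP => // x; rewrite mul1r projopE.
exact: fourier_le (@basis_upto n).
Qed.

(** Two successive nets reduce the claim to finitely many vectors: a net of operators for [A], then
    for each of them a net for the image of the unit ball. On finitely many vectors the Fourier sums
    converge uniformly. *)
Lemma projop_tbdd (A : set (compactOp H)) (d : R) : tbdd A -> 0 < d ->
  exists N, forall n T, (N <= n)%N -> A T -> rnorm (cmul (projop n) T - T) <= d.
Proof.
move=> tA d0; have d40 : 0 < d / 4 by rewrite divr_gt0.
have [s As] := tA _ d40.
have [t st] : exists t : seq H, forall S x, S \in s -> rnorm x <= 1 ->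
    exists2 y, y \in t & rnorm (S x - y) <= d / 4.
  elim: s {As} => [|S s [t IHs]]; first by exists [::].
  have /compact_mapP/(_ _ d40)[t' St'] := op_compact S.
  exists (t' ++ t) => U x; rewrite inE => /predU1P[->|Us] x1.
    by have [y yt' xy] := St' _ x1; exists y => //; rewrite mem_cat yt'.
  by have [y yt xy] := IHs _ _ Us x1; exists y => //; rewrite mem_cat yt orbT.
have [N tN] : exists N, forall n y, (N <= n)%N -> y \in t ->
    rnorm (y - fourier e n y) <= d / 4.
  elim: t {st} => [|y t [N IHt]]; first by exists 0%N.
  have [M yM] := eB.2 y _ d40.
  exists (maxn M N) => n z; rewrite geq_max => /andP[Mn Nn].
  by rewrite inE => /predU1P[->|zt]; [exact: yM|exact: IHt].
exists N => n T Nn /As[S Ss TS]; apply: rnorm_op_unit => [|x x1]; first exact: ltW.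
have [y yt Sy] := st _ _ Ss x1.
have oe := @basis_upto n.
rewrite op_funB cmulE projopE rnormBC.
have -> : T x - fourier e n (T x) = ((T x - y) - fourier e n (T x - y)) + (y - fourier e n y).
  by rewrite fourierB addrACA subrK -opprD subrK.
rewrite (le_trans (rnormD _ _))// (le_trans (lerD (fourier_resid_le _ oe) (tN _ _ Nn yt)))//.
have h1 := rnormB3 (T x) (S x) y.
have h2 : rnorm (T x - S x) <= d / 4.
  rewrite -op_funB (le_trans (rnorm_op_le _ _))// (le_trans (ler_wpM2l (rnorm_ge0 _) x1))//.
  by rewrite mulr1.
lra.
Qed.

Lemma projop_tbdd2 (A : set (compactOp H)) (d : R) : tbdd A -> 0 < d ->
  exists N, forall n T, (N <= n)%N -> A T ->
    rnorm (cmul (cmul (projop n) T) (projop n) - T) <= d.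
Proof.
move=> tA d0; have d20 : 0 < d / 2 by rewrite divr_gt0.
have tA' : tbdd [set star T | T in A].
  move=> r r0; have [s As] := tA r r0; exists (map star s) => _ [T AT <-].
  have [S Ss TS] := As _ AT; exists (star S); first exact: map_f.
  by rewrite -starB star_rnorm.
have [N1 h1] := projop_tbdd tA d20; have [N2 h2] := projop_tbdd tA' d20.
exists (maxn N1 N2) => n T; rewrite geq_max => /andP[n1 n2] AT.
have {}h1 := h1 _ _ n1 AT; have {}h2 := h2 _ (star T) n2 (ex_intro2 _ _ T AT erefl).
have -> : cmul (cmul (projop n) T) (projop n) - T =
    cmul (cmul (projop n) T - T) (projop n) + star (cmul (projop n) (star T) - star T).
  by rewrite starB starM !starK star_projop cmulBl addrA subrK.
rewrite (le_trans (rnormD _ _))// star_rnorm.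
have h3 : rnorm (cmul (cmul (projop n) T - T) (projop n)) <= d / 2.
  rewrite (le_trans (cnorm_rM _ _))// (le_trans _ h1)// ler_piMr ?rnorm_ge0//.
  exact: rnorm_projop.
lra.
Qed.

End Approximation.

Section CX.
Variables (R : realType) (X : topologicalType) (cX : compact [set: X]) (H : hilbertType R).
Local Notation K := (compactOp H).
Local Notation C := (cfun cX K).
Implicit Types (T : K) (F G a b c x y : C) (u v w : H).

Lemma ccst_continuous T : continuous (fun _ : X => T).
Proof. by move=> t; exact: cvg_cst. Qed.

Definition ccst T : C := CFun cX (@ccst_continuous T).

Lemma tens_continuous (f : X -> R) T : continuous f -> continuous (fun t => (f t)%:C *: T).
Proof.
move=> cf; apply/continuous_rnormP => t d d0.
have N0 : 0 < rnorm T + 1 by rewrite ltr_wpDl ?rnorm_ge0.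
have /cvgrPdist_lt/(_ _ (divr_gt0 d0 N0)) := cf t.
apply: filterS => s fs; rewrite -scalerBl -rmorphB rnormZ rnormC.
rewrite (@le_lt_trans _ _ (`|f t - f s| * (rnorm T + 1)))//; last by rewrite -ltr_pdivlMr.
by rewrite ler_wpM2l// lerDl.
Qed.

Definition tens (f : X -> R) (cf : continuous f) T : C := CFun cX (@tens_continuous f T cf).

Lemma tensE (f : X -> R) (cf : continuous f) T t : tens cf T t = (f t)%:C *: T.
Proof. by []. Qed.
Lemma ccstE T t : ccst T t = T. Proof. by []. Qed.
Lemma cfun_cmulE F G t : cmul F G t = cmul (F t) (G t). Proof. by []. Qed.
Lemma cfun_starE F t : star F t = star (F t). Proof. by []. Qed.
Lemma cfun_funB F G t : (F - G) t = F t - G t.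
Proof. by rewrite cfun_funD cfun_funN. Qed.
Lemma cfun_rnorm_le F t : rnorm (F t) <= rnorm F.
Proof. exact: cfun_norm_ub. Qed.

Lemma cfun_rnorm_leP F (M : R) : 0 <= M -> (forall t, rnorm (F t) <= M) -> rnorm F <= M.
Proof. exact: cfun_norm_leP. Qed.

Lemma cfun_tbdd F : tbdd (F @` [set: X]).
Proof.
apply/precompact_tbdd.
have Fcpt : compact (F @` [set: X]).
  by apply: continuous_compact => //; exact/continuous_subspaceT/cfun_continuous.
by rewrite precompact_closed//; exact: compact_closed (@norm_hausdorff _ _) Fcpt.
Qed.

Variables (e : nat -> H).
Hypothesis eB : orthonormal_basis e.

(** The constant functions with value [projop e n] thus form an approximate unit of C(X, K), because
    [F] has totally bounded range. *)
Lemma cfun_projop F (d : R) : 0 < d -> exists n, rnorm (cmul (ccst (projop e n)) F - F) <= d.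
Proof.
move=> d0; have [N FN] := projop_tbdd eB (cfun_tbdd F) d0.
exists N; apply: cfun_rnorm_leP => [|t]; first exact: ltW.
by rewrite cfun_funB; apply: FN => //; exists t.
Qed.

Variable phi : cpcoz C K.

Lemma ozD x y : phi (x + y) = phi x + phi y.
Proof. by have := oz_linear phi 1 x y; rewrite !scale1r. Qed.

Lemma oz0 : phi 0 = 0.
Proof. by have /eqP := ozD 0 0; rewrite addr0 eq_sym -subr_eq0 addrK => /eqP. Qed.

Lemma ozZ k x : phi (k *: x) = k *: phi x.
Proof. by have := oz_linear phi k x 0; rewrite /= oz0 !addr0. Qed.

Lemma ozB x y : phi (x - y) = phi x - phi y.
Proof. by rewrite -scaleN1r ozD ozZ scaleN1r. Qed.

Lemma oz_sum (I : Type) (s : seq I) (P : pred I) (F : I -> C) :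
  phi (\sum_(i <- s | P i) F i) = \sum_(i <- s | P i) phi (F i).
Proof.
elim/big_rec2: _ => [|i p q _ <-]; first by rewrite oz0.
by rewrite ozD.
Qed.

Lemma oz_rnorm x : rnorm (phi x) <= rnorm x.
Proof. by rewrite -lecR -!rnormE; exact: oz_contractive. Qed.

(** Complete positivity at n = 2: the matrix with entries c_i^* c_j is the square of the matrix with
    rows (a, b) and (0, 0). The conditionals let one statement cover all four entries. *)
Lemma oz_gram a b : exists B : 'M[K]_2, forall i j : 'I_2,
  phi (cmul (star (if i == 0 then a else b)) (if j == 0 then a else b)) =
  cmul (star (B 0 i)) (B 0 j) + cmul (star (B 1 i)) (B 1 j).
Proof.
pose c (i : 'I_2) := if i == 0 then a else b.
pose A : 'M[C]_2 := \matrix_(i, j) cmul (star (c i)) (c j).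
have Apos : mxpos A.
  exists (\matrix_(k, j) if k == 0 then c j else 0) => i j.
  by rewrite big_ord_recl big_ord1 !mxE /= star0 cmul0l addr0.
have [B hB] := oz_cp phi Apos.
exists B => i j; have := hB i j; rewrite !mxE => ->.
by rewrite big_ord_recl big_ord1; congr (_ + cmul (star (B _ _)) (B _ _)); apply: val_inj.
Qed.

(* Positivity of the image of [[a^* a, a^* b], [b^* a, b^* b]] at (w, z). *)
Lemma oz_quad a b w z :
  0 <= hre (phi (cmul (star a) a) w) w + 2 * hre (phi (cmul (star a) b) z) w +
       hre (phi (cmul (star b) b) z) z.
Proof.
have [B hB] := oz_gram a b.
rewrite (hB 0 0) (hB 0 1) (hB 1 1) /hre !op_funD !dotDl !cmulE.
rewrite !(starP (star _)) !starK -/(hre _ _).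
have h (S T : K) : 0 <= hre (S w) (S w) + 2 * hre (T z) (S w) + hre (T z) (T z).
  by rewrite !hre_norm (hreC (T z)) -rnormD2 sqr_ge0.
have := addr_ge0 (h (B 0 0) (B 0 1)) (h (B 1 0) (B 1 1)).
rewrite !raddfD /= -!/(hre _ _); lra.
Qed.

Lemma oz_star_gram a b : star (phi (cmul (star a) b)) = phi (cmul (star b) a).
Proof.
have [B hB] := oz_gram a b.
by rewrite (hB 0 1) (hB 1 0) starD !starM !starK.
Qed.

(** For a product P x this is the symmetry of a Gram matrix; the approximate unit reaches all
    [x]. *)
Lemma oz_star x : star (phi x) = phi (star x).
Proof.
apply/eqP; rewrite -subr_eq0; apply/eqP; apply: rnorm_small => d d0.
have d20 : 0 < d / 2 by rewrite divr_gt0.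
have [n xn] := cfun_projop x d20.
pose P := ccst (projop e n).
have sP : star P = P by apply: cfunP => t; rewrite cfun_starE ccstE star_projop.
have -> : star (phi x) - phi (star x) =
    phi (star (cmul P x - x)) - star (phi (cmul P x - x)).
  have := oz_star_gram P x; rewrite sP => h.
  by rewrite starB ozB [phi (cmul P x - x)]ozB starB h starM sP opprB [RHS]addrC addrA subrK.
rewrite (le_trans (rnormD _ _))// rnormN star_rnorm.
have := oz_rnorm (star (cmul P x - x)); have := oz_rnorm (cmul P x - x).
by rewrite star_rnorm; move: xn; rewrite -/P; lra.
Qed.

(* Kadison's inequality: [oz_quad] at a = P and w = - phi(P b) z, for P in an
   approximate unit of finite rank projections. *)
Lemma oz_kadison b z : rnorm (phi b z) ^+ 2 <= hre (phi (cmul (star b) b) z) z.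
Proof.
set B := hre _ _.
have hP n : rnorm (phi (cmul (ccst (projop e n)) b) z) ^+ 2 <= B.
  pose P := ccst (projop e n).
  have sP : star P = P by apply: cfunP => t; rewrite cfun_starE ccstE star_projop.
  pose w := phi (cmul P b) z.
  have := oz_quad P b (- w) z; rewrite {2}sP -/w -/B (hreNr w w) hre_norm.
  have -> : hre (phi (cmul (star P) P) (- w)) (- w) = hre (phi (cmul (star P) P) w) w.
    by rewrite -scaleN1r -(rmorphN1 (real_complex R)) opZ hreZl hreZr mulrA mulrNN mulr1 mul1r.
  have : hre (phi (cmul (star P) P) w) w <= rnorm w ^+ 2.
    rewrite (le_trans (ler_norm _))// (le_trans (hre_le _ _))// expr2.
    rewrite ler_wpM2r ?rnorm_ge0// (le_trans (rnorm_op_le _ _))//.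
    rewrite ler_piMl ?rnorm_ge0// (le_trans (oz_rnorm _))// cstar_rnorm expr_le1 ?rnorm_ge0//.
    by apply: cfun_rnorm_leP => // t; exact: rnorm_projop.
  by rewrite /w; lra.
have B0 : 0 <= B by apply: le_trans (hP 0%N); exact: sqr_ge0.
rewrite -[leRHS]sqr_sqrtr// ler_sqr ?nnegrE ?rnorm_ge0 ?sqrtr_ge0//.
apply/ler_addgt0Pr => d d0.
have z1 : 0 < rnorm z + 1 by rewrite ltr_wpDl ?rnorm_ge0.
have [n bn] := cfun_projop b (divr_gt0 d0 z1).
have -> : phi b z = phi (cmul (ccst (projop e n)) b) z - phi (cmul (ccst (projop e n)) b - b) z.
  by rewrite ozB op_funB opprB addrC subrK.
rewrite (le_trans (rnormD _ _))// rnormN lerD//.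
  by rewrite -ler_sqr ?nnegrE ?rnorm_ge0 ?sqrtr_ge0// sqr_sqrtr.
rewrite (le_trans (rnorm_op_le _ _))//.
rewrite (le_trans (ler_wpM2r (rnorm_ge0 _) (le_trans (oz_rnorm _) bn)))//.
by rewrite mulrAC ler_pdivrMr// ler_pM2l// lerDl.
Qed.

(** Cauchy-Schwarz for the form of [oz_quad]: at [t w] it is a polynomial in [t] that is never
    negative and has no constant term, hence no linear term either. *)
Lemma oz_kernel a b z : hre (phi (cmul (star b) b) z) z = 0 -> phi (cmul (star a) b) z = 0.
Proof.
move=> b0; apply: rnorm_eq0; apply/eqP; rewrite -sqrf_eq0 -hre_norm; apply/eqP.
set w := phi _ z.
have A0 : 0 <= hre (phi (cmul (star a) a) w) w.
  by have := oz_quad a 0 w 0; rewrite cmul0r oz0 star0 cmul0l oz0 /hre !dot0l /= mulr0 !addr0.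
apply: (quad_ge0 A0) => t.
have := oz_quad a b (t%:C *: w) z; rewrite b0 addr0 opZ hreZl !hreZr -/w.
by rewrite addrC expr2 !mulrA.
Qed.

(** The order zero condition speaks of positive elements, so it is applied to x^* x and y y^*.
    Kadison's inequality shows that the kernel of phi(b^* b) lies in that of phi(b), which strips
    off one factor; adjoints do the same on the other side. *)
Lemma oz_mul0 x y : cmul x y = 0 -> cmul (phi x) (phi y) = 0.
Proof.
move=> xy.
have kz (b : C) z : phi (cmul (star b) b) z = 0 -> phi b z = 0.
  move=> h; apply: rnorm_eq0; apply/eqP; rewrite -sqrf_eq0 eq_le sqr_ge0 andbT.
  by rewrite (le_trans (oz_kadison b z))// h /hre dot0l.
have h0 : cmul (phi (cmul (star x) x)) (phi (cmul y (star y))) = 0.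
  apply: oz_order_zero.
  - by exists x.
  - by exists (star y); rewrite starK.
  - by rewrite cmulA -(cmulA _ x y) xy cmul0r cmul0l.
have h1 : cmul (phi x) (phi (cmul y (star y))) = 0.
  apply: opP => z; rewrite cmulE; apply: kz.
  by rewrite -[RHS](op_fun0 z) -h0.
have h2 : cmul (phi (cmul y (star y))) (star (phi x)) = 0.
  have := congr1 star h1; rewrite starM star0 oz_star => <-.
  by rewrite starM starK.
have h3 : cmul (phi (star y)) (star (phi x)) = 0.
  apply: opP => z; rewrite cmulE; apply: kz.
  by rewrite starK -[RHS](op_fun0 z) -h2.
by rewrite -[LHS]starK starM oz_star h3 star0.
Qed.

(** Both sides equal phi(a P) phi(P b), since a P annihilates b - P b and a - a P annihilates P
    b. *)
Lemma oz_move_proj T a b : cmul T T = T ->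
  cmul (phi (cmul a (ccst T))) (phi b) = cmul (phi a) (phi (cmul (ccst T) b)).
Proof.
move=> TT; pose P := ccst T.
have PP : cmul P P = P by apply: cfunP => t; rewrite cfun_cmulE ccstE.
have h1 : cmul (phi (cmul a P)) (phi (b - cmul P b)) = 0.
  by apply: oz_mul0; rewrite cmulBr -!cmulA [cmul P (cmul P b)]cmulA PP subrr.
have h2 : cmul (phi (a - cmul a P)) (phi (cmul P b)) = 0.
  by apply: oz_mul0; rewrite cmulBl -!cmulA [cmul P (cmul P b)]cmulA PP subrr.
move/eqP : h1; rewrite ozB cmulBr subr_eq0 => /eqP ->.
by move/eqP : h2; rewrite ozB cmulBl subr_eq0 => /eqP ->.
Qed.

Lemma ccstD S T : ccst (S + T) = ccst S + ccst T.
Proof. by apply: cfunP. Qed.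

Lemma ccstZ k T : ccst (k *: T) = k *: ccst T.
Proof. by apply: cfunP. Qed.

Lemma ccst0 : ccst 0 = 0.
Proof. by apply: cfunP. Qed.

Lemma oz_move_diag u a b :
  cmul (phi (cmul a (ccst (theta u u)))) (phi b) =
  cmul (phi a) (phi (cmul (ccst (theta u u)) b)).
Proof.
have [->|u0] := eqVneq u 0.
  have -> : theta 0 0 = 0 :> K by apply: opP => z; rewrite thetaE scaler0.
  by rewrite ccst0 cmul0r cmul0l oz0 cmul0l cmul0r.
have up := rnorm_gt0 u0.
pose v := (rnorm u)^-1%:C *: u.
have v1 : rnorm v = 1 by exact: rnorm_normalize.
have -> : theta u u = (rnorm u ^+ 2)%:C *: theta v v.
  rewrite /v thetaZl thetaZr !scalerA.
  have -> : Num.conj ((rnorm u)^-1%:C : R[i]) = (rnorm u)^-1%:C by rewrite /= conj_Creal// complex_real.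
  rewrite -!rmorphM /=.
  have -> : rnorm u ^+ 2 * (rnorm u)^-1 / rnorm u = 1 by field; rewrite gt_eqF.
  by rewrite scale1r.
rewrite ccstZ cmulZr cmulZl !ozZ cmulZl cmulZr oz_move_proj//.
by rewrite thetaM dotxx v1 expr1n scale1r.
Qed.

Lemma theta_polar u v :
  2%:R *: theta u v = (theta (u + v) (u + v) - theta u u - theta v v) +
  'i *: (theta (u + 'i *: v) (u + 'i *: v) - theta u u - theta ('i *: v) ('i *: v)) :> K.
Proof.
have S w : theta (u + w) (u + w) - theta u u - theta w w = theta u w + theta w u :> K.
  have -> : theta (u + w) (u + w) = (theta u w + theta w u) + (theta u u + theta w w) :> K.
    by rewrite thetaDl !thetaDr [RHS]addrACA [theta u w + theta u u]addrC.
  by rewrite -[LHS]addrA -opprD addrK.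
have ii : 'i * Num.conj ('i : R[i]) = 1.
  by rewrite -normCK normc_def /= expr0n expr1n add0r sqrtr1 expr1n.
have i2 : 'i * 'i = -1 :> R[i] by rewrite -expr2 sqr_i.
rewrite !S thetaZl thetaZr scalerDr !scalerA ii i2 scaleN1r scale1r.
by rewrite addrACA subrr addr0 scaler_nat mulr2n.
Qed.

(** By polarization, a condition linear in the operator may be checked on the [theta w w], which are
    multiples of projections. *)
Lemma theta_ind (Q : K -> Prop) u v : (forall S T, Q S -> Q T -> Q (S + T)) ->
  (forall k T, Q T -> Q (k *: T)) -> (forall w, Q (theta w w)) -> Q (theta u v).
Proof.
move=> QD QZ Qd.
have QB S T : Q S -> Q T -> Q (S - T).
  by move=> QS QT; apply: QD => //; rewrite -scaleN1r; exact: QZ.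
have [k k2] : exists k : R[i], k * 2%:R = 1 by exists 2^-1; rewrite mulVf ?pnatr_eq0.
have <- : k *: (2%:R *: theta u v) = theta u v by rewrite scalerA k2 scale1r.
move: (2%:R *: _) (theta_polar u v) => S -> {S}.
exact: QZ _ _ (QD _ _ (QB _ _ (QB _ _ (Qd _) (Qd _)) (Qd _))
  (QZ _ _ (QB _ _ (QB _ _ (Qd _) (Qd _)) (Qd _)))).
Qed.

Lemma oz_move u v a b :
  cmul (phi (cmul a (ccst (theta u v)))) (phi b) =
  cmul (phi a) (phi (cmul (ccst (theta u v)) b)).
Proof.
pose Q T := cmul (phi (cmul a (ccst T))) (phi b) = cmul (phi a) (phi (cmul (ccst T) b)).
have QD S T : Q S -> Q T -> Q (S + T).
  by rewrite /Q ccstD cmulDr cmulDl !ozD cmulDl cmulDr => -> ->.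
have QZ k T : Q T -> Q (k *: T).
  by rewrite /Q ccstZ cmulZr cmulZl !ozZ cmulZl cmulZr => ->.
by apply: (@theta_ind Q) => // w; exact: oz_move_diag.
Qed.

(* With u and v orthogonal, x = k E11 - E12 and y = h E11 + k h E21, for the matrix
   units of span(u, v), satisfy x y = 0, so that phi(k E11) phi(h E11) is equal to
   phi(E12) phi(k h E21) and depends on k and h through k h only. *)
Lemma oz_exchange u v (f g f' g' : X -> R) (cf : continuous f) (cg : continuous g)
    (cf' : continuous f') (cg' : continuous g') :
  rnorm u = 1 -> rnorm v = 1 -> hdot H u v = 0 ->
  (forall t, g t * f t = g' t * f' t) ->
  cmul (phi (tens cg (theta u u))) (phi (tens cf (theta u u))) =
  cmul (phi (tens cg' (theta u u))) (phi (tens cf' (theta u u))).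
Proof.
move=> u1 v1 uv fg.
have vu : hdot H v u = 0 by rewrite hdotC uv conjC0.
have uu : hdot H u u = 1 by rewrite dotxx u1 expr1n.
have vv : hdot H v v = 1 by rewrite dotxx v1 expr1n.
have cfg : continuous (fun t => g t * f t) by move=> t; apply: cvgM; [exact: cg|exact: cf].
have key (k h : X -> R) (ck : continuous k) (ch : continuous h) :
    (forall t, k t * h t = g t * f t) ->
    cmul (phi (tens ck (theta u u))) (phi (tens ch (theta u u))) =
    cmul (phi (ccst (theta u v))) (phi (tens cfg (theta v u))).
  move=> kh.
  have h0 : cmul (phi (tens ck (theta u u) - ccst (theta u v)))
      (phi (tens ch (theta u u) + tens cfg (theta v u))) = 0.
    apply: oz_mul0; apply: cfunP => t.
    rewrite cfun_cmulE cfun_funB cfun_funD !tensE ccstE.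
    rewrite cmulBl !cmulDr !cmulZl !cmulZr !thetaM uu uv vu vv !scale0r !scale1r !scaler0.
    by rewrite addr0 add0r scalerA -rmorphM kh subrr.
  have h1 : cmul (phi (tens ck (theta u u))) (phi (tens cfg (theta v u))) = 0.
    apply: oz_mul0; apply: cfunP => t; rewrite cfun_cmulE !tensE.
    by rewrite cmulZl cmulZr thetaM vu scale0r !scaler0.
  have h2 : cmul (phi (ccst (theta u v))) (phi (tens ch (theta u u))) = 0.
    apply: oz_mul0; apply: cfunP => t; rewrite cfun_cmulE tensE ccstE.
    by rewrite cmulZr thetaM uv scale0r !scaler0.
  move/eqP : h0; rewrite ozB ozD cmulBl !cmulDr h1 h2 addr0 add0r subr_eq0.
  by move=> /eqP.
by rewrite (key g f)// (key g' f')// => t; rewrite fg.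
Qed.

End CX.

(** * Joint eigenvectors *)

(** The [W x] need not be open. If no finite list covered [A], the sets [B s] of missed points would
    generate a filter with a cluster point y in [A], although [W y] is disjoint from [B [:: y]]. *)
Lemma compact_finite_cover (X : topologicalType) (A : set X) (W : X -> set X) : compact A ->
  (forall x, A x -> nbhs x (W x)) ->
  exists s : seq X, (forall x, x \in s -> A x) /\
    forall y, A y -> exists2 x, x \in s & W x y.
Proof.
move=> cA xW; apply: contrapT => ns.
pose B (s : seq X) := A `&` [set y | forall x, x \in s -> A x -> ~ W x y].
have FB : ProperFilter (filter_from setT B).
  apply: filter_from_proper.
    apply: filter_from_filter; first by exists [::].
    move=> s t _ _; exists (s ++ t) => // y [Ay yst].
    by split; split=> // x xs Ax; apply: yst => //; rewrite mem_cat xs ?orbT.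
  move=> s _; apply: contrapT => nB; apply: ns; exists [seq x <- s | `[< A x >]].
  split=> [x|y Ay]; first by rewrite mem_filter => /andP[/asboolP].
  apply: contrapT => ny; apply: nB; exists y; split=> // x xs Ax Wxy.
  by apply: ny; exists x => //; rewrite mem_filter xs andbT; apply/asboolP.
have [|y [Ay clB]] := cA (filter_from setT B) FB; first by exists [::] => // y [].
have [|z [[_ zW] Wz]] := clB (B [:: y]) _ _ (xW _ Ay); first by exists [:: y].
by apply: (zW y) => //; rewrite inE.
Qed.

Section JointEigenvector.
Variables (R : realType) (X : topologicalType) (cX : compact [set: X]) (H : hilbertType R).
Local Notation K := (compactOp H).
Local Notation C := (cfun cX K).
Variables (d : X -> X -> R).
Hypothesis d0P : forall x y, d x y = 0 <-> x = y.
Hypothesis dC : forall x y, d x y = d y x.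
Hypothesis d3 : forall x y z, d x z <= d x y + d y z.
Hypothesis nbhsd : forall x (W : set X), nbhs x W <->
  exists2 r : R, 0 < r & [set y | d x y < r] `<=` W.

Lemma dist_continuous x : continuous (d x).
Proof.
move=> y; apply/cvgrPdist_lt => r r0; apply/nbhsd; exists r => // z yz.
rewrite (le_lt_trans _ yz)// ler_norml.
have h1 := d3 x y z; have h2 := d3 x z y; rewrite (dC z y) in h2.
by apply/andP; split; lra.
Qed.

Definition bump x r y : R := Order.max 0 (r - d x y).

Lemma bump_continuous x r : continuous (bump x r).
Proof.
move=> y; apply: (@continuous_max _ _ (fun=> 0) (fun y => r - d x y)); first exact: cvg_cst.
by apply: cvgB; [exact: cvg_cst|exact: dist_continuous].
Qed.

Lemma bump_ge0 x r y : 0 <= bump x r y.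
Proof. by rewrite le_max lexx. Qed.

Lemma dxx x : d x x = 0. Proof. exact/d0P. Qed.

Lemma bump_gt0 x r y : (0 < bump x r y) = (d x y < r).
Proof. by rewrite /bump lt_max ltxx /= subr_gt0. Qed.

Lemma bump_eq0 x r y : r <= d x y -> bump x r y = 0.
Proof. by move=> h; apply/max_idPl; rewrite subr_le0. Qed.

Variables (e : nat -> H).
Hypothesis eB : orthonormal_basis e.
Variable phi : cpcoz C K.

Local Notation p := (theta (e 0%N) (e 0%N)).
Local Notation rho cf := (phi (tens cX cf p)).
Local Notation h := (phi (ccst cX p)).

Lemma basis_norm k : rnorm (e k) = 1.
Proof.
apply/eqP; rewrite -sqrp_eq1 ?rnorm_ge0//; apply/eqP.
by apply: complexI; rewrite -dotxx eB.1 eqxx.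
Qed.

Lemma one_continuous : continuous (fun _ : X => 1 : R).
Proof. by move=> t; exact: cvg_cst. Qed.

Lemma rho1 : h = rho one_continuous.
Proof. by congr (phi _); apply: cfunP => t; rewrite tensE ccstE scale1r. Qed.

Lemma rho_exchange (f g f' g' : X -> R) (cf : continuous f) (cg : continuous g)
    (cf' : continuous f') (cg' : continuous g') z :
  (forall t, g t * f t = g' t * f' t) -> rho cg (rho cf z) = rho cg' (rho cf' z).
Proof.
move=> fg.
have := oz_exchange eB phi cf cg cf' cg' (basis_norm 0) (basis_norm 1) (eB.1 0%N 1%N) fg.
by move/(congr1 (fun T : K => T z)).
Qed.

Lemma rho_rnorm (f : X -> R) (cf : continuous f) (M : R) : 0 <= M ->
  (forall t, `|f t| <= M) -> rnorm (rho cf) <= M.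
Proof.
move=> M0 fM; apply: le_trans (oz_rnorm phi _) _.
apply: cfun_rnorm_leP => // t; rewrite tensE rnormZ rnormC.
rewrite -[leRHS]mulr1 ler_pM ?rnorm_ge0//.
by rewrite (le_trans (theta_rnorm _ _))// basis_norm mulr1.
Qed.

Lemma rho_lin (f g k : X -> R) (cf : continuous f) (cg : continuous g)
    (ck : continuous k) (a : R) :
  (forall t, k t = a * f t + g t) -> rho ck = a%:C *: rho cf + rho cg.
Proof.
move=> kE; rewrite -ozZ -ozD; congr (phi _); apply: cfunP => t.
by rewrite cfun_funD cfun_funZ !tensE scalerA -scalerDl -rmorphM -rmorphD kE.
Qed.

Lemma theta_basis_idem k : cmul (theta (e k) (e k)) (theta (e k) (e k)) = theta (e k) (e k).
Proof. by rewrite thetaM eB.1 eqxx scale1r. Qed.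

Lemma h_square : h = phi (cmul (star (ccst cX p)) (ccst cX p)).
Proof.
congr (phi _); apply: cfunP => t.
by rewrite cfun_cmulE cfun_starE !ccstE theta_star theta_basis_idem.
Qed.

Lemma h_star : star h = h.
Proof.
rewrite (oz_star eB); congr (phi _); apply: cfunP => t.
by rewrite cfun_starE ccstE theta_star.
Qed.

Lemma h_kadison z : rnorm (h z) ^+ 2 <= hre (h z) z.
Proof. by rewrite {2}h_square; exact: (oz_kadison eB). Qed.

Lemma h_rnorm : rnorm h <= 1.
Proof. by rewrite rho1; apply: rho_rnorm => // t; rewrite normr1. Qed.

(* Otherwise finitely many f killed by E would have a positive sum g, and g and 1/g
   would give h^2 = 0 on E. *)
Lemma concentration_point (E : set H) (kap : R) zeta : 0 < kap -> E zeta -> rnorm zeta = 1 ->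
  h zeta = kap%:C *: zeta ->
  exists x, forall (f : X -> R) (cf : continuous f), (forall t, 0 <= f t) -> 0 < f x ->
    exists2 z, E z & rho cf z <> 0.
Proof.
move=> kp Ez z1 hz; apply: contrapT => nx.
have ex x : exists f : {f : X -> R | continuous f}, [/\ forall t, 0 <= sval f t, 0 < sval f x &
    forall z, E z -> rho (svalP f) z = 0].
  apply: contrapT => nf; apply: nx; exists x => f cf f0 fx.
  apply: contrapT => nz; apply: nf; exists (exist _ f cf); split=> // z Ez'.
  by apply: contrapT => rz; apply: nz; exists z => // r0; apply: rz; rewrite -r0; congr (op_fun (phi _) z); exact: cfunP.
have [f fP] := choice ex.
have [|s [_ scov]] := @compact_finite_cover _ _ (fun x => [set t | 0 < sval (f x) t]) cX.
  move=> x _; have [_ fx _] := fP x.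
  have /cvgrPdist_lt/(_ _ fx) := svalP (f x) x.
  apply: filterS => t; rewrite ltr_norml => /andP[_].
  by rewrite /=; lra.
have [g [cg [gE gE0]]] : exists g : X -> R, exists cg : continuous g,
    (forall t, g t = \sum_(x <- s) sval (f x) t) /\ (forall z, E z -> rho cg z = 0).
  elim: (s) => [|x t [g [cg [gE gE0]]]].
    have c0 : continuous (fun _ : X => 0 : R) by move=> ?; exact: cvg_cst.
    exists (fun=> 0), c0; split=> [t|z _]; first by rewrite big_nil.
    rewrite (_ : tens _ _ _ = 0) ?oz0//.
    by apply: cfunP => t; rewrite tensE scale0r.
  have cfg : continuous (fun y => sval (f x) y + g y).
    by move=> y; apply: cvgD; [exact: (svalP (f x))|exact: cg].
  exists (fun y => sval (f x) y + g y), cfg; split=> [y|z Ez'].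
    by rewrite big_cons gE.
  rewrite (@rho_lin _ _ _ (svalP (f x)) cg cfg 1) => [|y]; last by rewrite mul1r.
  by rewrite scale1r op_funD gE0//; have [_ _ ->] := fP x; rewrite // addr0.
have gp t : 0 < g t.
  have [x xs fxt] := scov t I.
  rewrite gE (big_rem x)//= ltr_pwDl// sumr_ge0// => y _.
  by have [f0 _ _] := fP y.
have cV : continuous (fun t => (g t)^-1).
  by move=> t; apply: cvgV; [rewrite gt_eqF|exact: cg].
have hh : h (h zeta) = 0.
  rewrite rho1 -(@rho_exchange _ _ _ _ cg cV one_continuous one_continuous zeta).
    by rewrite gE0// op0.
  by move=> t; rewrite mulVf ?gt_eqF// mulr1.
have : rnorm (h (h zeta)) = kap * kap.
  by rewrite hz opZ hz !(rnorm_realC _ (ltW kp)) z1 mulr1.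
by rewrite hh rnorm0 => /esym/eqP; rewrite mulf_eq0 gt_eqF.
Qed.

Definition rho_invariant (Z : set H) := forall (f : X -> R) (cf : continuous f) z,
  Z z -> Z (rho cf z).

(** Stated on an invariant closed subspace so that it applies to the orthogonal complement of the
    eigenvectors found so far. The search takes place in the top eigenspace [E] of [h] on [Z], where
    [h] acts as a positive scalar. *)
Lemma joint_eigenvector (Z : set H) z0 : closed_subspace Z -> rho_invariant Z ->
  Z z0 -> h z0 <> 0 ->
  exists xi lam x, [/\ Z xi, rnorm xi = 1, 0 < lam &
    forall (f : X -> R) (cf : continuous f), rho cf xi = (lam * f x)%:C *: xi].
Proof.
move=> cZ rZ Zz0 hz0.
have hpos z : 0 <= hre (h z) z by apply: le_trans (h_kadison z); exact: sqr_ge0.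
have hZ z : Z z -> Z (h z) by rewrite rho1; exact: rZ.
have [kap k0 [kM kE]] := top_eigenvector h_star hpos cZ hZ.
have kp : 0 < kap.
  rewrite lt_neqAle k0 andbT eq_sym; apply/eqP => kz; apply: hz0.
  apply: rnorm_eq0; apply/eqP; rewrite -sqrf_eq0 eq_le sqr_ge0 andbT.
  by rewrite (le_trans (h_kadison z0))// (le_trans (kM _ Zz0))// kz mul0r.
have [zeta [Zzeta z1 hzeta]] := kE kp.
pose E := Z `&` [set z | h z = kap%:C *: z].
have cE : closed_subspace E by apply: csub_inter => //; exact: csub_eigen.
have [x xE] := @concentration_point E kap zeta kp (conj Zzeta hzeta) z1 hzeta.
pose close (r : R) (g : X -> R) (M : R) := forall t, d x t < r -> `|g t - g x| <= M.
(* Unit vectors of E on which phi acts nearly as the evaluation at x; compactness of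
   h makes them cluster at a joint eigenvector as r tends to 0. *)
pose A (r : R) := [set xi | [/\ E xi, rnorm xi = 1 &
  forall (g : X -> R) (cg : continuous g) (M : R), 0 < M -> close r g M ->
    rnorm (rho cg xi - (kap * g x)%:C *: xi) <= M]].
have A0 r : 0 < r -> A r !=set0.
  move=> r0.
  (* Applying the operator of the bump function to a suitable z in [E] gives a nonzero vector w,
     again in [E]. By exchange, [rho cg w] depends only on the values of g within distance r of
     x. *)
  have cb := @bump_continuous x r.
  have [|z [Zz hz] bz] := xE _ cb (@bump_ge0 x r); first by rewrite bump_gt0 dxx.
  set w := rho cb z in bz.
  have hw : h w = kap%:C *: w.
    rewrite /w rho1 (@rho_exchange _ _ _ _ cb one_continuous one_continuous cb).
      by rewrite -rho1 hz opZ.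
    by move=> t; rewrite mulrC.
  have w0 : w != 0 by apply/eqP.
  have Zw : Z w by exact: rZ.
  have w1 : 0 <= (rnorm w)^-1 by rewrite invr_ge0 rnorm_ge0.
  exists ((rnorm w)^-1%:C *: w); split.
  - by split; [exact: csubZ|rewrite /= opZ hw !scalerA mulrC].
  - exact: rnorm_normalize.
  move=> g cg M M0 gM.
  (* g - g x clipped to [-M, M]: it has sup norm at most M and agrees with g - g x wherever the bump
     function is nonzero. *)
  pose k t := Order.max (- M) (Order.min M (g t - g x)).
  have cgx : continuous (fun t => g t - g x).
    by move=> t; apply: cvgB; [exact: cg|exact: cvg_cst].
  have ck : continuous k.
    move=> t; apply: (@continuous_max _ _ (fun=> - M) (fun t => Order.min M (g t - g x))).
      exact: cvg_cst.
    by apply: (@continuous_min _ _ (fun=> M)); [exact: cvg_cst|exact: cgx].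
  have kM' t : `|k t| <= M.
    by rewrite ler_norml /k le_max lexx /= ge_max ge_min lexx /= andbT; lra.
  have gk : rho cg w - (kap * g x)%:C *: w = rho ck w.
    have -> : rho ck w = rho cgx w.
      apply: rho_exchange => t.
      have [rt|tr] := leP r (d x t); first by rewrite bump_eq0 ?mulr0.
      congr (_ * _); have := gM t tr; rewrite ler_norml => /andP[g1 g2].
      by rewrite /k (min_idPr g2) (max_idPr g1).
    rewrite (@rho_lin _ _ _ one_continuous cg cgx (- g x)) => [|t]; last first.
      by rewrite mulr1 addrC.
    rewrite op_funD op_funZ -rho1 hw scalerA -rmorphM addrC mulNr rmorphN scaleNr.
    by rewrite mulrC.
  rewrite opZ scalerA mulrC -scalerA -scalerBr gk (rnorm_realC _ w1).
  rewrite mulrC ler_pdivrMr ?rnorm_gt0// (le_trans (rnorm_op_le _ _))//.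
  by rewrite ler_wpM2r ?rnorm_ge0// rho_rnorm// ltW.
pose F := filter_from [set r : R | 0 < r] A.
have FF : ProperFilter F.
  apply: filter_from_proper => //.
  apply: filter_from_filter; first by exists 1; exact: ltr01.
  move=> r1 r2 /= r10 r20; exists (Order.min r1 r2); first by rewrite /= lt_min r10.
  move=> z [Ez zn zA]; split; split=> // g cg M M0 gM; apply: zA => // t;
    by rewrite lt_min => /andP[t1 t2]; apply: gM.
have FA r : 0 < r -> F (A r) by move=> r0; exists r.
have F1 : F [set z | rnorm z <= 1] by apply: filterS (FA _ ltr01) => z [_ /= ->].
have Fh r : 0 < r -> F [set z | rnorm (h z - kap%:C *: z) <= r].
  move=> r0; apply: filterS (FA _ ltr01) => z [[_ /= ->] _ _].
  by rewrite subrr rnorm0 ltW.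
have [xi xiF] := compact_cluster FF kp F1 Fh.
have [Zxi hxi] : E xi.
  apply: (csub_closed cE) => r r0; have [z [Ez _ _] zz] := xiF _ _ r0 (FA _ ltr01).
  by exists z => //; rewrite rnormBC.
have xi1 : rnorm xi = 1.
  apply/eqP; rewrite -subr_eq0 -normr_eq0 eq_le normr_ge0 andbT.
  apply/ler_addgt0Pr => r r0; rewrite add0r.
  have [z [_ zn _] zz] := xiF _ _ r0 (FA _ ltr01).
  have h1 := rnormD (xi - z) z; have h2 := rnormD (z - xi) xi.
  rewrite !subrK in h1 h2; rewrite (rnormBC xi) in h1.
  by rewrite ler_norml; lra.
exists xi, kap, x; split=> // f cf.
apply/eqP; rewrite -subr_eq0; apply/eqP; apply: rnorm_small => r r0.
set B := `|kap * f x|.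
have N0 : 0 < 2 + rnorm (rho cf) + B.
  by rewrite -addrA ltr_pwDl// addr_ge0 ?rnorm_ge0 ?normr_ge0.
have q0 := divr_gt0 r0 N0.
have [s s0 sf] : exists2 s, 0 < s & close s f (r / (2 + rnorm (rho cf) + B)).
  have /cvgrPdist_lt/(_ _ q0) := cf x; move/nbhsd => [s s0 sf]; exists s => // t xt.
  by rewrite distrC ltW// sf.
have [z [_ zn zA] zz] := xiF _ _ q0 (FA _ s0).
have zf := zA f cf _ q0 sf.
have -> : rho cf xi - (kap * f x)%:C *: xi = (rho cf xi - rho cf z) +
   (rho cf z - (kap * f x)%:C *: z) + ((kap * f x)%:C *: z - (kap * f x)%:C *: xi).
  by rewrite !addrA !subrK.
rewrite -opB -scalerBr (le_trans (rnormD _ _))//.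
rewrite (le_trans (lerD (rnormD _ _) (lexx _)))// rnormZ rnormC -/B.
have h1 := rnorm_op_le (rho cf) (xi - z); rewrite (rnormBC xi) in h1.
have h2 := ler_wpM2l (rnorm_ge0 (rho cf)) (ltW zz).
have h3 := ler_wpM2l (normr_ge0 (kap * f x)) (ltW zz).
have h4 : r / (2 + rnorm (rho cf) + B) * (2 + rnorm (rho cf) + B) = r by rewrite divfK ?gt_eqF.
move: h1 h2 h3 h4 zf q0; rewrite -/B; set q := r / _; lra.
Qed.

End JointEigenvector.

(** * Orthogonal families of isometries *)

(** If no list exhausted [D], lists of distinct elements could be extended one by one up to length
    [n]. *)
Lemma finite_enum (T : eqType) (D : T -> Prop) n :
  (forall s : seq T, uniq s -> (forall x, x \in s -> D x) -> (size s < n)%N) ->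
  exists s : seq T, [/\ uniq s, (size s < n)%N & forall x, x \in s <-> D x].
Proof.
move=> Dn; apply: contrapT => ns.
suff [s [us sD sn]] : exists s : seq T, [/\ uniq s, forall x, x \in s -> D x & size s = n].
  by have := Dn s us sD; rewrite sn ltnn.
have : exists s : seq T, [/\ uniq s, forall x, x \in s -> D x & size s = n]; last by [].
elim: {-2}n (leqnn n) => [_|m IHm mn]; first by exists [::].
have [s [us sD sm]] := IHm (ltnW mn).
have [x Dx xs] : exists2 x, D x & x \notin s.
  apply: contrapT => nx; apply: ns; exists s; split; [by []|by rewrite sm|move=> x; split].
    exact: sD.
  by move=> Dx; apply: contrapT => /negP xs; apply: nx; exists x.
exists (x :: s); split => /=; [by rewrite xs|move=> y|by rewrite sm].
by rewrite inE => /predU1P[->//|]; exact: sD.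
Qed.

Section Contractions.
Variables (R : realType) (H : hilbertType R).
Local Notation K := (compactOp H).
Implicit Types (T S : K) (z eta : H).

(** Isometries of an infinite-dimensional space are not in K, so they are kept as maps together with
    their adjoint. Asking only for contractions makes 0 available as a default; isometry comes from
    [orthogonal_family]. *)
Record contraction := Contraction {
  ctr :> H -> H;
  adj : H -> H;
  ctr_linear : linear ctr;
  ctr_adj : adjoint_of ctr adj;
  ctr_le : forall z, rnorm (ctr z) <= rnorm z
}.
Implicit Types V W : contraction.

Lemma adj_linear V : linear (adj V).
Proof. exact: adjoint_linear (@ctr_adj V). Qed.

Lemma adj_le V z : rnorm (adj V z) <= rnorm z.
Proof.
rewrite -[leRHS]mul1r; apply: (adjoint_le ler01 (@ctr_adj V)) => x.
by rewrite mul1r ctr_le.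
Qed.

Lemma ctr_dot V z eta : hdot H (V z) eta = hdot H z (adj V eta).
Proof. exact: ctr_adj. Qed.

Lemma ctr_dotr V z eta : hdot H eta (V z) = hdot H (adj V eta) z.
Proof. by rewrite hdotC ctr_dot -hdotC. Qed.

Lemma zero_adj : adjoint_of (fun _ : H => 0 : H) (fun _ : H => 0 : H).
Proof. by move=> x y; rewrite dot0l dot0r. Qed.

Lemma zero_ctr_le z : rnorm (0 : H) <= rnorm z.
Proof. by rewrite rnorm0 rnorm_ge0. Qed.

Definition zero_ctr : contraction :=
  Contraction (@op_zero_linear R H) zero_adj zero_ctr_le.

Lemma contraction_exists (f : H -> H) : linear f -> (forall z, rnorm (f z) <= rnorm z) ->
  exists V : contraction, forall z, V z = f z.
Proof.
move=> fl f1; have [|g fg] := @adjoint_exists _ _ f 1 fl ler01.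
  by move=> z; rewrite mul1r.
by exists (Contraction fl fg f1).
Qed.

Definition sand_fun V T W z := V (T (adj W z)).

Lemma sand_linear V T W : linear (sand_fun V T W).
Proof.
by move=> k x y; rewrite /sand_fun adj_linear op_linear ctr_linear.
Qed.

Lemma sand_compact V T W : compact_map (sand_fun V T W).
Proof.
apply: (@compact_map_comp _ _ V (fun z => T (adj W z)) 1 (@ctr_linear V) ler01).
  by move=> z; rewrite mul1r ctr_le.
have /compact_mapP Tc := op_compact T.
apply/compact_mapP => d d0; have [s sT] := Tc _ d0; exists s => z z1.
by apply: sT; exact: le_trans (adj_le _ _) z1.
Qed.

(** The operator V T W^*, which is compact although V and W need not be. *)
Definition sand V T W : K := CompactOp (@sand_linear V T W) (@sand_compact V T W).

Lemma sandE V T W z : sand V T W z = V (T (adj W z)). Proof. by []. Qed.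

Lemma ctr0 V : V 0 = 0. Proof. exact: linear_map0 (@ctr_linear V). Qed.
Lemma ctrD V x y : V (x + y) = V x + V y. Proof. exact: linear_mapD (@ctr_linear V) x y. Qed.
Lemma ctrZ V k x : V (k *: x) = k *: V x. Proof. exact: linear_mapZ (@ctr_linear V) k x. Qed.
Lemma adj0 V : adj V 0 = 0. Proof. exact: linear_map0 (@adj_linear V). Qed.
Lemma adjB V x y : adj V (x - y) = adj V x - adj V y.
Proof. exact: linear_mapB (@adj_linear V) x y. Qed.
Lemma adj_sum V (J : Type) (s : seq J) (P : pred J) (F : J -> H) :
  adj V (\sum_(i <- s | P i) F i) = \sum_(i <- s | P i) adj V (F i).
Proof.
elim/big_rec2: _ => [|i a b _ <-]; first by rewrite adj0.
exact: (linear_mapD (@adj_linear V)).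
Qed.

Lemma sand_star V T W : star (sand V T W) = sand W (star T) V.
Proof.
apply: op_star_uniq => x y; rewrite !sandE.
by rewrite ctr_dot starP ctr_dotr.
Qed.

Lemma sandD V S T W : sand V (S + T) W = sand V S W + sand V T W.
Proof. by apply: opP => z; rewrite op_funD !sandE op_funD ctrD. Qed.

Lemma sandZ V k T W : sand V (k *: T) W = k *: sand V T W.
Proof. by apply: opP => z; rewrite op_funZ !sandE op_funZ ctrZ. Qed.

Lemma sandB V S T W : sand V (S - T) W = sand V S W - sand V T W.
Proof. by rewrite -scaleN1r sandD sandZ scaleN1r. Qed.

Section Family.
Variables (I : eqType) (A : I -> Prop) (V : I -> contraction).

Definition orthogonal_family := forall i j, A i -> A j ->
  forall eta, adj (V i) (V j eta) = if i == j then eta else 0.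

Hypothesis Vo : orthogonal_family.

Lemma family_dot i j x y : A i -> A j ->
  hdot H (V i x) (V j y) = if i == j then hdot H x y else 0.
Proof.
move=> Ai Aj; rewrite ctr_dot Vo//.
by case: ifP => // _; rewrite dot0r.
Qed.

Lemma family_rnorm i x : A i -> rnorm (V i x) = rnorm x.
Proof.
move=> Ai; have := family_dot x x Ai Ai; rewrite eqxx !dotxx => /complexI.
by move/eqP; rewrite eqrXn2 ?rnorm_ge0// => /eqP.
Qed.

Variable s : seq I.
Hypotheses (us : uniq s) (sA : forall i, i \in s -> A i).

Lemma family_pyth (F : I -> H) :
  rnorm (\sum_(i <- s) V i (F i)) ^+ 2 = \sum_(i <- s) rnorm (F i) ^+ 2.
Proof.
rewrite pythagoras_sum//.
  by apply: eq_big_seq => i si; rewrite family_rnorm//; exact: sA.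
by move=> i j si sj ij; rewrite family_dot ?(negPf ij)//; exact: sA.
Qed.

Lemma family_adj_sum (F : I -> H) j : A j ->
  adj (V j) (\sum_(i <- s) V i (F i)) = if j \in s then F j else 0.
Proof.
move=> Aj; rewrite adj_sum.
case: ifPn => js.
  rewrite (bigD1_seq j)//= Vo// eqxx big_seq_cond big1 ?addr0// => i /andP[si ij].
  by rewrite Vo ?(eq_sym j) ?(negPf ij)//; exact: sA.
rewrite big_seq big1// => i si; rewrite Vo//; last exact: sA.
by case: eqP => // ji; rewrite ji si in js.
Qed.

Lemma family_resid z :
  rnorm (z - \sum_(i <- s) V i (adj (V i) z)) ^+ 2 + \sum_(i <- s) rnorm (adj (V i) z) ^+ 2 =
  rnorm z ^+ 2.
Proof.
set w := \sum_(i <- s) _.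
have zw : hdot H (z - w) w = 0.
  rewrite {2}/w dot_sumr big_seq big1// => i si.
  rewrite ctr_dotr adjB family_adj_sum ?si ?subrr ?dot0l//; exact: sA.
by rewrite -family_pyth -pythagoras// subrK.
Qed.

Lemma family_bessel z : \sum_(i <- s) rnorm (adj (V i) z) ^+ 2 <= rnorm z ^+ 2.
Proof. by rewrite -family_resid lerDr sqr_ge0. Qed.

Lemma family_resid_le z : rnorm (z - \sum_(i <- s) V i (adj (V i) z)) <= rnorm z.
Proof.
rewrite -ler_sqr ?nnegrE ?rnorm_ge0// -[leRHS]family_resid lerDl sumr_ge0// => i _.
exact: sqr_ge0.
Qed.

(** The summands live on mutually orthogonal subspaces, so the norm of the sum is controlled by the
    largest of them and not by their number. *)
Lemma sand_sum_rnorm (T : I -> K) (M : R) : 0 <= M ->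
  (forall i, i \in s -> rnorm (T i) <= M) ->
  rnorm (\sum_(i <- s) sand (V i) (T i) (V i)) <= M.
Proof.
move=> M0 TM; apply: rnorm_op_leP => // z.
rewrite -ler_sqr ?nnegrE ?mulr_ge0 ?rnorm_ge0// sum_op.
rewrite (family_pyth (fun i => T i (adj (V i) z))) exprMn.
apply: le_trans (ler_wpM2l (sqr_ge0 M) (family_bessel z)).
rewrite mulr_sumr big_seq [leRHS]big_seq; apply: ler_sum => i si.
rewrite -exprMn ler_sqr ?nnegrE ?mulr_ge0 ?rnorm_ge0//.
by rewrite (le_trans (rnorm_op_le _ _))// ler_wpM2r ?rnorm_ge0// TM.
Qed.

End Family.

End Contractions.

Section Representation.
Variables (R : realType) (X : topologicalType) (cX : compact [set: X]) (H : hilbertType R).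
Local Notation K := (compactOp H).
Local Notation C := (cfun cX K).

(* phi(F) = sum_i lam_i V_i F(x_i) V_i^* over the i with lam_i > 0; nothing is asked
   of V_i and x_i when lam_i = 0. *)
Record representation (I : eqType) (lam : I -> R) (pt : I -> X) (V : I -> contraction H)
    (phi : cpcoz C K) : Prop := Representation {
  rep_ge0 : forall i, 0 <= lam i;
  rep_le1 : forall i, lam i <= 1;
  rep_orth : orthogonal_family (fun i => 0 < lam i) V;
  rep_diag : forall i, 0 < lam i -> forall F eta,
    phi F (V i eta) = (lam i)%:C *: V i (F (pt i) eta);
  rep_approx : forall d : R, 0 < d -> exists s : seq I,
    [/\ uniq s, forall i, i \in s -> 0 < lam i & forall F,
      rnorm (phi F - \sum_(i <- s) sand (V i) ((lam i)%:C *: F (pt i)) (V i)) <= d * rnorm F]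
}.

End Representation.

(** * Structure of order zero maps *)

Section Structure.
Variables (R : realType) (X : topologicalType) (cX : compact [set: X]) (H : hilbertType R).
Local Notation K := (compactOp H).
Local Notation C := (cfun cX K).
Variables (d : X -> X -> R).
Hypothesis d0P : forall x y, d x y = 0 <-> x = y.
Hypothesis dC : forall x y, d x y = d y x.
Hypothesis d3 : forall x y z, d x z <= d x y + d y z.
Hypothesis nbhsd : forall x (W : set X), nbhs x W <->
  exists2 r : R, 0 < r & [set y | d x y < r] `<=` W.
Variables (e : nat -> H).
Hypothesis eB : orthonormal_basis e.
Variables (phi : cpcoz C K) (x0 : X).

Local Notation u := (e 0%N).
Local Notation rho cf := (phi (tens cX cf (theta u u))).
Local Notation h := (phi (ccst cX (theta u u))).
Local Notation ph T := (phi (ccst cX T)).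

Let u1 : rnorm u = 1 := basis_norm eB 0.

Definition joint_eigen (xi : H) (l : R) (x : X) := 0 < l /\
  forall (f : X -> R) (cf : continuous f), rho cf xi = (l * f x)%:C *: xi.

Definition eigen_system (S : set H) :=
  (forall xi, S xi -> rnorm xi = 1 /\ exists l x, joint_eigen xi l x) /\
  (forall xi zeta, S xi -> S zeta -> xi <> zeta -> hdot H xi zeta = 0).

Lemma rho_sym (f : X -> R) (cf : continuous f) z w :
  hdot H (rho cf z) w = hdot H z (rho cf w).
Proof.
rewrite starP (oz_star eB); congr (hdot H _ (phi _ _)); apply: cfunP => t.
rewrite cfun_starE !tensE starZ theta_star; congr (_ *: _).
by rewrite conj_Creal// complex_real.
Qed.

(** Zorn. The conclusion concerns [h z] and not [z], because phi may be degenerate. If [h z] were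
    nonzero, the orthogonal complement of [S], which is invariant, would contain a further joint
    eigenvector. *)
Lemma maximal_system : exists S, eigen_system S /\
  forall z, (forall xi, S xi -> hdot H z xi = 0) -> h z = 0.
Proof.
have [|S [[S1 S2] Smax]] := @Zorn_bigcup H eigen_system.
  move=> F FP Ft; split=> [xi [A FA Axi]|xi zeta [A FA Axi] [B FB Bz]].
    by have [h1 _] := FP _ FA; exact: h1.
  have [AB|BA] := Ft _ _ FA FB.
    by have [_ h2] := FP _ FB; apply: h2 => //; exact: AB.
  by have [_ h2] := FP _ FA; apply: h2 => //; exact: BA.
exists S; split=> // z zS; apply: contrapT => hz.
pose Z := [set z | forall xi, S xi -> hdot H z xi = 0].
have cZ : closed_subspace Z := csub_orth S.
have rZ : rho_invariant e phi Z.
  move=> f cf y Zy xi Sxi; rewrite rho_sym.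
  have [_ [l [x [_ ->]]]] := S1 _ Sxi.
  by rewrite dotZr Zy// mulr0.
have [xi [l [x [Zxi xi1 l0 xiE]]]] := joint_eigenvector d0P dC d3 nbhsd eB cZ rZ zS hz.
have nS : ~ S xi.
  move=> Sxi; have := Zxi _ Sxi; rewrite dotxx xi1 expr1n => /eqP.
  by rewrite oner_eq0.
apply: (Smax (S `|` [set xi])).
  split; first by move=> y Sy; left.
  by move=> /(_ xi) sub; apply: nS; apply: sub; right.
split=> [y [Sy|->]|y w [Sy|->] [Sw|->]] //.
- exact: S1.
- by split=> //; exists l, x.
- exact: S2.
- by move=> _; rewrite hdotC Zxi// conjC0.
- by move=> _; exact: Zxi.
Qed.

Lemma ccstM (S T : K) : cmul (ccst cX S) (ccst cX T) = ccst cX (cmul S T).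
Proof. exact: cfunP. Qed.

Lemma ccst_star (T : K) : star (ccst cX T) = ccst cX (star T).
Proof. exact: cfunP. Qed.

(** [theta z u] absorbs [theta u u] on its right; moving it across the product leaves [h] behind. *)
Lemma cmul_ph (F : C) z w : phi F (ph (theta z u) w) = phi (cmul F (ccst cX (theta z u))) (h w).
Proof.
have := oz_move eB phi z u F (ccst cX (theta u u)).
rewrite ccstM thetaM eB.1 eqxx scale1r.
by move/(congr1 (fun T : K => T w)); rewrite !cmulE => ->.
Qed.

Lemma ph_inner z z' w : ph (theta u z') (ph (theta z u) w) = hdot H z z' *: h (h w).
Proof.
rewrite cmul_ph ccstM thetaM ccstZ ozZ op_funZ.
done.
Qed.

Lemma ph_star (T : K) : star (ph T) = ph (star T).
Proof. by rewrite (oz_star eB) ccst_star. Qed.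

(** Heuristically phi is a homomorphism pi times a positive factor, equal to [l] at [xi]. Dividing
    by [l] leaves eta -> pi(|eta><u|) xi, isometric for a unit vector [xi] because pi(|u><u|) fixes
    it. *)
Definition eigen_map (l : R) (xi eta : H) : H := l^-1%:C *: ph (theta eta u) xi.

Lemma eigen_map_linear l xi : linear (eigen_map l xi).
Proof.
move=> k x y; rewrite /eigen_map thetaDl thetaZl ccstD ccstZ ozD ozZ.
by rewrite op_funD op_funZ scalerDr !scalerA mulrC.
Qed.

Lemma joint_eigen_h xi l x : joint_eigen xi l x -> h xi = l%:C *: xi.
Proof. by move=> [_ xiE]; rewrite rho1 xiE mulr1. Qed.

(** The factor l / l' does no harm: within an eigenvector system it is 1 for equal vectors, and
    otherwise multiplies a vanishing inner product. *)
Lemma eigen_map_dot xi l x zeta l' x' eta eta' :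
  joint_eigen xi l x -> joint_eigen zeta l' x' ->
  hdot H (eigen_map l xi eta) (eigen_map l' zeta eta') =
  (l / l')%:C * (hdot H eta eta' * hdot H xi zeta).
Proof.
move=> xiE zetaE; have [l0 _] := xiE; have [l'0 _] := zetaE.
rewrite /eigen_map dotZl dotZr starPr ph_star theta_star ph_inner.
rewrite (joint_eigen_h xiE) opZ (joint_eigen_h xiE) !dotZl.
have -> : Num.conj ((l'^-1)%:C : R[i]) = (l'^-1)%:C by rewrite conj_Creal// complex_real.
rewrite rmorphM /=.
have ll : (l^-1)%:C * l%:C = 1 :> R[i] by rewrite -rmorphM mulVf ?gt_eqF.
transitivity (((l^-1)%:C * l%:C) * (l%:C * (l'^-1)%:C * (hdot H eta eta' * hdot H xi zeta))).
  ring.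
by rewrite ll mul1r.
Qed.

Lemma cfun_eval_continuous (F : C) T eta : continuous (fun t => rnorm ((F t - T) eta)).
Proof.
move=> t; apply/cvgrPdist_lt => r r0.
have N0 : 0 < rnorm eta + 1 by rewrite ltr_wpDl ?rnorm_ge0.
have /continuous_rnormP/(_ t _ (divr_gt0 r0 N0)) := @cfun_continuous _ _ _ _ F.
apply: filterS => s Fts.
have le (a b : H) : `|rnorm a - rnorm b| <= rnorm (a - b).
  have h1 := rnormD (a - b) b; have h2 := rnormD (b - a) a.
  by move: h1 h2; rewrite !subrK (rnormBC b) => h1 h2; rewrite ler_norml; lra.
apply: le_lt_trans (le _ _) _; rewrite -op_funB opprB addrA subrK.
apply: le_lt_trans (rnorm_op_le _ _) _.
apply: (@le_lt_trans _ _ (rnorm (F t - F s) * (rnorm eta + 1))).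
  by rewrite ler_wpM2l ?rnorm_ge0// lerDl.
by rewrite -ltr_pdivlMr.
Qed.

(** The two sides differ by phi(G) xi, where G(t) = |(F(t) - F(x)) eta><u|. Now G^* G = g (x) p with
    g(x) = 0, so phi(G^* G) kills [xi], and by Kadison's inequality so does phi(G). *)
Lemma eigen_map_diag xi l x (F : C) eta : joint_eigen xi l x ->
  phi F (eigen_map l xi eta) = l%:C *: eigen_map l xi (F x eta).
Proof.
move=> xiE; have [l0 xiE'] := xiE.
have ll : l%:C * (l^-1)%:C = 1 :> R[i] by rewrite -rmorphM mulfV ?gt_eqF.
rewrite /eigen_map opZ cmul_ph (joint_eigen_h xiE) opZ !scalerA mulrC ll !scale1r.
apply/eqP; rewrite -subr_eq0 -op_funB -ozB; apply/eqP.
set G := _ - _.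
pose g t := rnorm ((F t - F x) eta) ^+ 2.
have cg : continuous g.
  by move=> t; apply: cvgM; exact: cfun_eval_continuous.
have GE : cmul (star G) G = tens cX cg (theta u u).
  apply: cfunP => t; rewrite cfun_cmulE cfun_starE tensE.
  have -> : G t = theta ((F t - F x) eta) u.
    rewrite /G cfun_funB cfun_cmulE !ccstE cmul_theta op_funB.
    by apply: opP => z; rewrite op_funB !thetaE scalerBr.
  by rewrite theta_star thetaM dotxx.
apply: rnorm_eq0; apply/eqP; rewrite -sqrf_eq0 eq_le sqr_ge0 andbT.
rewrite (le_trans (oz_kadison eB phi G xi))// GE xiE' /g subrr op_fun0 rnorm0.
by rewrite expr0n mulr0 scale0r /hre dot0l.
Qed.

(** [ph (theta eta eta)] is self-adjoint, and its square is |eta|^2 times [ph (theta eta u)] after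
    [ph (theta u eta)]. Kadison's inequality makes the former vanish on [w]. *)
Lemma ph_kernel z eta : h (ph (theta u eta) z) = 0 -> ph (theta eta eta) z = 0.
Proof.
set w := ph (theta u eta) z => hw.
have w0 : ph (theta eta u) w = 0.
  apply: rnorm_eq0; apply/eqP; rewrite -sqrf_eq0 eq_le sqr_ge0 andbT.
  rewrite (le_trans (oz_kadison eB phi _ w))// ccst_star ccstM theta_star thetaM.
  by rewrite ccstZ ozZ op_funZ hw scaler0 /hre dot0l.
have qq : ph (theta eta eta) (ph (theta eta eta) z) = 0.
  have := oz_move eB phi u eta (ccst cX (theta eta u)) (ccst cX (theta eta eta)).
  rewrite !ccstM !thetaM dotxx u1 expr1n scale1r ccstZ ozZ => /(congr1 (fun T : K => T z)).
  by rewrite !cmulE => ->; rewrite op_funZ opZ -/w w0 scaler0.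
apply: rnorm_eq0; apply/eqP; rewrite -sqrf_eq0 -hre_norm /hre starP ph_star theta_star.
by rewrite qq dot0r.
Qed.

(** Completeness criterion: it shows that phi vanishes on vectors orthogonal to the ranges of all
    the eigenvector maps. *)
Lemma oz_eq0 z : (forall eta, h (ph (theta u eta) z) = 0) -> forall F, phi F z = 0.
Proof.
move=> hz F.
have F1 eta : phi (cmul F (ccst cX (theta eta eta))) z = 0.
  (* F |eta><eta| is split as F |eta><u| times b = |u><eta|, for which b^* b = |eta><eta|. *)
  have := @oz_kernel _ _ _ _ phi (star (cmul F (ccst cX (theta eta u))))
    (ccst cX (theta u eta)) z.
  rewrite starK -cmulA !ccst_star !ccstM !theta_star !thetaM dotxx u1 expr1n scale1r.
  by apply; rewrite ph_kernel// /hre dot0l.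
have FP n : phi (cmul F (ccst cX (projop e n))) z = 0.
  have -> : cmul F (ccst cX (projop e n)) =
      \sum_(k < n) cmul F (ccst cX (theta (e k) (e k))).
    elim: n => [|n IHn].
      rewrite big_ord0 (_ : projop e 0 = 0); last by rewrite /projop big_ord0.
      by rewrite ccst0 cmul0r.
    rewrite big_ord_recr /= -IHn -cmulDr -ccstD.
    by rewrite /projop big_ord_recr.
  by rewrite oz_sum sum_op big1.
apply: rnorm_small => r r0.
have z1 : 0 < rnorm z + 1 by rewrite ltr_wpDl ?rnorm_ge0.
have [n Fn] := cfun_projop eB (star F) (divr_gt0 r0 z1).
have {}Fn : rnorm (F - cmul F (ccst cX (projop e n))) <= r / (rnorm z + 1).
  by rewrite rnormBC -[X in rnorm X]starK star_rnorm starB starM ccst_star star_projop.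
rewrite -[phi F z]subr0 -(FP n) -op_funB -ozB (le_trans (rnorm_op_le _ _))//.
rewrite (le_trans (ler_wpM2r (rnorm_ge0 _) (le_trans (oz_rnorm _ _) Fn)))//.
by rewrite mulrAC ler_pdivrMr// ler_pM2l// lerDl.
Qed.

Lemma joint_eigen_le1 xi l x : rnorm xi = 1 -> joint_eigen xi l x -> l <= 1.
Proof.
move=> xi1 xiE; have [l0 _] := xiE.
have := rnorm_op_le h xi; rewrite (joint_eigen_h xiE) (rnorm_realC _ (ltW l0)) xi1 !mulr1.
by move=> /le_trans; apply; exact: (h_rnorm eB phi).
Qed.

Lemma eigen_map_le xi l x eta : rnorm xi = 1 -> joint_eigen xi l x ->
  rnorm (eigen_map l xi eta) <= rnorm eta.
Proof.
move=> xi1 xiE; have [l0 _] := xiE.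
rewrite -ler_sqr ?nnegrE ?rnorm_ge0// le_eqVlt; apply/orP; left; apply/eqP.
apply: complexI; rewrite -!dotxx (eigen_map_dot _ _ xiE xiE) (dotxx xi) xi1 expr1n.
by rewrite divff ?gt_eqF// mulr1 mul1r.
Qed.

Lemma eigen_system_family (S : set H) : eigen_system S -> exists (lam : H -> R) (pt : H -> X)
    (V : H -> contraction H), forall xi,
  (S xi -> joint_eigen xi (lam xi) (pt xi) /\ forall eta, V xi eta = eigen_map (lam xi) xi eta) /\
  (~ S xi -> lam xi = 0).
Proof.
move=> [S1 _].
have ex xi : exists q : R * X * contraction H,
  (S xi -> joint_eigen xi q.1.1 q.1.2 /\ forall eta, q.2 eta = eigen_map q.1.1 xi eta) /\
  (~ S xi -> q.1.1 = 0).
  have [Sxi|nS] := pselect (S xi); last by exists (0, x0, zero_ctr H).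
  have [xi1 [l [x xiE]]] := S1 _ Sxi.
  have [V VE] := contraction_exists (eigen_map_linear l xi) (fun z => eigen_map_le z xi1 xiE).
  by exists (l, x, V).
have [q qP] := choice ex.
by exists (fun xi => (q xi).1.1), (fun xi => (q xi).1.2), (fun xi => (q xi).2).
Qed.

Theorem oz_representation : exists (I : eqType) (lam : I -> R) (pt : I -> X) (V : I -> contraction H),
  representation lam pt V phi.
Proof.
have [S [Ssys Smax]] := maximal_system.
have [S1 S2] := Ssys.
have [lam [pt [V VP]]] := eigen_system_family Ssys.
(* The eigenvectors index themselves: [I] is [H], with weight 0 off [S], so the system need not be
   enumerated. *)
exists H, lam, pt, V.
have SP xi : 0 < lam xi -> S xi.
  by move=> l0; apply: contrapT => nS; have [_ /(_ nS) lz] := VP xi; rewrite lz ltxx in l0.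
have SE xi : S xi -> joint_eigen xi (lam xi) (pt xi) by case: (VP xi) => h1 _ /h1[].
have SV xi eta : S xi -> V xi eta = eigen_map (lam xi) xi eta.
  by case: (VP xi) => h1 _ /h1[].
have Sl xi : S xi -> 0 < lam xi by move=> /SE[].
have Vdot xi zeta eta eta' : S xi -> S zeta ->
    hdot H (V xi eta) (V zeta eta') = if xi == zeta then hdot H eta eta' else 0.
  move=> Sxi Szeta; rewrite !SV// (eigen_map_dot _ _ (SE _ Sxi) (SE _ Szeta)).
  case: eqP => [<-|ne]; last by rewrite (S2 _ _ Sxi Szeta ne) !mulr0.
  by rewrite dotxx (S1 _ Sxi).1 expr1n mulr1 divff ?gt_eqF ?mul1r// Sl.
have orthV : orthogonal_family (fun i => 0 < lam i) V.
  move=> xi zeta /SP Sxi /SP Szeta eta; apply: dotI => v.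
  rewrite -ctr_dot Vdot//; case: eqP => // _; by rewrite dot0r.
have diagV xi : S xi -> forall F eta, phi F (V xi eta) = (lam xi)%:C *: V xi (F (pt xi) eta).
  by move=> Sxi F eta; rewrite !SV// (eigen_map_diag _ _ (SE _ Sxi)).
have complete z : (forall xi eta, S xi -> hdot H z (V xi eta) = 0) -> forall F, phi F z = 0.
  move=> zV; apply: oz_eq0 => eta; apply: Smax => xi Sxi.
  rewrite starP ph_star theta_star.
  have l0 := Sl _ Sxi.
  have -> : ph (theta eta u) xi = (lam xi)%:C *: V xi eta.
    by rewrite SV// /eigen_map scalerA -rmorphM mulfV ?gt_eqF// scale1r.
  by rewrite dotZr zV// mulr0.
split=> [xi|xi|||].
- have [/Sl/ltW//|nS] := pselect (S xi).
  by have [_ ->] := VP xi.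
- have [Sxi|nS] := pselect (S xi); last by have [_ ->] := VP xi.
  exact: joint_eigen_le1 (S1 _ Sxi).1 (SE _ Sxi).
- exact: orthV.
- by move=> xi /SP; exact: diagV.
move=> r r0.
have hxi xi : S xi -> h xi = (lam xi)%:C *: xi by move=> /SE /joint_eigen_h.
have r20 : 0 < r / 2 by rewrite divr_gt0.
have /compact_mapP/(_ _ r20)[t tP] := op_compact h.
(* For distinct xi in [S] of weight at least r, the vectors h xi are orthogonal of norm at least r,
   so more than r apart. Two of them cannot be within r / 2 of the same element of the net [t]. *)
have [|s [us _ sP]] := @finite_enum H (fun xi => S xi /\ r <= lam xi) (size t).+1.
  move=> s us sS; rewrite ltnS.
  pose y xi := xget 0 [set y | y \in t /\ rnorm (h xi - y) <= r / 2].
  have yP xi : xi \in s -> y xi \in t /\ rnorm (h xi - y xi) <= r / 2.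
    move=> xis; have [|y' yt yh] := tP xi; first by rewrite (S1 _ (sS _ xis).1).1.
    have ex : exists y, [set y | y \in t /\ rnorm (h xi - y) <= r / 2] y by exists y'.
    exact: (xgetPex 0 ex).
  have yinj : {in s &, injective y}.
    move=> xi zeta xis zs yy; apply: contrapT => ne.
    have [_ h1] := yP _ xis; have [_ h2] := yP _ zs.
    have [Sxi lxi] := sS _ xis; have [Sz lz] := sS _ zs.
    have h3 : rnorm (h xi - h zeta) <= r.
      rewrite (le_trans (rnormB3 _ (y xi) _))// {2}yy (rnormBC _ (h zeta)).
      by move: h1 h2; rewrite yy; lra.
    have : rnorm (h xi - h zeta) ^+ 2 <= r ^+ 2.
      by rewrite ler_sqr ?nnegrE ?rnorm_ge0 ?(ltW r0).
    rewrite pythagoras; last first.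
      by rewrite !hxi// -scaleN1r !(dotZl, dotZr) (S2 _ _ Sxi Sz ne) !mulr0.
    rewrite rnormN !hxi// !(rnorm_realC _ (ltW (Sl _ _)))//.
    rewrite (S1 _ Sxi).1 (S1 _ Sz).1 !mulr1.
    have : r ^+ 2 <= lam xi ^+ 2 by rewrite ler_sqr ?nnegrE ?(ltW r0)// (le_trans (ltW r0)).
    have : r ^+ 2 <= lam zeta ^+ 2 by rewrite ler_sqr ?nnegrE ?(ltW r0)// (le_trans (ltW r0)).
    have : 0 < r ^+ 2 by rewrite exprn_gt0.
    lra.
  rewrite -(size_map y s); apply: uniq_leq_size; first by rewrite map_inj_in_uniq.
  by move=> _ /mapP[xi xis ->]; have [] := yP _ xis.
exists s; split=> // [xi /sP[/Sl//]|F].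
have sS xi : xi \in s -> 0 < lam xi by move=> /sP[/Sl].
apply: rnorm_op_leP => [|z]; first by rewrite mulr_ge0 ?rnorm_ge0// ltW.
(* On the ranges of the chosen [V xi] phi(F) equals the finite sum, so the error at z is phi(F)
   applied to the part of z orthogonal to these ranges. *)
pose z' := z - \sum_(xi <- s) V xi (adj (V xi) z).
have -> : (phi F - \sum_(xi <- s) sand (V xi) ((lam xi)%:C *: F (pt xi)) (V xi)) z = phi F z'.
  rewrite op_funB sum_op opB; congr (_ - _); rewrite op_sum big_seq [RHS]big_seq.
  apply: eq_bigr => xi xis; rewrite diagV; last by apply/SP/sS.
  by rewrite sandE op_funZ ctrZ.
have z'z : rnorm z' <= rnorm z := family_resid_le orthV us sS z.
pose Z := [set z | forall w, (exists xi eta, xi \in s /\ w = V xi eta) -> hdot H z w = 0].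
have cZ : closed_subspace Z := csub_orth _.
have Zz' : Z z'.
  move=> _ [xi [eta [xis ->]]]; rewrite ctr_dotr adjB.
  rewrite (family_adj_sum orthV us sS (fun i => adj (V i) z) (sS _ xis)) xis.
  by rewrite subrr dot0l.
(* A top eigenvector of A orthogonal to the ranges of V xi, xi in s, has a nonzero
   component in the range of some V xi with lam xi < r. *)
pose A := cmul (star (phi F)) (phi F).
have Adot a b : hdot H (A a) b = hdot H (phi F a) (phi F b).
  by rewrite /A cmulE -starPr.
have AV xi eta a : S xi -> hdot H (A a) (V xi eta) =
    (lam xi ^+ 2)%:C * hdot H a (V xi (cmul (star F (pt xi)) (F (pt xi)) eta)).
  move=> Sxi; rewrite Adot diagV// dotZr starP (oz_star eB) diagV// dotZr mulrA.
  congr (_ * _).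
  by rewrite conj_Creal ?complex_real// -rmorphM.
have sA : star A = A by rewrite /A starM starK.
have A0 a : 0 <= hre (A a) a by rewrite /hre Adot -/(hre _ _) hre_norm sqr_ge0.
have AZ a : Z a -> Z (A a).
  move=> Za _ [xi [eta [xis ->]]]; rewrite AV; last exact/SP/sS.
  by rewrite Za ?mulr0//; exists xi, (cmul (star F (pt xi)) (F (pt xi)) eta).
have [kap k0 [kM kE]] := top_eigenvector sA A0 cZ AZ.
have kr : kap <= (r * rnorm F) ^+ 2.
  have [kz|kp] := leP kap 0; first exact: le_trans kz (sqr_ge0 _).
  have [zeta [Zzeta z1 Azeta]] := kE kp.
  have [xi [Sxi y0]] : exists xi, S xi /\ adj (V xi) zeta != 0.
    apply: contrapT => nxi.
    have Fz : phi F zeta = 0.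
      apply: complete => xi eta Sxi; rewrite ctr_dotr.
      have [->|yn] := eqVneq (adj (V xi) zeta) 0; first by rewrite dot0l.
      by case: nxi; exists xi.
    have : rnorm (A zeta) = kap by rewrite Azeta (rnorm_realC _ (ltW kp)) z1 mulr1.
    by rewrite /A cmulE Fz op0 rnorm0 => kz; rewrite -kz ltxx in kp.
  have xis : xi \notin s.
    apply/negP => xis; case/eqP: y0; apply: dotI => v.
    by rewrite dot0r -ctr_dot hdotC Zzeta ?conjC0//; exists xi, v.
  have lr : lam xi < r.
    by rewrite ltNge; apply: contra xis => rl; apply/sP.
  set y := adj (V xi) zeta in y0.
  have := AV xi y zeta Sxi; rewrite Azeta dotZl !ctr_dotr -/y dotxx.
  rewrite cmulE cfun_starE -starP dotxx -!rmorphM => /complexI yE.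
  have yp := rnorm_gt0 y0.
  rewrite -(ler_pM2r (exprn_gt0 2 yp)) yE exprMn -[leRHS]mulrA.
  apply: ler_pM; rewrite ?sqr_ge0//.
    by rewrite ler_sqr ?nnegrE ?(ltW r0) ?(ltW lr)// ltW// Sl.
  rewrite -exprMn ler_sqr ?nnegrE ?mulr_ge0 ?rnorm_ge0//.
  rewrite (le_trans (rnorm_op_le _ _))// ler_wpM2r ?rnorm_ge0//.
  exact: cfun_rnorm_le.
have rF : 0 <= r * rnorm F by rewrite mulr_ge0 ?rnorm_ge0// ltW.
rewrite (@le_trans _ _ (r * rnorm F * rnorm z'))//; last by rewrite ler_wpM2l.
rewrite -ler_sqr ?nnegrE ?mulr_ge0 ?rnorm_ge0//; last by rewrite ltW.
rewrite exprMn (le_trans _ (ler_wpM2r (sqr_ge0 _) kr))// (le_trans _ (kM _ Zz'))//.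
by rewrite /hre Adot -/(hre _ _) hre_norm.
Qed.

End Structure.

(** * Comparison of order zero maps *)

Lemma exists_lincomb (F : fieldType) (I : eqType) (s : seq I) m (M : I -> 'I_m -> F) :
  uniq s -> (m < size s)%N ->
  exists2 c : I -> F, (exists2 i, i \in s & c i != 0) &
    forall k, \sum_(i <- s) c i * M i k = 0.
Proof.
move=> us ms; pose t := in_tuple s.
pose A := \matrix_(k < size s, l < m) M (tnth t k) l.
have kn0 : kermx A != 0.
  rewrite -mxrank_eq0 mxrank_ker subn_eq0 -ltnNge.
  exact: leq_ltn_trans (rank_leq_col A) ms.
have /rowV0Pn[k /sub_kermxP kA kn] := kn0.
(* Turns coefficients indexed by positions into coefficients indexed by elements; each sum over a
   position in [t] has one term, as [s] has no repetition. *)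
pose c i := \sum_(l < size s | tnth t l == i) k 0 l.
have cE l : c (tnth t l) = k 0 l.
  rewrite /c (bigD1 l)//= big1 ?addr0// => l' /andP[/eqP tl nl].
  by case/eqP: nl; have /tuple_uniqP tinj : uniq t by []; exact: tinj.
exists c.
  have /rV0Pn[l kl] := kn.
  by exists (tnth t l); rewrite ?mem_tnth// cE.
move=> l; rewrite (big_tnth _ _ s).
transitivity ((k *m A) 0 l); last by rewrite kA mxE.
by rewrite mxE; apply: eq_bigr => i _; rewrite cE mxE.
Qed.

Lemma exists_lower_bound (R : realDomainType) (T : eqType) (s : seq T) (f : T -> R) :
  (forall x, x \in s -> 0 < f x) -> exists2 r, 0 < r & forall x, x \in s -> r <= f x.
Proof.
elim: s => [|x s IHs] fs; first by exists 1.
have [|r r0 rs] := IHs; first by move=> y ys; apply: fs; rewrite inE ys orbT.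
exists (Order.min (f x) r); first by rewrite lt_min r0 andbT fs ?inE ?eqxx.
move=> y; rewrite inE => /predU1P[->|ys]; first by rewrite ge_min lexx.
by rewrite ge_min rs ?orbT.
Qed.

Lemma cvg_rnormP (R : realType) (V : normedModType R[i]) (w : nat -> V) (l : V) :
  (w n @[n --> \oo] --> l) <->
  forall r : R, 0 < r -> exists N, forall n, (N <= n)%N -> rnorm (l - w n) < r.
Proof.
split=> [wl r r0|wl].
  have rC : 0 < r%:C :> R[i] by rewrite ltcR.
  have /cvg_ballP/(_ _ rC)[N _ wN] := wl.
  by exists N => n Nn; apply/ball_rnorm/wN.
apply/cvg_ballP => rr /gt0_complexE[-> r0].
have [N wN] := wl _ r0.
by exists N => // n Nn; apply/ball_rnorm/wN.
Qed.

Lemma family_dot_sum (R : realType) (H : hilbertType R) (I : eqType) (A : I -> Prop)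
    (V : I -> contraction H) (s : seq I) (F G : I -> H) : orthogonal_family A V ->
  uniq s -> (forall i, i \in s -> A i) ->
  hdot H (\sum_(i <- s) V i (F i)) (\sum_(i <- s) V i (G i)) = \sum_(i <- s) hdot H (F i) (G i).
Proof.
move=> Vo us sA; rewrite dot_sumr big_seq [RHS]big_seq; apply: eq_bigr => i si.
by rewrite ctr_dotr (family_adj_sum Vo us sA) ?si//; exact: sA.
Qed.

Section Comparison.
Variables (R : realType) (X : topologicalType) (cX : compact [set: X]) (H : hilbertType R).
Local Notation K := (compactOp H).
Local Notation C := (cfun cX K).
Variables (d : X -> X -> R).
Hypothesis d0P : forall x y, d x y = 0 <-> x = y.
Hypothesis dC : forall x y, d x y = d y x.
Hypothesis d3 : forall x y z, d x z <= d x y + d y z.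
Hypothesis nbhsd : forall x (W : set X), nbhs x W <->
  exists2 r : R, 0 < r & [set y | d x y < r] `<=` W.
Variables (e : nat -> H).
Hypothesis eB : orthonormal_basis e.
Local Notation u := (e 0%N).

(** Says that the multiplicity at [x] is at least [n]; with all [n] at once, infinite values need no
    separate treatment. *)
Definition mult_ge (I : eqType) (lam : I -> R) (pt : I -> X) (x : X) (n : nat) :=
  forall r : R, 0 < r -> exists s : seq I, [/\ uniq s, size s = n &
    forall i, i \in s -> 0 < lam i /\ d x (pt i) < r].

Variables (I J : eqType) (lam : I -> R) (mu : J -> R) (pt : I -> X) (qt : J -> X).
Variables (V : I -> contraction H) (W : J -> contraction H).
Variables (phi psi : cpcoz C K).
Hypotheses (rphi : representation lam pt V phi) (rpsi : representation mu qt W psi).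

Lemma rep_vanish (f : X -> R) (cf : continuous f) w :
  (forall j, 0 < mu j -> f (qt j) != 0 -> hdot H w (W j u) = 0) ->
  psi (tens cX cf (theta u u)) w = 0.
Proof.
move=> wW; set F := tens _ _ _; apply: rnorm_small => r r0.
have N0 : 0 < rnorm F * rnorm w + 1 by rewrite ltr_wpDl// mulr_ge0 ?rnorm_ge0.
have [s [us sA sF]] := rep_approx rpsi (divr_gt0 r0 N0).
have s0 : (\sum_(j <- s) sand (W j) ((mu j)%:C *: F (qt j)) (W j)) w = 0.
  rewrite sum_op big_seq big1// => j js.
  rewrite sandE op_funZ /F tensE op_funZ thetaE -ctr_dotr.
  have [f0|f0] := eqVneq (f (qt j)) 0; first by rewrite f0 scale0r scaler0 ctr0.
  by rewrite wW ?sA// scale0r !scaler0 ctr0.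
rewrite -[psi F w]subr0 -s0 -op_funB (le_trans (rnorm_op_le _ _))//.
rewrite (le_trans (ler_wpM2r (rnorm_ge0 _) (sF F)))//.
by rewrite -mulrA mulrAC ler_pdivrMr// ler_pM2l// lerDl.
Qed.

(** With fewer than [n] indices of psi near [x], some nonzero combination z of n vectors [V i u] has
    T z orthogonal to every [W j u] that matters. Then psi(F) kills T z, while phi(F) is bounded
    below at z. *)
Lemma cuntz_le_mult x n : cuntz_le phi psi -> mult_ge lam pt x n -> mult_ge mu qt x n.
Proof.
move=> [b bP] mx r r0; apply: contrapT => nt.
have [s [us sn sP]] := mx r r0.
have [t [ut tn tP]] : exists t : seq J, [/\ uniq t, (size t < n)%N &
    forall j, j \in t <-> 0 < mu j /\ d x (qt j) < r].
  apply: finite_enum => t ut tP; rewrite ltnNge; apply/negP => nlt; apply: nt.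
  exists (take n t); split; [exact: take_uniq|exact: size_takel|].
  by move=> j /mem_take; exact: tP.
have cf : continuous (bump d x r) := @bump_continuous _ _ d dC d3 nbhsd x r.
pose F := tens cX cf (theta u u).
have u1 := basis_norm eB 0.
have sA i : i \in s -> 0 < lam i by move=> /sP[].
(* [del] bounds from below the eigenvalues of phi(F) on the span of the chosen [V i u]. An
   approximation of phi(F) closer than [del] therefore cannot vanish at z. *)
have [del del0 delP] := @exists_lower_bound _ _ s (fun i => lam i * bump d x r (pt i))
  (fun i si => let: conj l0 xi := sP i si in
     mulr_gt0 l0 (etrans (bump_gt0 d x r (pt i)) xi)).
have [N bN] := (cvg_rnormP _ _).1 (bP F) _ del0.
have {bN bP} := bN N (leqnn N); set T := b N => TN.
(* n unknown coefficients against fewer than n linear conditions. *)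
have [|c [i0 si0 ci0] cM] := @exists_lincomb _ _ s (size t)
    (fun i k => hdot H (T (V i u)) (W (tnth (in_tuple t) k) u)) us; first by rewrite sn.
pose z := \sum_(i <- s) V i (c i *: u).
have Tz : psi F (T z) = 0.
  apply: rep_vanish => j mj fj.
  have jt : j \in t.
    apply/tP; split=> //; rewrite ltNge; apply: contra fj => rd.
    by rewrite bump_eq0.
  have /tnthP[k jk] : j \in in_tuple t by [].
  rewrite jk /z op_sum dot_suml -[RHS](cM k); apply: eq_bigr => i _.
  by rewrite ctrZ opZ dotZl.
have zz : rnorm z ^+ 2 = \sum_(i <- s) rnorm (c i) ^+ 2.
  rewrite (family_pyth (rep_orth rphi) us sA); apply: eq_bigr => i _.
  by rewrite rnormZ u1 mulr1.
have Fz : hre (phi F z) z = \sum_(i <- s) (lam i * bump d x r (pt i)) * rnorm (c i) ^+ 2.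
  have -> : phi F z = \sum_(i <- s) V i ((lam i * bump d x r (pt i))%:C *: (c i *: u)).
    rewrite op_sum big_seq [RHS]big_seq; apply: eq_bigr => i si.
    rewrite (rep_diag rphi)//; last exact: sA.
    rewrite opZ tensE op_funZ thetaE dotxx u1 expr1n scale1r -ctrZ !scalerA.
    by congr (V i (_ *: _)); rewrite rmorphM /= mulrAC mulrC mulrA.
  rewrite /hre (family_dot_sum _ _ (rep_orth rphi) us sA) raddf_sum.
  apply: eq_bigr => i _; rewrite -[RHS]/(_ * _) /= -/(hre _ _) hreZl hre_norm.
  by rewrite rnormZ u1 mulr1.
have z0 : 0 < rnorm z ^+ 2.
  rewrite zz (big_rem i0)//= ltr_pwDl//; first by rewrite exprn_gt0// rnorm_gt0.
  by rewrite sumr_ge0// => i _; exact: sqr_ge0.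
have h1 : del * rnorm z ^+ 2 <= hre (phi F z) z.
  rewrite zz Fz mulr_sumr big_seq [leRHS]big_seq; apply: ler_sum => i si.
  by rewrite ler_wpM2r ?sqr_ge0// delP.
have h2 : hre (phi F z) z <= rnorm (phi F - cmul (cmul (star T) (psi F)) T) * rnorm z ^+ 2.
  have -> : phi F z = (phi F - cmul (cmul (star T) (psi F)) T) z.
    by rewrite op_funB !cmulE Tz op0 subr0.
  rewrite (le_trans (ler_norm _))// (le_trans (hre_le _ _))// expr2 mulrA.
  by rewrite ler_wpM2r ?rnorm_ge0// rnorm_op_le.
have : del * rnorm z ^+ 2 < del * rnorm z ^+ 2.
  by rewrite (le_lt_trans (le_trans h1 h2))// ltr_pM2r.
by rewrite ltxx.
Qed.

Lemma uniformly_continuous (F : C) (r : R) : 0 < r ->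
  exists2 q, 0 < q & forall x y, d x y < q -> rnorm (F x - F y) <= r.
Proof.
move=> r0; have r20 : 0 < r / 2 by rewrite divr_gt0.
have ex x : exists q, 0 < q /\ forall y, d x y < q -> rnorm (F x - F y) < r / 2.
  have := (continuous_rnormP F).1 (@cfun_continuous _ _ _ _ F) x _ r20.
  by move=> /nbhsd[q q0 qF]; exists q.
have [q qP] := choice ex.
have [|s [_ scov]] := @compact_finite_cover _ _ (fun x => [set y | d x y < q x / 2]) cX.
  move=> x _; apply/nbhsd; exists (q x / 2) => //; have [q0 _] := qP x.
  by rewrite divr_gt0.
have [|r' r'0 r's] := @exists_lower_bound _ _ s (fun x => q x / 2).
  by move=> x _; rewrite divr_gt0//; have [] := qP x.
exists r' => // y z yz; have [x xs xy] := scov y Logic.I.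
have [q0 qx] := qP x.
have h3 := r's _ xs; have h4 := d3 x y z.
move: xy => /= xy.
rewrite (le_trans (rnormB3 _ (F x) _))// (rnormBC (F y)).
by rewrite [leRHS](splitr r) lerD// ltW// qx//; lra.
Qed.

Hypothesis mle : forall x n, mult_ge lam pt x n -> mult_ge mu qt x n.

Lemma matching (s : seq I) (i0 : I) (r : R) : uniq s -> i0 \in s ->
  (forall i, i \in s -> 0 < lam i) -> 0 < r ->
  exists2 sig : I -> J, {in s &, injective sig} &
    forall i, i \in s -> 0 < mu (sig i) /\ d (pt i) (qt (sig i)) < r.
Proof.
move=> us si0 sA r0.
pose D := [seq pq <- [seq (pt i, pt j) | i <- s, j <- s] | pq.1 != pq.2].
have [|r' r'0 r'D] := @exists_lower_bound _ _ D (fun pq => d pq.1 pq.2).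
  move=> [x y]; rewrite mem_filter /= => /andP[xy _].
  have dxy : 0 <= d x y.
    have := d3 x y x; rewrite (dC y x) (d0P x x).2//; lra.
  by rewrite lt_neqAle dxy andbT eq_sym; apply: contra_neq xy => /d0P.
(* Balls of radius q around distinct points pt i are disjoint, so the matchings
   chosen around each point can be put together. *)
pose q := Order.min r (r' / 2).
have q0 : 0 < q by rewrite lt_min r0 divr_gt0.
pose sx x := [seq i <- s | pt i == x].
have ex x : exists l : seq J, [/\ uniq l, size l = size (sx x) &
    forall j, j \in l -> 0 < mu j /\ d x (qt j) < q].
  apply: mle => //= p p0; exists (sx x); split=> //; first exact: filter_uniq.
  move=> i; rewrite mem_filter => /andP[/eqP -> si]; split; first exact: sA.
  by rewrite (d0P x x).2.
have [L LP] := choice ex.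
have idx i : i \in s -> (index i (sx (pt i)) < size (L (pt i)))%N.
  by move=> si; have [_ -> _] := LP (pt i); rewrite index_mem mem_filter eqxx.
(* [J] is not known to be inhabited; the nonempty list at [pt i0] supplies the default value for
   [nth]. *)
have [j0 _] : exists j0 : J, true.
  by have := idx _ si0; case: (L _) => // j l; exists j.
pose sig i := nth j0 (L (pt i)) (index i (sx (pt i))).
have sigP i : i \in s -> 0 < mu (sig i) /\ d (pt i) (qt (sig i)) < q.
  by move=> si; have [_ _] := LP (pt i); apply; exact/mem_nth/idx.
exists sig; last first.
  by move=> i /sigP[h1]; rewrite lt_min => /andP[].
move=> i j si sj sij.
have [pij|pij] := eqVneq (pt i) (pt j).
  have [ul _ _] := LP (pt i).
  move: sij; rewrite /sig -pij => /eqP; rewrite nth_uniq ?idx//; last first.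
    by rewrite pij idx.
  by move=> /eqP; apply: (index_inj i); rewrite mem_filter ?si ?sj ?pij eqxx.
have [_ di] := sigP _ si; have [_ dj] := sigP _ sj.
have dij : r' <= d (pt i) (pt j).
  apply: (r'D (pt i, pt j)); rewrite mem_filter /= pij /=.
  by apply/allpairsP; exists (i, j).
have := d3 (pt i) (qt (sig i)) (pt j); rewrite (dC (qt _) (pt j)) {2}sij.
move: di dj; rewrite !lt_min => /andP[_ di] /andP[_ dj] h.
by exfalso; clear sij; lra.
Qed.

End Comparison.

(** * From multiplicities to Cuntz comparison *)

Section Comparison2.
Variables (R : realType) (X : topologicalType) (cX : compact [set: X]) (H : hilbertType R).
Local Notation K := (compactOp H).
Local Notation C := (cfun cX K).
Variables (d : X -> X -> R).
Hypothesis d0P : forall x y, d x y = 0 <-> x = y.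
Hypothesis dC : forall x y, d x y = d y x.
Hypothesis d3 : forall x y z, d x z <= d x y + d y z.
Hypothesis nbhsd : forall x (W : set X), nbhs x W <->
  exists2 r : R, 0 < r & [set y | d x y < r] `<=` W.
Variables (e : nat -> H).
Hypothesis eB : orthonormal_basis e.
Variables (I J : eqType) (lam : I -> R) (mu : J -> R) (pt : I -> X) (qt : J -> X).
Variables (V : I -> contraction H) (W : J -> contraction H).
Variables (phi psi : cpcoz C K).
Hypotheses (rphi : representation lam pt V phi) (rpsi : representation mu qt W psi).
Hypothesis mle : forall x n, mult_ge d lam pt x n -> mult_ge d mu qt x n.

(** The square of [c i] turns the weight [mu (sig i)] into [lam i]. The compact [P] keeps [b] in K,
    at the price of replacing F by its compression. *)
Lemma compression (s : seq I) (sig : I -> J) (P : K) : uniq s -> star P = P ->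
  (forall i, i \in s -> 0 < lam i) -> {in s &, injective sig} ->
  (forall i, i \in s -> 0 < mu (sig i)) ->
  exists b : K, forall F : C, cmul (cmul (star b) (psi F)) b =
    \sum_(i <- s) sand (V i) ((lam i)%:C *: cmul (cmul P (F (qt (sig i)))) P) (V i).
Proof.
move=> us sP sA sinj sM.
pose c i : R := Num.sqrt (lam i / mu (sig i)).
exists (\sum_(i <- s) (c i)%:C *: sand (W (sig i)) P (V i)) => F.
have Wo : orthogonal_family (fun i => i \in s) (fun i => W (sig i)).
  move=> i j si sj eta; rewrite (rep_orth rpsi) ?sM//.
  have [->|ij] := eqVneq i j; first by rewrite eqxx.
  by case: eqP => // /sinj ijE; rewrite ijE ?eqxx in ij.
apply: opP => z; rewrite !cmulE star_sum !sum_op op_sum.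
have -> : \sum_(i <- s) psi F (((c i)%:C *: sand (W (sig i)) P (V i)) z) =
    \sum_(i <- s) W (sig i) ((c i * mu (sig i))%:C *: F (qt (sig i)) (P (adj (V i) z))).
  rewrite big_seq [RHS]big_seq; apply: eq_bigr => i si.
  by rewrite op_funZ sandE opZ (rep_diag rpsi) ?sM// -ctrZ -ctrZ scalerA -rmorphM.
rewrite big_seq [RHS]big_seq; apply: eq_bigr => i si.
rewrite starZ sand_star sP op_funZ !sandE.
rewrite (family_adj_sum Wo us (fun _ h => h) _ si) si opZ ctrZ scalerA.
rewrite op_funZ !cmulE ctrZ; congr (_ *: _).
have -> : Num.conj ((c i)%:C : R[i]) = (c i)%:C by rewrite conj_Creal// complex_real.
rewrite -rmorphM mulrA -expr2 sqr_sqrtr ?divfK ?gt_eqF ?sM//.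
by rewrite divr_ge0 ?ltW ?sA ?sM.
Qed.

(** [b] is chosen before [F], because one sequence has to serve all functions. The same [r] bounds
    the truncation error and the distance between matched points; the dependence on [F] is confined
    to [M]. *)
Lemma compression_approx n (r : R) : 0 < r -> exists b : K, forall (F : C) (M : R), 0 <= M ->
  (forall x y, d x y < r -> rnorm (F x - cmul (cmul (projop e n) (F y)) (projop e n)) <= M) ->
  rnorm (phi F - cmul (cmul (star b) (psi F)) b) <= r * rnorm F + M.
Proof.
move=> r0; have [s [us sA sF]] := rep_approx rphi r0.
case: s us sA sF => [|i0 s'] us sA sF.
  exists 0 => F M M0 _; have := sF F; rewrite big_nil cmul0r !subr0.
  by move=> /le_trans; apply; rewrite lerDl.
set s := i0 :: s' in us sA sF; have si0 : i0 \in s by rewrite inE eqxx.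
have [sig sinj sM] := matching d0P dC d3 mle us si0 sA r0.
have [b bE] := compression us (star_projop e n) sA sinj (fun i si => (sM i si).1).
exists b => F M M0 FM; rewrite bE.
rewrite (le_trans (rnormB3 _ (\sum_(i <- s) sand (V i) ((lam i)%:C *: F (pt i)) (V i)) _))//.
rewrite lerD// -sumrB.
under eq_bigr do rewrite -sandB -scalerBr.
apply: (sand_sum_rnorm (rep_orth rphi) us sA) => // i si.
rewrite (rnorm_realC _ (rep_ge0 rphi i)) (le_trans _ (FM _ _ (sM i si).2))//.
by rewrite ler_piMl ?rnorm_ge0// (rep_le1 rphi).
Qed.

Lemma mult_cuntz_le : cuntz_le phi psi.
Proof.
pose r n : R := n.+1%:R^-1.
have r0 n : 0 < r n by rewrite invr_gt0.
have [b bP] := choice (fun n => compression_approx n (r0 n)).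
exists b => F; apply/cvg_rnormP => q q0.
have q40 : 0 < q / 4 by rewrite divr_gt0.
have [q' q'0 Fq'] := uniformly_continuous d3 nbhsd F q40.
have [N1 N1P] := projop_tbdd2 eB (cfun_tbdd F) q40.
pose t := Order.min q' (q / 4 / (rnorm F + 1)).
have F1 : 0 < rnorm F + 1 by rewrite ltr_wpDl ?rnorm_ge0.
have t0 : 0 < t by rewrite lt_min q'0 divr_gt0.
pose N2 := Num.truncn t^-1.
have rt n : (N2 <= n)%N -> r n < t.
  move=> Nn; rewrite /r invf_plt ?posrE//.
  have tV : 0 <= t^-1 by rewrite invr_ge0 ltW.
  have /andP[_ h] := truncn_itv tV.
  by rewrite (lt_le_trans h)// ler_nat.
exists (maxn N1 N2) => n; rewrite geq_max => /andP[n1 n2].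
have := rt _ n2; rewrite lt_min => /andP[rq' rF].
have := bP n F (q / 4 + q / 4) => /(_ _ _)/le_lt_trans; apply.
- by rewrite addr_ge0 ?ltW.
- move=> x y xy; rewrite (le_trans (rnormB3 _ (F y) _))// lerD//.
    by apply: Fq'; exact: lt_trans xy rq'.
  by rewrite rnormBC; apply: N1P => //; exists y.
have : r n * rnorm F <= q / 4.
  rewrite (@le_trans _ _ (r n * (rnorm F + 1)))//.
    by rewrite ler_wpM2l ?lerDl// ltW.
  by rewrite -ler_pdivlMr// ltW.
lra.
Qed.

End Comparison2.

(** * Multiplicities *)

Section ExtendedNat.
Implicit Types a b : enat.

(** If [P] fails somewhere, its least failure is positive by [P 0], and the predecessor of that
    number is the value. *)
Lemma enat_exists (P : nat -> Prop) : P 0%N -> (forall m n, (m <= n)%N -> P n -> P m) ->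
  exists a, forall n, P n <-> ele (Some n) a.
Proof.
move=> P0 Pmono; have [Pall|/existsNP nP] := pselect (forall n, P n); first by exists None.
have ex : exists n, `[< ~ P n >] by have [n nPn] := nP; exists n; apply/asboolP.
case: (ex_minnP ex) => -[|m] /asboolP nPm mmin; first by [].
exists (Some m) => n /=; split=> [Pn|nm].
  rewrite leqNgt; apply/negP => mn; apply: nPm; exact: Pmono Pn.
apply: (Pmono n m nm); apply: contrapT => nPm'.
by have := mmin m (asboolT nPm'); rewrite ltnn.
Qed.

Lemma eleP a b : (forall n, ele (Some n) a -> ele (Some n) b) <-> ele a b.
Proof.
case: a b => [a|] [b|] /=; split=> //.
- by move=> /(_ a (leqnn a)).
- by move=> ab n /leq_trans; apply.
- by move=> /(_ b.+1 isT); rewrite ltnn.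
Qed.

Lemma eleD a b n : ele (Some n) (eadd a b) <->
  exists k l, [/\ n = (k + l)%N, ele (Some k) a & ele (Some l) b].
Proof.
case: a b => [a|] [b|] /=; last 3 first.
- by split=> // _; exists 0%N, n.
- by split=> // _; exists n, 0%N; rewrite addn0.
- by split=> // _; exists n, 0%N; rewrite addn0.
split=> [nab|[k [l [-> ka lb]]]]; last exact: leq_add.
exists (minn n a), (n - minn n a)%N; split.
- by rewrite subnKC// geq_minl.
- exact: geq_minr.
- rewrite leq_subLR; have [na|an] := leqP n a; last by [].
  by rewrite leq_addr.
Qed.

End ExtendedNat.

Section Multiplicity.
Variables (R : realType) (X : topologicalType).
Variables (d : X -> X -> R).
Hypothesis d0P : forall x y, d x y = 0 <-> x = y.
Hypothesis dC : forall x y, d x y = d y x.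
Hypothesis d3 : forall x y z, d x z <= d x y + d y z.
Hypothesis nbhsd : forall x (W : set X), nbhs x W <->
  exists2 r : R, 0 < r & [set y | d x y < r] `<=` W.

Lemma dist_gt0 x y : x <> y -> 0 < d x y.
Proof.
move=> xy; rewrite lt_neqAle; apply/andP; split.
  by apply/eqP => /esym /d0P.
by have := d3 x y x; rewrite (dC y x) (d0P x x).2//; lra.
Qed.

Section OneFamily.
Variables (I : eqType) (lam : I -> R) (pt : I -> X).

Lemma mult_ge0 x : mult_ge d lam pt x 0.
Proof. by move=> r r0; exists [::]. Qed.

Lemma mult_ge_mono x m n : (m <= n)%N -> mult_ge d lam pt x n -> mult_ge d lam pt x m.
Proof.
move=> mn xn r r0; have [s [us sn sP]] := xn r r0.
exists (take m s); split; [exact: take_uniq|by rewrite size_takel ?sn|].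
by move=> i /mem_take; exact: sP.
Qed.

Lemma mult_ge1 x : mult_ge d lam pt x 1 <->
  forall r, 0 < r -> exists2 i, 0 < lam i & d x (pt i) < r.
Proof.
split=> [x1 r r0|x1 r r0].
  have [s [_ ss sP]] := x1 r r0; case: s ss sP => [//|i s] _ sP.
  by have [|l0 xi] := sP i; [rewrite inE eqxx|exists i].
have [i l0 xi] := x1 r r0; exists [:: i]; split=> // j; by rewrite inE => /eqP ->.
Qed.

(** Indices are added one at a time, each closer to [x] than all earlier ones and hence new. To
    leave room for the next, the distance must stay positive: choose y different from x, then an
    index closer to y than x is. *)
Lemma mult_ge_limit x : limit_point [set y | mult_ge d lam pt y 1] x ->
  forall n, mult_ge d lam pt x n.
Proof.
move=> lx n r r0.
suff [s [us sn sP]] : exists s : seq I, [/\ uniq s, size s = n &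
    forall i, i \in s -> [/\ 0 < lam i, 0 < d x (pt i) & d x (pt i) < r]].
  by exists s; split=> // i /sP[].
elim: n => [|n [s [us sn sP]]]; first by exists [::].
have [|q q0 qs] := @exists_lower_bound _ _ s (fun i => d x (pt i)); first by move=> i /sP[].
pose p := Order.min q r.
have p0 : 0 < p by rewrite lt_min q0.
have [|y [/eqP yx /= y1 xy]] := lx [set y | d x y < p / 2].
  by apply/nbhsd; exists (p / 2) => //; rewrite divr_gt0.
have xy0 : 0 < d x y by apply: dist_gt0 => xy'; apply: yx.
have [i l0 yi] := (mult_ge1 y).1 y1 _ xy0.
have h1 := d3 x (pt i) y; have h2 := d3 x y (pt i); rewrite (dC (pt i)) in h1.
have hp : d x (pt i) < p by move: xy => /= xy; lra.
have {}hp : d x (pt i) < q /\ d x (pt i) < r by move: hp; rewrite lt_min => /andP[].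
exists (i :: s); split=> /=.
- rewrite us andbT; apply/negP => /qs; rewrite leNgt; case: hp => -> //.
- by rewrite sn.
- move=> j; rewrite inE => /predU1P[->|]; last exact: sP.
  by split=> //; [lra|case: hp].
Qed.

Lemma mult_multfun : exists nu : multfun X, forall x n,
  mult_ge d lam pt x n <-> ele (Some n) (nu x).
Proof.
have [f fP] := choice (fun x => enat_exists (mult_ge0 x) (@mult_ge_mono x)).
have f1 : mf_support f = [set x | mult_ge d lam pt x 1].
  apply/seteqP; split=> x; rewrite /mf_support /= fP; first by case: (f x) => [[|a]|] //= [].
  by case: (f x) => [[|a]|].
have fc : closed (mf_support f).
  rewrite f1 => x xc; apply/mult_ge1 => r r0.
  have [|y [/= y1 xy]] := xc [set y | d x y < r / 2].
    by apply/nbhsd; exists (r / 2) => //; rewrite divr_gt0.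
  have r20 : 0 < r / 2 by rewrite divr_gt0.
  have [i l0 yi] := (mult_ge1 y).1 y1 _ r20.
  by exists i => //; have := d3 x y (pt i); lra.
have fl x : limit_point (mf_support f) x -> f x = None.
  rewrite f1 => lx; have := mult_ge_limit lx.
  case fx : (f x) => [a|] // /(_ a.+1); rewrite fP fx /= ltnn.
  done.
by exists (MultFun fc fl).
Qed.

End OneFamily.

Section SumFamily.
Variables (I J : eqType) (lam : I -> R) (mu : J -> R) (pt : I -> X) (qt : J -> X).

Definition sum_family (T : Type) (f : I -> T) (g : J -> T) (k : I + J) : T :=
  match k with inl i => f i | inr j => g j end.

(** From left to right, the way in which [n] splits may vary with the radius. But there are finitely
    many splittings: if each failed at some radius, then all would fail at a common smaller one. *)
Lemma mult_ge_sum x n : mult_ge d (sum_family lam mu) (sum_family pt qt) x n <->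
  exists k l, [/\ n = (k + l)%N, mult_ge d lam pt x k & mult_ge d mu qt x l].
Proof.
split=> [xn|[k [l [-> xk xl]]] r r0]; last first.
  have [s [us sk sP]] := xk r r0; have [t [ut tl tP]] := xl r r0.
  exists (map inl s ++ map inr t); split.
  - rewrite cat_uniq !map_inj_uniq ?us ?ut ?andbT/=; do ?[by move=> ? ? []].
    by apply/hasPn => _ /mapP[j _ ->]; apply/negP => /mapP[].
  - by rewrite size_cat !size_map sk tl.
  - by move=> i; rewrite mem_cat => /orP[] /mapP[j js ->] /=; [exact: sP|exact: tP].
apply: contrapT => nkl.
have ex (k : nat) : exists r : R, 0 < r /\ ((k <= n)%N -> forall p, 0 < p -> p <= r ->
    ~ ((exists s : seq I, [/\ uniq s, size s = k & forall i, i \in s -> 0 < lam i /\ d x (pt i) < p]) /\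
       (exists s : seq J, [/\ uniq s, size s = (n - k)%N & forall j, j \in s -> 0 < mu j /\ d x (qt j) < p]))).
  apply: contrapT => nr; apply: nkl.
  have [kn|nk] := leqP k n; last first.
    by case: nr; exists 1; split=> // kn; rewrite ltnNge kn in nk.
  exists k, (n - k)%N; split; first by rewrite subnKC.
    move=> r r0; apply: contrapT => ns; apply: nr; exists r; split=> // _ p p0 pr [[s [us sk sP]] _].
    apply: ns; exists s; split=> // i /sP[l0 xi]; split=> //; exact: lt_le_trans pr.
  move=> r r0; apply: contrapT => ns; apply: nr; exists r; split=> // _ p p0 pr [_ [s [us sk sP]]].
  apply: ns; exists s; split=> // i /sP[l0 xi]; split=> //; exact: lt_le_trans pr.
have [r rP] := choice ex.
have [|p p0 pP] := @exists_lower_bound _ _ (iota 0 n.+1) r; first by move=> k _; have [] := rP k.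
have [s [us sn sP]] := xn p p0.
pose sl := pmap (fun k : I + J => if k is inl i then Some i else None) s.
pose sr := pmap (fun k : I + J => if k is inr j then Some j else None) s.
have szs : (size sl + size sr = n)%N.
  rewrite -sn /sl /sr; elim: (s) => [|[i|j] t IHt] //=; first by rewrite addSn IHt.
  by rewrite addnS IHt.
have sls i : i \in sl = (inl i \in s).
  rewrite /sl; elim: (s) => [|[i'|j] t IHt] //=; rewrite !inE IHt//.
have srs j : j \in sr = (inr j \in s).
  rewrite /sr; elim: (s) => [|[i'|j'] t IHt] //=; rewrite !inE IHt//.
have usl : uniq sl by apply: (@pmap_uniq _ _ _ inl) => //; case.
have usr : uniq sr by apply: (@pmap_uniq _ _ _ inr) => //; case.
have kn : (size sl <= n)%N by rewrite -szs leq_addr.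
have [_ /(_ kn p p0)] := rP (size sl); apply.
  by apply: pP; rewrite mem_iota.
split; [exists sl|exists sr]; split=> //.
- by move=> i; rewrite sls => /sP.
- by rewrite -szs addKn.
- by move=> j; rewrite srs => /sP.
Qed.

End SumFamily.

End Multiplicity.

(** * Direct sums *)

Section DirectSumRepresentation.
Variables (R : realType) (X : topologicalType) (cX : compact [set: X]) (H : hilbertType R).
Variable U : doubling H.
Local Notation K := (compactOp H).
Local Notation C := (cfun cX K).
Implicit Types V : contraction H.

Lemma left_summand_exists V : exists L : contraction H,
  (forall z, L z = U (V z, 0)) /\ (forall z, adj L z = adj V (dbl_inv U z).1).
Proof.
have lin : linear (fun z => U (V z, 0)).
  move=> k x y; rewrite ctr_linear -dbl_linear; congr (U _).
  by rewrite -[_ *: _ + _]/(_, _) /= scaler0 addr0.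
have ad : adjoint_of (fun z => U (V z, 0)) (fun z => adj V (dbl_inv U z).1).
  by move=> x y; rewrite -{1}(dbl_invK U y) dbl_dot /= dot0l addr0 ctr_dot.
have le z : rnorm (U (V z, 0)) <= rnorm z.
  rewrite -ler_sqr ?nnegrE ?rnorm_ge0// dbl_rnorm /= rnorm0 expr0n addr0.
  by rewrite ler_sqr ?nnegrE ?rnorm_ge0// ctr_le.
by exists (Contraction lin ad le).
Qed.

Lemma right_summand_exists V : exists L : contraction H,
  (forall z, L z = U (0, V z)) /\ (forall z, adj L z = adj V (dbl_inv U z).2).
Proof.
have lin : linear (fun z => U (0, V z)).
  move=> k x y; rewrite ctr_linear -dbl_linear; congr (U _).
  by rewrite -[_ *: _ + _]/(_, _) /= scaler0 addr0.
have ad : adjoint_of (fun z => U (0, V z)) (fun z => adj V (dbl_inv U z).2).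
  by move=> x y; rewrite -{1}(dbl_invK U y) dbl_dot /= dot0l add0r ctr_dot.
have le z : rnorm (U (0, V z)) <= rnorm z.
  rewrite -ler_sqr ?nnegrE ?rnorm_ge0// dbl_rnorm /= rnorm0 expr0n add0r.
  by rewrite ler_sqr ?nnegrE ?rnorm_ge0// ctr_le.
by exists (Contraction lin ad le).
Qed.

Lemma dsum_rnorm_le (S T : K) (M : R) : rnorm S <= M -> rnorm T <= M -> rnorm (dsum U S T) <= M.
Proof.
move=> SM TM; rewrite -lecR -rnormE; apply: dsum_norm_le; by rewrite rnormE lecR.
Qed.

Variables (I J : eqType) (lam : I -> R) (mu : J -> R) (pt : I -> X) (qt : J -> X).
Variables (V : I -> contraction H) (W : J -> contraction H).
Variables (phi psi : cpcoz C K).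

(** Through [U] the two families are placed in the two summands of H + H, which makes their ranges
    orthogonal to each other. *)
Lemma representation_dsum : representation lam pt V phi -> representation mu qt W psi ->
  exists VW : I + J -> contraction H,
    representation (sum_family lam mu) (sum_family pt qt) VW (oz_dsum U phi psi).
Proof.
move=> rphi rpsi.
have [L LP] := choice (fun i => left_summand_exists (V i)).
have [M MP] := choice (fun j => right_summand_exists (W j)).
have LE i z : L i z = U (V i z, 0) by have [->] := LP i.
have LA i z : adj (L i) z = adj (V i) (dbl_inv U z).1 by have [_ ->] := LP i.
have ME i z : M i z = U (0, W i z) by have [->] := MP i.
have MA i z : adj (M i) z = adj (W i) (dbl_inv U z).2 by have [_ ->] := MP i.
have U0 : U (0, 0) = 0.
  have := dbl_linear U 1 0 0; rewrite !scale1r addr0 => /eqP.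
  by rewrite -subr_eq0 opprD addrA subrr sub0r oppr_eq0 => /eqP.
have UD x y x' y' : U (x + x', y + y') = U (x, y) + U (x', y').
  by have := dbl_linear U 1 (x, y) (x', y'); rewrite !scale1r.
have UDl x x' : U (x + x', 0) = U (x, 0) + U (x', 0) by rewrite -UD addr0.
have UDr x x' : U (0, x + x') = U (0, x) + U (0, x') by rewrite -UD addr0.
have UZ k x y : U (k *: x, k *: y) = k *: U (x, y).
  have h := dbl_linear U k (x, y) (0, 0); rewrite U0 in h.
  rewrite -[RHS]addr0 -h; congr (U _).
  by rewrite -[RHS]/(_, _) /= !addr0.
exists (sum_family L M); split.
- by case=> [i|j]; [exact: (rep_ge0 rphi)|exact: (rep_ge0 rpsi)].
- by case=> [i|j]; [exact: (rep_le1 rphi)|exact: (rep_le1 rpsi)].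
- move=> [i|i] [j|j] /= i0 j0 eta; rewrite ?LA ?MA ?LE ?ME ?dbl_funK /=.
  + exact: (rep_orth rphi).
  + by rewrite adj0.
  + by rewrite adj0.
  + exact: (rep_orth rpsi).
- move=> [i|j] /= l0 F eta; rewrite ?LE ?ME /dsum_fun dbl_funK /= ?op0.
  + by rewrite (rep_diag rphi)// -UZ scaler0.
  + by rewrite (rep_diag rpsi)// -UZ scaler0.
move=> r r0; have [s [us sA sF]] := rep_approx rphi r0.
have [t [ut tA tF]] := rep_approx rpsi r0.
exists (map inl s ++ map inr t); split.
- rewrite cat_uniq !map_inj_uniq ?us ?ut ?andbT/=; do ?[by move=> ? ? []].
  by apply/hasPn => _ /mapP[j _ ->]; apply/negP => /mapP[].
- by move=> i; rewrite mem_cat => /orP[] /mapP[j js ->] /=; [exact: sA|exact: tA].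
move=> F; apply: le_trans (dsum_rnorm_le (sF F) (tF F)).
rewrite le_eqVlt; apply/orP; left; apply/eqP; congr rnorm.
apply: opP => z; rewrite op_funB sum_op big_cat !big_map /= /dsum_fun.
have E1 : \sum_(i <- s) sand_fun (L i) ((lam i)%:C *: F (pt i)) (L i) z =
    U ((\sum_(i <- s) sand (V i) ((lam i)%:C *: F (pt i)) (V i)) (dbl_inv U z).1, 0).
  elim: (s) => [|i s' IHs]; first by rewrite !big_nil U0.
  by rewrite !big_cons IHs op_funD UDl /sand_fun LE LA.
have E2 : \sum_(j <- t) sand_fun (M j) ((mu j)%:C *: F (qt j)) (M j) z =
    U (0, (\sum_(j <- t) sand (W j) ((mu j)%:C *: F (qt j)) (W j)) (dbl_inv U z).2).
  elim: (t) => [|j t' IHt]; first by rewrite !big_nil U0.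
  by rewrite !big_cons IHt op_funD UDr /sand_fun ME MA.
rewrite E1 E2 -UD addr0 add0r !op_funB UD; congr (_ + _).
by rewrite -scaleN1r -UZ !scaleN1r.
Qed.

End DirectSumRepresentation.

(** * Diagonal order zero maps *)

Section Converges.
Variables (R : realType).

Definition converges (V : normedModType R[i]) (w : nat -> V) (l : V) :=
  forall r : R, 0 < r -> exists N, forall n, (N <= n)%N -> rnorm (l - w n) <= r.

Lemma converges_uniq (V : normedModType R[i]) (w : nat -> V) l l' :
  converges w l -> converges w l' -> l = l'.
Proof.
move=> wl wl'; apply/eqP; rewrite -subr_eq0; apply/eqP; apply: rnorm_small => r r0.
have r20 : 0 < r / 2 by rewrite divr_gt0.
have [N1 h1] := wl _ r20; have [N2 h2] := wl' _ r20.
have := h1 (maxn N1 N2) (leq_maxl _ _); have := h2 (maxn N1 N2) (leq_maxr _ _).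
set x := w _ => h3 h4; rewrite (le_trans (rnormB3 _ x _))// (rnormBC x).
lra.
Qed.

Lemma converges_eventually (V : normedModType R[i]) (w : nat -> V) l M :
  (forall n, (M <= n)%N -> w n = l) -> converges w l.
Proof. by move=> wl r r0; exists M => n Mn; rewrite wl// subrr rnorm0 ltW. Qed.

Lemma convergesD (V : normedModType R[i]) (w w' : nat -> V) l l' :
  converges w l -> converges w' l' -> converges (fun n => w n + w' n) (l + l').
Proof.
move=> wl wl' r r0; have r20 : 0 < r / 2 by rewrite divr_gt0.
have [N1 h1] := wl _ r20; have [N2 h2] := wl' _ r20.
exists (maxn N1 N2) => n; rewrite geq_max => /andP[/h1 n1 /h2 n2].
by rewrite opprD addrACA (le_trans (rnormD _ _))//; lra.
Qed.

Lemma converges_map (V W : normedModType R[i]) (f : V -> W) (M : R) (w : nat -> V) l :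
  (forall x y, rnorm (f x - f y) <= M * rnorm (x - y)) -> converges w l ->
  converges (fun n => f (w n)) (f l).
Proof.
move=> fM wl r r0; have M1 : 0 < `|M| + 1 by rewrite ltr_wpDl.
have [N h] := wl _ (divr_gt0 r0 M1); exists N => n /h wn.
rewrite (le_trans (fM _ _))// (le_trans (ler_wpM2r (rnorm_ge0 _) (ler_norm M)))//.
rewrite (le_trans (ler_wpM2l (normr_ge0 M) wn))//.
by rewrite mulrCA ger_pMr// ler_pdivrMr// mul1r lerDl.
Qed.

Lemma convergesM (A : cstarType R) (w w' : nat -> A) l l' :
  converges w l -> converges w' l' -> converges (fun n => cmul (w n) (w' n)) (cmul l l').
Proof.
move=> wl wl' r r0.
pose N := rnorm l + rnorm l' + 1.
have N0 : 0 < N by rewrite ltr_wpDl// addr_ge0 ?rnorm_ge0.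
have d0 : 0 < r / N by rewrite divr_gt0.
have [N1 h1] := wl _ d0; have [N2 h2] := wl' _ d0; have [N3 h3] := wl' _ ltr01.
exists (maxn N1 (maxn N2 N3)) => n; rewrite !geq_max => /and3P[/h1 n1 /h2 n2 /h3 n3].
have -> : cmul l l' - cmul (w n) (w' n) = cmul l (l' - w' n) + cmul (l - w n) (w' n).
  by rewrite cmulBr cmulBl addrA subrK.
rewrite (le_trans (rnormD _ _))// (le_trans (lerD (cnorm_rM _ _) (cnorm_rM _ _)))//.
have wn : rnorm (w' n) <= rnorm l' + 1.
  by rewrite -(subrK l' (w' n)) (le_trans (rnormD _ _))// addrC lerD2l rnormBC.
have rN : r = rnorm l * (r / N) + (r / N) * (rnorm l' + 1).
  by rewrite mulrC -mulrDr addrA divfK// gt_eqF.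
rewrite [leRHS]rN lerD//; first by rewrite ler_wpM2l ?rnorm_ge0.
by rewrite ler_pM ?rnorm_ge0.
Qed.

Lemma converges_rnorm_le (V : normedModType R[i]) (w : nat -> V) l (M : R) :
  converges w l -> (forall n, rnorm (w n) <= M) -> rnorm l <= M.
Proof.
move=> wl wM; apply/ler_addgt0Pr => r r0; have [N h] := wl _ r0.
rewrite -(subrK (w N) l) (le_trans (rnormD _ _))// addrC lerD//; exact: h.
Qed.

Lemma cauchy_family (V : completeNormedModType R[i]) (I : Type) (ev : nat -> I -> V)
    (a : I -> R) : (forall i, 0 <= a i) ->
  (forall r : R, 0 < r -> exists N, forall n, (N <= n)%N ->
     forall i, rnorm (ev N i - ev n i) <= r * a i) ->
  exists g : I -> V, forall r : R, 0 < r -> exists N, forall n, (N <= n)%N ->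
     forall i, rnorm (g i - ev n i) <= r * a i.
Proof.
move=> a0 evC; have [|g gP] := @unif_limit R V I nat ev a \oo _ a0.
  by move=> r r0; have [N evN] := evC r r0; exists N, N.
by exists g => r r0; have [N _ gN] := gP r r0; exists N.
Qed.

End Converges.

(** * Isometries obtained from an orthonormal basis *)

Section Isometries.
Variables (R : realType) (H : hilbertType R) (e : nat -> H).
Hypothesis eB : orthonormal_basis e.

Lemma basis_ext x y : (forall k, hdot H x (e k) = hdot H y (e k)) -> x = y.
Proof.
move=> xy; apply: (@converges_uniq _ _ (fun n => fourier e n x)) => r r0.
  exact: eB.2.
have [N h] := eB.2 y _ r0; exists N => n /h.
rewrite (_ : fourier e n x = fourier e n y)//.
by apply: eq_bigr => k _; rewrite xy.
Qed.

Lemma fourier_diff (v : nat -> H) m n z : (forall i j, hdot H (v i) (v j) = (i == j)%:R) ->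
  (m <= n)%N ->
  rnorm (\sum_(k < m) hdot H z (e k) *: v k - \sum_(k < n) hdot H z (e k) *: v k) ^+ 2 =
  \sum_(m <= k < n) rnorm (hdot H z (e k)) ^+ 2.
Proof.
move=> vo mn; rewrite rnormBC.
have -> : \sum_(k < n) hdot H z (e k) *: v k - \sum_(k < m) hdot H z (e k) *: v k =
    \sum_(m <= k < n) hdot H z (e k) *: v k.
  pose F k := hdot H z (e k) *: v k.
  have E p : \sum_(k < p) hdot H z (e k) *: v k = \sum_(0 <= k < p) F k by rewrite big_mkord.
  by rewrite !E (big_cat_nat (leq0n m) mn)/= addrAC subrr add0r.
rewrite pythagoras_sum ?iota_uniq//; last first.
  by move=> i j _ _ ij; rewrite dotZl dotZr vo (negPf ij) !mulr0.
apply: eq_bigr => k _; have vk : rnorm (v k) = 1.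
  apply/eqP; rewrite -sqrp_eq1 ?rnorm_ge0//; apply/eqP.
  by apply: complexI; rewrite -dotxx vo eqxx.
by rewrite rnormZ vk mulr1.
Qed.

(** The sums of <z, e_k> v_k are Cauchy because their increments have the same norms as those of the
    Fourier sums of z. *)
Lemma isometry_exists (v : nat -> H) : (forall i j, hdot H (v i) (v j) = (i == j)%:R) ->
  exists V : contraction H, forall k, V (e k) = v k.
Proof.
move=> vo; pose g n z := \sum_(k < n) hdot H z (e k) *: v k.
have eo := eB.1.
have gf m n z : (m <= n)%N -> rnorm (g m z - g n z) = rnorm (fourier e m z - fourier e n z).
  move=> mn; apply/eqP; rewrite -(@eqrXn2 _ 2) ?rnorm_ge0//.
  by rewrite fourier_diff// fourier_diff.
have ex z : exists l, converges (fun n => g n z) l.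
  have [|r r0|l lP] := @cauchy_family _ H unit (fun n _ => g n z) (fun=> 1); first by [].
    have r20 : 0 < r / 2 by rewrite divr_gt0.
    have [N zN] := eB.2 z _ r20; exists N => n Nn _.
    rewrite gf// mulr1 (le_trans (rnormB3 _ z _))// (rnormBC _ z).
    by have := zN _ Nn; have := zN _ (leqnn N); lra.
  exists (l tt) => r r0; have [N lN] := lP r r0; exists N => n Nn.
  by have := lN n Nn tt; rewrite mulr1.
have [f fP] := choice ex.
have fl : linear f.
  move=> k x y; apply: (converges_uniq (fP _)).
  have h : converges (fun n => k *: g n x + g n y) (k *: f x + f y).
    apply: convergesD; last exact: fP.
    by apply: (@converges_map _ _ _ _ (rnorm k)) (fP x) => a b; rewrite -scalerBr rnormZ.
  move=> r r0; have [N hN] := h r r0; exists N => n /hN.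
  rewrite (_ : g n (k *: x + y) = k *: g n x + g n y)//.
  rewrite /g scaler_sumr -big_split; apply: eq_bigr => i _.
  by rewrite dotDl dotZl scalerDl scalerA.
have f1 z : rnorm (f z) <= rnorm z.
  apply: converges_rnorm_le (fP z) _ => n.
  have := gf 0%N n z (leq0n n); rewrite /g /fourier !big_ord0 !sub0r !rnormN => ->.
  exact: fourier_le (basis_upto eB (n := n)).
have [V VE] := contraction_exists fl f1.
exists V => k; rewrite VE; apply: (converges_uniq (fP _)).
apply: (@converges_eventually _ _ _ _ k.+1) => n kn.
rewrite /g (bigD1 (Ordinal kn))//= eo eqxx scale1r big1 ?addr0// => i ik.
by rewrite eo -[k]/(val (Ordinal kn)) val_eqE eq_sym (negPf ik) scale0r.
Qed.

(** Isometries as in a Cuntz algebra: S_m sends e_k to the basis vector numbered by the code of (m,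
    k), and codes of distinct pairs are distinct. *)
Lemma isometry_family : exists S : nat -> contraction H, orthogonal_family (fun=> True) S.
Proof.
have ex (m : nat) : exists V : contraction H, forall k, V (e k) = e (pickle (m, k)).
  apply: isometry_exists => i j; rewrite eB.1; congr (nat_of_bool _)%:R.
  by rewrite (inj_eq (pcan_inj pickleK)) xpair_eqE eqxx.
have [S SP] := choice ex.
exists S => i j _ _ eta; apply: basis_ext => k.
rewrite -ctr_dotr SP.
have jE : adj (S j) (e (pickle (i, k))) = if i == j then e k else 0.
  apply: basis_ext => l; rewrite -ctr_dotr SP eB.1 (inj_eq (pcan_inj pickleK)) xpair_eqE.
  by case: eqP => //= _; rewrite ?eB.1// dot0l.
rewrite ctr_dot jE; case: eqP => // _; first by rewrite dot0r dot0l.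
Qed.

End Isometries.

(** * Weighted sums of point evaluations *)

Section Construction.
Variables (R : realType) (X : topologicalType) (cX : compact [set: X]) (H : hilbertType R).
Local Notation K := (compactOp H).
Local Notation C := (cfun cX K).
Variables (pt : nat -> X) (S : nat -> contraction H).
Hypothesis So : orthogonal_family (fun=> True) S.
Implicit Types (w : nat -> R) (F G : C).

Definition null_weights w := (forall n, 0 <= w n <= 1) /\
  forall r : R, 0 < r -> exists N, forall n, (N <= n)%N -> w n <= r.

Definition partial_sum w n F : K :=
  \sum_(i <- iota 0 n) sand (S i) ((w i)%:C *: F (pt i)) (S i).

Lemma block_rnorm w m n F (r : R) : null_weights w -> 0 <= r ->
  (forall i, (m <= i)%N -> w i <= r) ->
  rnorm (\sum_(i <- iota m n) sand (S i) ((w i)%:C *: F (pt i)) (S i)) <= r * rnorm F.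
Proof.
move=> [w01 _] r0 wr.
apply: (@sand_sum_rnorm _ _ _ _ _ So _ (iota_uniq m n)) => //.
  by rewrite mulr_ge0 ?rnorm_ge0.
move=> i; rewrite mem_iota => /andP[mi _].
have /andP[w0 _] := w01 i.
by rewrite (rnorm_realC _ w0) ler_pM ?rnorm_ge0 ?wr// cfun_rnorm_le.
Qed.

Lemma partial_rnorm w n F : null_weights w -> rnorm (partial_sum w n F) <= rnorm F.
Proof.
move=> wN; rewrite -[leRHS]mul1r; apply: block_rnorm => // i _.
by have [w01 _] := wN; have /andP[] := w01 i.
Qed.

Lemma partial_eval w n F j eta : (j < n)%N ->
  partial_sum w n F (S j eta) = S j ((w j)%:C *: F (pt j) eta).
Proof.
move=> jn; rewrite /partial_sum sum_op (bigD1_seq j) ?iota_uniq ?mem_iota//.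
rewrite sandE So// eqxx op_funZ big1 => [|i ij]; first exact: addr0.
by rewrite sandE So// (negPf ij) op0 ctr0.
Qed.

Lemma partialM w w' n F G :
  cmul (partial_sum w n F) (partial_sum w' n G) = partial_sum (fun i => w i * w' i) n (cmul F G).
Proof.
apply: opP => z; rewrite cmulE /partial_sum !sum_op big_seq [RHS]big_seq.
apply: eq_bigr => i ii; rewrite !sandE.
rewrite (family_adj_sum So (iota_uniq 0 n) (fun _ _ => Logic.I)
  (fun i => ((w' i)%:C *: G (pt i)) (adj (S i) z)))// ii.
by rewrite !op_funZ opZ scalerA cmulE -rmorphM.
Qed.

Lemma partial_star w n F : star (partial_sum w n F) = partial_sum w n (star F).
Proof.
rewrite /partial_sum star_sum; apply: eq_bigr => i _.
by rewrite sand_star starZ conj_Creal// complex_real.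
Qed.

Lemma partial_linear w n k F G :
  partial_sum w n (k *: F + G) = k *: partial_sum w n F + partial_sum w n G.
Proof.
rewrite /partial_sum scaler_sumr -big_split; apply: eq_bigr => i _.
by rewrite cfun_funD cfun_funZ scalerDr scalerA mulrC -scalerA sandD sandZ.
Qed.

Definition is_limit w (A : C -> K) := forall F, converges (fun n => partial_sum w n F) (A F).

(** A tail is a sum over orthogonal ranges, bounded by its largest weight; thus the weights only
    have to tend to 0, without being summable. *)
Lemma limit_exists w : null_weights w -> exists A : C -> K, is_limit w A /\
  forall r : R, 0 < r -> exists N, forall F, rnorm (A F - partial_sum w N F) <= r * rnorm F.
Proof.
move=> wN; have [_ w0] := wN.
have [|r r0|A AP] := @cauchy_family _ K C (fun n F => partial_sum w n F) (@rnorm R C).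
- exact: rnorm_ge0.
- have [N Nw] := w0 _ r0; exists N => n Nn F.
  rewrite /partial_sum -(subnKC Nn) iotaD add0n big_cat /= opprD addrA subrr sub0r rnormN.
  exact: block_rnorm (ltW r0) Nw.
exists A; split=> [F r r0|r r0]; last first.
  by have [N AN] := AP _ r0; exists N => F; exact: AN.
have F1 : 0 < rnorm F + 1 by rewrite ltr_wpDl ?rnorm_ge0.
have [N AN] := AP _ (divr_gt0 r0 F1); exists N => n Nn.
rewrite (le_trans (AN _ Nn F))// mulrAC ler_pdivrMr// ler_pM2l// lerDl.
exact: ler01.
Qed.

Lemma limit_linear w A : is_limit w A -> linear A.
Proof.
move=> Al k F G; apply: (converges_uniq (Al _)).
have h : converges (fun n => k *: partial_sum w n F + partial_sum w n G) (k *: A F + A G).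
  apply: convergesD; last exact: Al.
  by apply: (@converges_map _ _ _ _ (rnorm k)) (Al F) => a b; rewrite -scalerBr rnormZ.
by move=> r r0; have [N hN] := h r r0; exists N => n /hN; rewrite partial_linear.
Qed.

Lemma limitM w w' A B D F G : is_limit w A -> is_limit w' B ->
  is_limit (fun i => w i * w' i) D -> cmul (A F) (B G) = D (cmul F G).
Proof.
move=> Al Bl Dl; apply/esym; apply: (converges_uniq (Dl _)).
have h := convergesM (Al F) (Bl G).
by move=> r r0; have [N hN] := h r r0; exists N => n /hN; rewrite partialM.
Qed.

Lemma limit_star w A F : is_limit w A -> star (A F) = A (star F).
Proof.
move=> Al; apply/esym; apply: (converges_uniq (Al _)).
have h : converges (fun n => star (partial_sum w n F)) (star (A F)).
  by apply: (@converges_map _ _ _ _ 1) (Al F) => a b; rewrite -starB star_rnorm mul1r.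
by move=> r r0; have [N hN] := h r r0; exists N => n /hN; rewrite partial_star.
Qed.

Lemma limit_rnorm w A F : null_weights w -> is_limit w A -> rnorm (A F) <= rnorm F.
Proof.
by move=> wN Al; apply: converges_rnorm_le (Al F) _ => n; exact: partial_rnorm.
Qed.

Lemma null_weights_sqrt w : null_weights w -> null_weights (fun n => Num.sqrt (w n)).
Proof.
move=> [w01 w0]; split=> [n|r r0].
  have /andP[wn0 wn1] := w01 n; rewrite sqrtr_ge0 /=.
  by rewrite -[leRHS](@sqrtr1 R) ler_wsqrtr.
have [N Nw] := w0 _ (exprn_gt0 2 r0); exists N => n /Nw wn.
by rewrite -[leRHS]gtr0_norm// -sqrtr_sqr ler_wsqrtr.
Qed.

Lemma null_weights_sqr w : null_weights w -> null_weights (fun n => w n * w n).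
Proof.
move=> [w01 w0]; split=> [n|r r0].
  by have /andP[wn0 wn1] := w01 n; rewrite mulr_ge0//= mulr_ile1.
have [N Nw] := w0 _ r0; exists N => n /Nw wn; have /andP[wn0 wn1] := w01 n.
by rewrite (le_trans _ wn)// ler_piMl.
Qed.

Lemma weights_representation w : null_weights w -> exists phi : cpcoz C K, representation w pt S phi.
Proof.
move=> wN; have [w01 _] := wN.
have [A [Al Aapp]] := limit_exists wN.
(* The square roots of the weights give A(F^* G) = B(F)^* B(G), hence complete positivity. Their
   squares, below, give A(F) A(G) = D(F G), hence order zero. *)
have [B [Bl _]] := limit_exists (null_weights_sqrt wN).
have [D [Dl _]] := limit_exists (null_weights_sqr wN).
have BA F G : cmul (star (B F)) (B G) = A (cmul (star F) G).
  rewrite (limit_star _ Bl); apply: limitM => //.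
  rewrite (_ : (fun i => _) = w)//; apply/funext => i.
  by rewrite -expr2 sqr_sqrtr//; have /andP[] := w01 i.
have A_lin := limit_linear Al.
have A_D x y : A (x + y) = A x + A y by have := A_lin 1 x y; rewrite !scale1r.
have A_0 : A 0 = 0 by have /eqP := A_D 0 0; rewrite addr0 eq_sym -subr_eq0 addrK => /eqP.
have A_cp n (a : 'M[C]_n) : mxpos a -> mxpos (map_mx A a).
  move=> [c ac]; exists (map_mx B c) => i j; rewrite mxE ac.
  transitivity (\sum_(k < n) A (cmul (star (c k i)) (c k j))).
    by elim/big_rec2: _ => [|k p q _ <-]; rewrite ?A_0// A_D.
  by apply: eq_bigr => k _; rewrite !mxE BA.
have A_ctr a : `|A a| <= `|a| by rewrite !rnormE lecR; exact: (limit_rnorm _ wN Al).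
have A_oz (a b : C) : cpos a -> cpos b -> cmul a b = 0 -> cmul (A a) (A b) = 0.
  move=> _ _ ab; rewrite (limitM _ _ Al Al Dl) ab.
  (* D(0) = 0 comes from the same product formula at F = G = 0. *)
  by rewrite -(cmul0l (0 : C)) -(limitM 0 0 Al Al Dl) A_0 cmul0l.
exists (CPCOZ A_lin A_cp A_ctr A_oz); split=> [i|i|||] /=.
- by have /andP[] := w01 i.
- by have /andP[] := w01 i.
- by move=> i j _ _; exact: So.
- move=> j _ F eta; rewrite -ctrZ.
  apply: (@converges_uniq _ _ (fun n => partial_sum w n F (S j eta))).
    apply: (@converges_map _ _ _ (fun T : K => T (S j eta)) (rnorm (S j eta))) (Al F) => a b.
    by rewrite -op_funB mulrC rnorm_op_le.
  by apply: (@converges_eventually _ _ _ _ j.+1) => n jn; rewrite partial_eval.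
move=> r r0; have [N AN] := Aapp _ r0.
exists [seq i <- iota 0 N | 0 < w i]; split=> [|i|F].
- exact: filter_uniq (iota_uniq _ _).
- by rewrite mem_filter => /andP[].
have := AN F; rewrite /partial_sum (bigID (fun i => 0 < w i)) /= [X in _ - (_ + X)]big1 ?addr0.
  by rewrite big_filter.
move=> i; rewrite -leNgt => wi; have /andP[wi0 _] := w01 i.
have -> : w i = 0 by apply/eqP; rewrite eq_le wi.
by rewrite scale0r; apply: opP => z; rewrite sandE ctr0.
Qed.

End Construction.

Lemma zero_representation (R : realType) (X : topologicalType) (cX : compact [set: X])
  (H : hilbertType R) (x0 : X) :
  representation (fun _ : nat => 0 : R) (fun=> x0) (fun=> zero_ctr H)
    (oz_zero (cfun cX (compactOp H)) (compactOp H)).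
Proof.
split=> [//|i||i|]; first exact: ler01.
- by move=> i j; rewrite ltxx.
- by rewrite ltxx.
move=> r r0; exists [::]; split=> // F.
by rewrite big_nil subrr rnorm0 mulr_ge0 ?rnorm_ge0// ltW.
Qed.

(** * Classification *)

Section Realization.
Variables (R : realType) (X : topologicalType) (cX : compact [set: X]).
Variables (d : X -> X -> R).
Hypothesis d0P : forall x y, d x y = 0 <-> x = y.
Hypothesis dC : forall x y, d x y = d y x.
Hypothesis d3 : forall x y z, d x z <= d x y + d y z.
Hypothesis nbhsd : forall x (W : set X), nbhs x W <->
  exists2 r : R, 0 < r & [set y | d x y < r] `<=` W.

Lemma dense_sequence (x0 : X) (A : set X) : closed A -> exists s : nat -> X,
  forall x (r : R), A x -> 0 < r -> exists2 a, A (s a) & d x (s a) < r.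
Proof.
move=> cA; have cptA : compact A by exact: subclosed_compact cA cX _.
have ex (n : nat) : exists t : seq X, (forall y, y \in t -> A y) /\
    forall x, A x -> exists2 y, y \in t & d y x < n.+1%:R^-1.
  apply: (@compact_finite_cover _ _ (fun y => [set x | d y x < n.+1%:R^-1])) => // y Ay.
  by apply/nbhsd; exists n.+1%:R^-1 => //; rewrite invr_gt0 ltr0n.
have [t tP] := choice ex.
exists (fun m => if (unpickle m : option (nat * nat)) is Some q then nth x0 (t q.1) q.2 else x0).
move=> x r Ax r0; pose n := Num.truncn r^-1.
have nr : n.+1%:R^-1 < r.
  rewrite invf_plt ?posrE//.
  have rV : 0 <= r^-1 by rewrite invr_ge0 ltW.
  by have /andP[_] := truncn_itv rV.
have [tA tx] := tP n; have [y yt yx] := tx x Ax.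
exists (pickle (n, index y (t n))); rewrite pickleK /= nth_index//; first exact: tA.
by rewrite dC; exact: lt_trans nr.
Qed.

Lemma multfun_realization (x0 : X) (nu : multfun X) : exists (w : nat -> R) (pt : nat -> X),
  null_weights w /\ forall x n, mult_ge d w pt x n <-> ele (Some n) (nu x).
Proof.
pose A := mf_support nu.
have [s sD] := dense_sequence x0 (@mf_closed _ nu).
(* The index pickle (a, k) stands for the k-th copy of the point s a, for a the first
   index at which that point occurs; [unpickle] would not do for [pickle_inv] below,
   as it may decode numbers that are not codes. *)
pose good q := [/\ A (s q.1), forall b, (b < q.1)%N -> s b <> s q.1 &
  ele (Some q.2.+1) (nu (s q.1))].
pose act m := if @pickle_inv (nat * nat)%type m is Some q then `[< good q >] else false.
pose pt m := if @pickle_inv (nat * nat)%type m is Some q then s q.1 else x0.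
(* The weights must be positive exactly at the active indices and tend to 0; their actual size does
   not affect the multiplicity. *)
pose w m : R := if act m then m.+1%:R^-1 else 0.
have w01 m : 0 <= w m <= 1.
  rewrite /w; case: ifP => _; last by rewrite lexx ler01.
  by rewrite invr_ge0 ler0n /= invf_le1// ler1n.
have wp m : (0 < w m) = act m.
  by rewrite /w; case: ifP; rewrite ?ltxx// invr_gt0 ltr0n.
have actP m : act m -> exists q, [/\ m = pickle q, good q & pt m = s q.1].
  rewrite /act /pt; case E : pickle_inv => [q|] // /asboolP gq; exists q; split=> //.
  by have := @pickle_invK (nat * nat)%type m; rewrite E.
have actE q : good q -> act (pickle q) /\ pt (pickle q) = s q.1.
  by move=> gq; rewrite /act /pt pickleK_inv; split=> //; apply/asboolP.
exists w, pt; split.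
  split=> // r r0; pose N := Num.truncn r^-1; exists N => m Nm.
  rewrite /w; case: ifP => _; last exact: ltW.
  rewrite ltW// invf_plt ?posrE//.
  have rV : 0 <= r^-1 by rewrite invr_ge0 ltW.
  by have /andP[_ h] := truncn_itv rV; rewrite (lt_le_trans h)// ler_nat.
have firstP x : A x -> forall r, 0 < r -> exists a, [/\ A (s a), d x (s a) < r &
    forall b, (b < a)%N -> s b <> s a].
  move=> Ax r r0; have [a Aa xa] := sD x r Ax r0.
  have ex : exists b, s b == s a by exists a.
  exists (ex_minn ex); case: ex_minnP => b /eqP ba bmin; rewrite ba; split=> // c cb ca.
  by have := bmin c; rewrite ca eqxx => /(_ isT); rewrite leqNgt cb.
have A1 x : A x -> ele (Some 1%N) (nu x).
  by rewrite /A /mf_support /=; case: (nu x) => [[|n]|].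
have Amult x : A x -> mult_ge d w pt x 1.
  move=> Ax; apply/(mult_ge1 d) => r r0.
  have [a [Aa xa amin]] := firstP x Ax r r0.
  have [|h1 h2] := actE (a, 0%N); first by split=> //; exact: A1.
  by exists (pickle (a, 0%N)); rewrite ?wp ?h2.
move=> x n.
have [Ax|nAx] := pselect (A x); last first.
  have -> : nu x = Some 0%N by apply: contrapT.
  split=> [xn|/= n0]; last by move: n0; rewrite leqn0 => /eqP ->; exact: mult_ge0.
  rewrite /= leqn0; apply/negPn/negP => n0; apply: nAx; apply: (@mf_closed _ nu) => W.
  move=> /nbhsd[r r0 rW].
  have x1 : mult_ge d w pt x 1 by apply: mult_ge_mono xn; rewrite lt0n.
  have [i wi xi] := (mult_ge1 d w pt x).1 x1 r r0.
  have [q [_ [Aq _ _] ptq]] := actP i (etrans (esym (wp i)) wi).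
  by exists (pt i); split; [rewrite ptq|exact: rW].
have [lx|nlx] := pselect (limit_point A x).
  rewrite (mf_limit lx); split=> // _.
  apply: (mult_ge_limit d0P dC d3 nbhsd) => W /lx[y [yx Ay Wy]].
  by exists y; split=> //; exact: Amult.
(* Here [x] is isolated in [A]: active indices within [r0] sit at [x] itself, so they are the codes
   of pairs (a, k) with k + 1 at most [nu x]. *)
have [r0 r00 isol] : exists2 r0 : R, 0 < r0 & forall y, A y -> d x y < r0 -> y = x.
  apply: contrapT => nr; apply: nlx => W /nbhsd[r rp rW].
  apply: contrapT => ny; apply: nr; exists r => // y Ay xy; apply: contrapT => yx.
  by apply: ny; exists y; split=> //; [apply/eqP|exact: rW].
have [a [Aa xa amin]] := firstP x Ax r0 r00.
have sa : s a = x by exact: isol.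
split=> [xn|nx r rp].
  have [t [ut tn tP]] := xn r0 r00.
  case nuE : (nu x) => [m|] //=.
  rewrite -tn -[leqRHS](size_iota 0) -(size_map (fun k => pickle (a, k)) (iota 0 m)).
  apply: uniq_leq_size => // i it; have [wi xi] := tP i it.
  have [[b k] [ib [/= Ab bmin bk] /= ptb]] := actP i (etrans (esym (wp i)) wi).
  have sb : s b = x by apply: isol => //; rewrite -ptb.
  have ab : a = b.
    have [lt|gt|//] := ltngtP a b; first by case: (bmin _ lt); rewrite sa sb.
    by case: (amin _ gt); rewrite sa sb.
  by rewrite ib ab; apply/mapP; exists k => //; rewrite mem_iota /=; move: bk; rewrite sb nuE.
exists [seq pickle (a, k) | k <- iota 0 n]; split.
- rewrite map_inj_uniq ?iota_uniq// => k l /(pcan_inj pickleK)[->]//.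
- by rewrite size_map size_iota.
move=> i /mapP[k]; rewrite mem_iota => /andP[_ kn] ->.
have [|h1 h2] := actE (a, k).
  split=> //=; rewrite sa; move: nx kn; case: (nu x) => //= m nm kn.
  exact: leq_trans kn nm.
by rewrite wp h1 h2 /= sa (d0P x x).2.
Qed.

End Realization.

Section Classification.
Variables (R : realType) (X : topologicalType) (cX : compact [set: X]) (H : hilbertType R).
Local Notation K := (compactOp H).
Local Notation C := (cfun cX K).
Variables (d : X -> X -> R).
Hypothesis d0P : forall x y, d x y = 0 <-> x = y.
Hypothesis dC : forall x y, d x y = d y x.
Hypothesis d3 : forall x y z, d x z <= d x y + d y z.
Hypothesis nbhsd : forall x (W : set X), nbhs x W <->
  exists2 r : R, 0 < r & [set y | d x y < r] `<=` W.
Variables (e : nat -> H).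
Hypothesis eB : orthonormal_basis e.
Variable x0 : X.

(** A relation, since phi has many representations; that they all give the same function follows
    from the comparison result. *)
Definition has_multiplicity (phi : cpcoz C K) (nu : multfun X) :=
  exists (I : eqType) (lam : I -> R) (pt : I -> X) (V : I -> contraction H),
    representation lam pt V phi /\ forall x n, mult_ge d lam pt x n <-> ele (Some n) (nu x).

Lemma multiplicity_exists phi : exists nu, has_multiplicity phi nu.
Proof.
have [I [lam [pt [V rphi]]]] := oz_representation d0P dC d3 nbhsd eB phi x0.
have [nu nuP] := mult_multfun d0P dC d3 nbhsd lam pt.
by exists nu, I, lam, pt, V.
Qed.

Lemma multiplicity_le phi psi nu mu : has_multiplicity phi nu -> has_multiplicity psi mu ->
  cuntz_le phi psi <-> (nu <= mu)%O.
Proof.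
move=> [I [lam [pt [V [rphi nuP]]]]] [J [lam' [qt [W [rpsi muP]]]]]; split=> [pp|nm].
  apply/multfun_leP => x; apply/eleP => n /nuP xn; apply/muP.
  exact: (cuntz_le_mult dC d3 nbhsd eB rphi rpsi pp xn).
apply: (mult_cuntz_le d0P dC d3 nbhsd eB rphi rpsi) => x n /nuP xn; apply/muP.
by move/multfun_leP/(_ x)/eleP : nm; apply.
Qed.

(** [multiplicity_le] with one representation used twice gives that phi is below itself; applied to
    two representations of phi, it then compares their multiplicities both ways. *)
Lemma multiplicity_uniq phi nu mu : has_multiplicity phi nu -> has_multiplicity phi mu -> nu = mu.
Proof.
move=> pn pm; apply/le_anti/andP.
have := multiplicity_le pn pn => -[_ /(_ (lexx _)) pp].
by split; [apply/(multiplicity_le pn pm)|apply/(multiplicity_le pm pn)].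
Qed.

Lemma multiplicity_onto nu : exists phi, has_multiplicity phi nu.
Proof.
have [w [pt [wN wP]]] := multfun_realization cX d0P dC d3 nbhsd x0 nu.
have [S So] := isometry_family eB.
have [phi rphi] := weights_representation cX pt So wN.
by exists phi, nat, w, pt, S.
Qed.

Lemma multiplicity_zero : has_multiplicity (oz_zero C K) 0.
Proof.
exists nat, (fun=> 0), (fun=> x0), (fun=> zero_ctr H).
split; first exact: zero_representation.
move=> x n /=; rewrite leqn0; split=> [|/eqP ->]; last exact: mult_ge0.
case: n => // n /(_ 1 ltr01)[[|i s] [_ //= _ /(_ i)]].
by rewrite inE eqxx ltxx => /(_ isT)[].
Qed.

Lemma multiplicity_dsum (U : doubling H) phi psi nu mu :
  has_multiplicity phi nu -> has_multiplicity psi mu ->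
  has_multiplicity (oz_dsum U phi psi) (nu + mu).
Proof.
move=> [I [lam [pt [V [rphi nuP]]]]] [J [lam' [qt [W [rpsi muP]]]]].
have [VW rsum] := representation_dsum U rphi rpsi.
exists (I + J)%type, (sum_family lam lam'), (sum_family pt qt), VW; split=> // x n.
rewrite multfun_addE eleD; split=> [/mult_ge_sum[k [l [-> xk xl]]]|[k [l [-> xk xl]]]].
  by exists k, l; split=> //; [exact/nuP|exact/muP].
by apply/mult_ge_sum; exists k, l; split=> //; [exact/nuP|exact/muP].
Qed.

End Classification.

Lemma inj_surj_bijective (A : Type) (B : Type) (f : A -> B) : injective f ->
  (forall b, exists a, f a = b) -> bijective f.
Proof.
move=> fi fs; have [g gP] := choice fs.
by exists g => // a; apply: fi; rewrite gP.
Qed.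

Theorem corollary5p20 (R : realType)
    (X : topologicalType) (cX : compact [set: X]) (hX : hausdorff_space X)
    (mX : metrizable R X)
    (H : hilbertType R) (sH : separable H) (iH : infinite_dimensional H) :
  exists N : cuntz_homology cX H -> multfun X,
    [/\ bijective N,
        forall phi psi : cpcoz (cfun cX (compactOp H)) (compactOp H),
          cuntz_le phi psi <-> (N (cuntz_class phi) <= N (cuntz_class psi))%O,
        N (cuntz_class (oz_zero (cfun cX (compactOp H)) (compactOp H))) = 0
      & forall (U : doubling H)
               (phi psi : cpcoz (cfun cX (compactOp H)) (compactOp H)),
          N (cuntz_class (oz_dsum U phi psi)) =
          N (cuntz_class phi) + N (cuntz_class psi)].
Proof.
have [e eB] := orthonormal_basis_exists sH iH.
have [d [d0P dC d3 nbhsd]] := mX.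
(* Representations use a default point of [X]. Over the empty space the algebra C(X, K) is 0, and
   both monoids have a single element. *)
have [x0|X0] := pselect (inhabited X); last first.
  have leT (phi psi : cpcoz (cfun cX (compactOp H)) (compactOp H)) : cuntz_le phi psi.
    exists (fun=> 0) => a; apply/cvg_rnormP => r r0; exists 0%N => n _.
    have -> : a = 0 by apply: cfunP => x; case: X0.
    by rewrite oz0 cmul0r subrr rnorm0.
  have nuE (nu mu : multfun X) : nu = mu by apply: multfunP => x; case: X0.
  exists (fun=> 0); split=> [|phi psi|//|U phi psi]; last 2 first.
  - by split.
  - exact: nuE.
  apply: inj_surj_bijective => [[c cP] [c' cP'] _|nu].
    apply: eq_exist => /=; have [phi cE] := cP; have [phi' cE'] := cP'.
    by rewrite cE cE'; apply/seteqP; split=> psi _; split; exact: leT.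
  by exists (cuntz_class (oz_zero _ _)); exact: nuE.
have [x] := x0.
have mult_ex := multiplicity_exists (cX := cX) d0P dC d3 nbhsd eB x.
have [m mP] := choice mult_ex.
have mle phi psi := multiplicity_le d0P dC d3 nbhsd eB (mP phi) (mP psi).
have meq phi psi : cuntz_eq phi psi <-> m phi = m psi.
  split=> [[/mle h1 /mle h2]|h]; first by apply/le_anti; rewrite h1.
  by split; apply/mle; rewrite h.
(* Classes are sets of maps; the isomorphism is the multiplicity of a chosen representative,
   independent of the choice by [meq]. *)
pose rep (c : cuntz_homology cX H) := sval (cid (svalP c)).
have repP c : sval c = [set psi | cuntz_eq (rep c) psi] by rewrite /rep; case: cid.
have rep_class phi : m (rep (cuntz_class phi)) = m phi.
  have : sval (cuntz_class phi) (rep (cuntz_class phi)) by rewrite repP /=; apply/meq.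
  by move/meq.
have uniq := multiplicity_uniq d0P dC d3 nbhsd eB.
exists (fun c => m (rep c)); split.
- apply: inj_surj_bijective => [c c' cc|nu].
    have : sval c = sval c'.
      by rewrite !repP; apply/seteqP; split=> psi /meq h; apply/meq; rewrite -h.
    by case: c c' {cc} => [c cP] [c' cP'] /= cc; exact: eq_exist.
  have [phi pnu] := multiplicity_onto cX d0P dC d3 nbhsd eB x nu.
  by exists (cuntz_class phi); rewrite rep_class; exact: uniq (mP phi) pnu.
- by move=> phi psi; rewrite !rep_class.
- by rewrite rep_class; exact: uniq (mP _) (multiplicity_zero _ _ _ _).
- move=> U phi psi; rewrite !rep_class; apply: uniq (mP _) _.
  exact: multiplicity_dsum.
Qed.
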